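(* Let $(M,g)$ be a connected smooth parallelizable $4$-manifold without boundary (not necessarily compact), equipped with a time-orientable Lorentzian metric $g$ of signature $(+,+,+,-)$. Fix an orientation of $M$, a reference timelike covector field $q$, and values $\mathbf c_{\mathrm{top}},\mathbf c_{\mathrm{tem}}\in\{+1,-1\}$ of the topological and temporal charges. Then the analytic definition of spin structure and the traditional definition of spin structure on $M$ (both spelled out in the context) are equivalent, in the following sense. Fix a reference framing $b=(b_1,b_2,b_3,b_4)$ of $M$. For an admissible operator $L$ with associated framing $e=(e_1,e_2,e_3,e_4)$, let $f_L:M\to SO^+(3,1)$ be the unique smooth function with $e_k=\sum_j b_j\,(f_L)^j{}_k$, and let $$\Phi_L:M\times SL(2,\mathbb C)\to M\times SO^+(3,1),\qquad \Phi_L(x,h)=(x,\,f_L(x)\cdot\operatorname{Ad}h).$$ Then $L\mapsto\Phi_L$ induces a well-defined bijection from the set of analytic spin structures (equivalence classes of admissible operators) onto the set of traditional spin structures (equivalence classes of equivariant maps $\Phi$) on $M$.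
   Context: All objects (functions, vector fields, metrics, coefficients of operators, maps) are $C^\infty$. Latin indices number frame vectors, Greek indices are coordinate indices, and repeated indices are summed. Operators. Consider first order linear differential operators $L$ acting on $2$-columns of complex-valued half-densities on $M$ (a half-density transforms under coordinate changes as the square root of a density). The inner product on compactly supported $2$-columns is $\langle v,w\rangle=\int_M w^*v\,dx$, and formal self-adjointness is with respect to it. In local coordinates $L=F^\alpha(x)\,\partial/\partial x^\alpha+G(x)$ with $2\times2$ matrix-functions $F^\alpha,G$. The principal symbol is $L_{\mathrm{prin}}(x,p)=iF^\alpha(x)p_\alpha$ and the subprincipal symbol is $L_{\mathrm{sub}}(x)=G(x)-\frac12(F^\alpha)_{x^\alpha}(x)$. Both are invariantly defined matrix-functions, on $T^*M$ and $M$ respectively. They determine $L$ uniquely, and $L$ is formally self-adjoint if and only if both are Hermitian. $L$ is non-degenerate if $L_{\mathrm{prin}}(x,p)\neq0$ for all $(x,p)\in T^*M$ with $p\ne0$. Tetrads. Let $$s^1=\begin{pmatrix}0&1\\1&0\end{pmatrix},\quad s^2=\begin{pmatrix}0&-i\\i&0\end{pmatrix},\quad s^3=\begin{pmatrix}1&0\\0&-1\end{pmatrix},\quad s^4=\begin{pmatrix}1&0\\0&1\end{pmatrix}.$$ For $L$ formally self-adjoint, write $L_{\mathrm{prin}}(x,p)=s^j e_j{}^\alpha(x)p_\alpha$. This defines real vector fields $e_1,\dots,e_4$, and gives a one-to-one correspondence between Hermitian principal symbols and tetrads of real vector fields. $L$ is non-degenerate if and only if $e_1,\dots,e_4$ are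 everywhere linearly independent. Metric and charges. A vector field $u$ is timelike if $g_{\alpha\beta}u^\alpha u^\beta<0$ at every point, and similarly for covector fields using $g^{\alpha\beta}$. $(M,g)$ is time-orientable if it admits a timelike vector field. A non-degenerate formally self-adjoint $L$ corresponds to $g$ if $\det L_{\mathrm{prin}}(x,p)=-g^{\alpha\beta}(x)p_\alpha p_\beta$. Equivalently, $(e_j)$ is Lorentz-orthonormal: $g(e_j,e_k)=0$ for $j\ne k$, $g(e_j,e_j)=1$ for $j=1,2,3$, and $g(e_4,e_4)=-1$. The topological charge of $L$ is $\operatorname{sgn}\det(e_j{}^\alpha)$ in positively oriented local coordinates. The temporal charge of $L$ is $\operatorname{sgn}\operatorname{tr}L_{\mathrm{prin}}(x,q(x))=\operatorname{sgn}(q_\alpha e_4{}^\alpha)$. Admissible operators. These are the $2\times2$ formally self-adjoint non-degenerate first order linear differential operators corresponding to $g$ and having the fixed charges $\mathbf c_{\mathrm{top}},\mathbf c_{\mathrm{tem}}$. Framings. A framing is a Lorentz-orthonormal tetrad of smooth vector fields whose associated charges are the fixed ones. Equivalently, it is positively oriented and positively time-oriented for the corresponding choice of orientation and time orientation. $SO^+(3,1)$ is the identity component of the Lorentz group. Any two framings differ by a unique smooth function $M\to SO^+(3,1)$. The homomorphism $\operatorname{Ad}$. $\operatorname{Ad}:SL(2,\mathbb C)\to SO^+(3,1)$ is the standard double covering homomorphism, given by $R^*s^jR=\sum_k(\operatorname{Ad}R)^j{}_k\,s^k$. Analytic definition. Admissible operators $L,\tilde L$ are equivalent if there is a smooth $R:M\to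 SL(2,\mathbb C)$ with $\tilde L_{\mathrm{prin}}=R^*L_{\mathrm{prin}}R$. An analytic spin structure is an equivalence class of admissible operators. Traditional definition (for $M$ with $TM$ trivialized by the reference framing $b$, so that the bundle of framings is $M\times SO^+(3,1)$). Consider smooth maps $\Phi:M\times SL(2,\mathbb C)\to M\times SO^+(3,1)$ that commute with the projections $\pi$ to $M$ and satisfy $\Phi(x,h)=\Phi(x,1)\cdot\operatorname{Ad}h$ for all $x\in M$, $h\in SL(2,\mathbb C)$, where the group acts on the second factor by right multiplication. Two such maps $\Phi_1,\Phi_2$ are equivalent if there is a smooth map $A:M\times SL(2,\mathbb C)\to M\times SL(2,\mathbb C)$ with $\pi\circ A=\pi$, $A(x,h)=A(x,1)\cdot h$ for all $x,h$, and $\Phi_2\circ A=\Phi_1$. A traditional spin structure is an equivalence class of such maps $\Phi$. *)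

(* Defs.v *)
From HB Require Import structures.
From mathcomp Require Import all_boot all_order all_algebra.
From mathcomp Require Import all_classical all_reals all_analysis.
From mathcomp Require Import complex lra.
Set Implicit Arguments.
Unset Strict Implicit.
Unset Printing Implicit Defensive.
Import Order.TTheory GRing.Theory Num.Theory.
Import numFieldNormedType.Exports.
Local Open Scope classical_set_scope.
Local Open Scope complex_scope.
Local Open Scope ring_scope.

Section Calculus.
Context {R : realType}.

Definition partial {n} (a : 'I_n) (f : 'rV[R]_n -> R) (y : 'rV[R]_n) : R :=
  'D_(delta_mx 0 a) f y.

(* Meant for open U *)
Fixpoint Ck {n} (k : nat) (U : set 'rV[R]_n) (f : 'rV[R]_n -> R) : Prop :=
  (forall y, U y -> {for y, continuous f}) /\
  match k with
  | 0 => True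
  | k'.+1 => forall a : 'I_n,
      (forall y, U y -> derivable f y (delta_mx 0 a)) /\ Ck k' U (partial a f)
  end.

Definition smooth_on {n} (U : set 'rV[R]_n) (f : 'rV[R]_n -> R) : Prop :=
  forall k, Ck k U f.

Definition csmooth_on {n} (U : set 'rV[R]_n) (f : 'rV[R]_n -> R[i]) : Prop :=
  smooth_on U (fun y => complex.Re (f y)) /\
  smooth_on U (fun y => complex.Im (f y)).

Definition cpartial {n} (a : 'I_n) (f : 'rV[R]_n -> R[i]) (y : 'rV[R]_n) : R[i] :=
  partial a (fun z => complex.Re (f z)) y +i*
  partial a (fun z => complex.Im (f z)) y.

(* Lebesgue integral over R^4, as an iterated integral; only used on continuous
   compactly supported functions *)
Definition int4 (f : 'rV[R]_4 -> R) : R :=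
  (\int[lebesgue_measure]_(t0 in setT) \int[lebesgue_measure]_(t1 in setT)
   \int[lebesgue_measure]_(t2 in setT) \int[lebesgue_measure]_(t3 in setT)
     f (\row_(a < 4) nth 0 [:: t0; t1; t2; t3] a))%R.

Definition cint4 (f : 'rV[R]_4 -> R[i]) : R[i] :=
  int4 (fun y => complex.Re (f y)) +i* int4 (fun y => complex.Im (f y)).

Definition adjmx {m n} (X : 'M[R[i]]_(m, n)) : 'M[R[i]]_(n, m) :=
  (map_mx (@conjc R) X)^T.

End Calculus.

Section Lorentz.
Context {R : realType}.

Definition mx2 (a b c d : R[i]) : 'M[R[i]]_2 :=
  \matrix_(i < 2, j < 2)
    if i == 0 then (if j == 0 then a else b) else (if j == 0 then c else d).

(* s^1, ..., s^4 are pauli 0, ..., pauli 3 *)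
Definition pauli (j : 'I_4) : 'M[R[i]]_2 :=
  match val j with
  | 0 => mx2 0 1 1 0
  | 1 => mx2 0 (- 'i) 'i 0
  | 2 => mx2 1 0 0 (- 1)
  | _ => mx2 1 0 0 1
  end.

Definition eta : 'M[R]_4 := diag_mx (\row_(j < 4) (-1) ^+ (j == ord_max)).

Definition Lorentz : set 'M[R]_4 := [set m | m^T *m eta *m m = eta].

Definition SOplus : set 'M[R]_4 := connected_component Lorentz 1%:M.

Definition SL2 : set 'M[R[i]]_2 := [set h | \det h = 1].

(* Since tr(s^j s^k) = 2 delta_jk, this is the coefficient of s^k in S^* s^j S;
   see Ad_spec *)
Definition Ad (S : 'M[R[i]]_2) : 'M[R]_4 :=
  \matrix_(j < 4, k < 4)
    (complex.Re (\tr (pauli k *m (adjmx S *m pauli j *m S))) / 2).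

End Lorentz.

Section Manifold.
Context {R : realType} {M : topologicalType}.

(* cmap is only meaningful on cdom, and cinv on cimg *)
Record chart := Chart {
  cdom : set M;
  cmap : M -> 'rV[R]_4;
  cinv : 'rV[R]_4 -> M
}.

Definition cimg (c : chart) : set 'rV[R]_4 := cmap c @` cdom c.

Definition is_chart (c : chart) : Prop :=
  [/\ open (cdom c), open (cimg c),
      {within cdom c, continuous (cmap c)},
      {within cimg c, continuous (cinv c)} &
      forall x, cdom c x -> cinv c (cmap c x) = x].

Definition trans (c d : chart) (y : 'rV[R]_4) : 'rV[R]_4 := cmap d (cinv c y).

(* entry (a, b) is the derivative of the b-th d-coordinate by the a-th
   c-coordinate *)
Definition Jac (c d : chart) (y : 'rV[R]_4) : 'M[R]_4 :=
  \matrix_(a < 4, b < 4) partial a (fun z => trans c d z 0 b) y.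

Definition compatible (c d : chart) : Prop :=
  forall b : 'I_4,
    smooth_on (cmap c @` (cdom c `&` cdom d)) (fun y => trans c d y 0 b) /\
    smooth_on (cmap d @` (cdom c `&` cdom d)) (fun y => trans d c y 0 b).

Definition maximal_atlas (A : set chart) : Prop :=
  [/\ forall c, A c -> is_chart c,
      forall x, exists2 c, A c & cdom c x,
      forall c d, A c -> A d -> compatible c d &
      forall c, is_chart c -> (forall d, A d -> compatible c d) -> A c].

Definition smooth_manifold (A : set chart) : Prop :=
  [/\ hausdorff_space M, @second_countable M & maximal_atlas A].

(* An orientation is given by an oriented atlas O; the positively oriented
   local coordinates are the charts in O *)
Definition orientation (A O : set chart) : Prop :=
  [/\ O `<=` A,
      forall x, exists2 c, O c & cdom c x &
      forall c d x, O c -> O d -> cdom c x -> cdom d x ->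
        0 < \det (Jac c d (cmap c x))].

Definition smooth_fun (A : set chart) (u : M -> R) : Prop :=
  forall c, A c -> smooth_on (cimg c) (fun y => u (cinv c y)).

Definition smooth_mx (A : set chart) {m n} (u : M -> 'M[R]_(m, n)) : Prop :=
  forall i j, smooth_fun A (fun x => u x i j).

Definition smooth_cmx (A : set chart) {m n} (u : M -> 'M[R[i]]_(m, n)) : Prop :=
  forall i j, smooth_fun A (fun x => complex.Re (u x i j)) /\
              smooth_fun A (fun x => complex.Im (u x i j)).

(* A field on M is the family of its coordinate expressions: T c y is the
   expression in the chart c at the point with coordinates y. Its values for c
   outside the atlas or y outside cimg c are irrelevant. *)
Definition coord_field (X : Type) := chart -> 'rV[R]_4 -> X.

Definition is_vector (A : set chart) (v : coord_field 'rV[R]_4) : Prop :=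
  (forall c a, A c -> smooth_on (cimg c) (fun y => v c y 0 a)) /\
  (forall c d x, A c -> A d -> cdom c x -> cdom d x ->
     v d (cmap d x) = v c (cmap c x) *m Jac c d (cmap c x)).

Definition is_covector (A : set chart) (q : coord_field 'rV[R]_4) : Prop :=
  (forall c a, A c -> smooth_on (cimg c) (fun y => q c y 0 a)) /\
  (forall c d x, A c -> A d -> cdom c x -> cdom d x ->
     q c (cmap c x) = q d (cmap d x) *m (Jac c d (cmap c x))^T).

Definition lorentz_metric (A : set chart) (g : coord_field 'M[R]_4) : Prop :=
  [/\ forall c a b, A c -> smooth_on (cimg c) (fun y => g c y a b),
      forall c d x, A c -> A d -> cdom c x -> cdom d x ->
        g c (cmap c x) =
        Jac c d (cmap c x) *m g d (cmap d x) *m (Jac c d (cmap c x))^T,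
      forall c y, A c -> cimg c y -> (g c y)^T = g c y &
      forall c y, A c -> cimg c y ->
        exists2 P : 'M[R]_4, P \in unitmx & P *m g c y *m P^T = eta].

Definition timelike (A : set chart) (g : coord_field 'M[R]_4) (u : coord_field 'rV[R]_4) :=
  forall c y, A c -> cimg c y -> (u c y *m g c y *m (u c y)^T) 0 0 < 0.

Definition cotimelike (A : set chart) (g : coord_field 'M[R]_4) (q : coord_field 'rV[R]_4) :=
  forall c y, A c -> cimg c y -> (q c y *m invmx (g c y) *m (q c y)^T) 0 0 < 0.

Definition time_orientable (A : set chart) (g : coord_field 'M[R]_4) : Prop :=
  exists2 u, is_vector A u & timelike A g u.

Definition frame_mx (e : 'I_4 -> coord_field 'rV[R]_4) : coord_field 'M[R]_4 :=
  fun c y => \matrix_(j < 4, a < 4) e j c y 0 a.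

Definition parallelizable (A : set chart) : Prop :=
  exists2 e : 'I_4 -> coord_field 'rV[R]_4, forall j, is_vector A (e j) &
    forall c y, A c -> cimg c y -> \det (frame_mx e c y) != 0.

Definition is_framing (A O : set chart) (g : coord_field 'M[R]_4) (q : coord_field 'rV[R]_4)
    (ctop ctem : int) (b : 'I_4 -> coord_field 'rV[R]_4) : Prop :=
  [/\ forall j, is_vector A (b j),
      forall c y j k, A c -> cimg c y ->
        (b j c y *m g c y *m (b k c y)^T) 0 0 = eta j k,
      forall c y, O c -> cimg c y -> sgz (\det (frame_mx b c y)) = ctop &
      forall c y, A c -> cimg c y ->
        sgz ((q c y *m (b ord_max c y)^T) 0 0) = ctem].

(* v is a smooth 2-column of half-densities on the open set U of M *)
Definition half_density (A : set chart) (U : set M) (v : coord_field 'cV[R[i]]_2) :=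
  (forall c i, A c ->
     csmooth_on (cmap c @` (U `&` cdom c)) (fun y => v c y i 0)) /\
  (forall c d x, A c -> A d -> U x -> cdom c x -> cdom d x ->
     v c (cmap c x) =
     (Num.sqrt `|\det (Jac c d (cmap c x))|)%:C *: v d (cmap d x)).

Definition density (A : set chart) (m : coord_field R[i]) : Prop :=
  (forall c, A c -> csmooth_on (cimg c) (m c)) /\
  (forall c d x, A c -> A d -> cdom c x -> cdom d x ->
     m c (cmap c x) = `|\det (Jac c d (cmap c x))|%:C * m d (cmap d x)).

Definition vanishes_off {X : zmodType} (A : set chart) (K : set M) (v : coord_field X) :=
  forall c y, A c -> cimg c y -> ~ K (cinv c y) -> v c y = 0.

Definition compactly_supported {X : zmodType} (A : set chart) (v : coord_field X) :=
  exists2 K : set M, compact K & vanishes_off A K v.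

(* z is the integral over M of the compactly supported density m: m splits into
   finitely many densities, each compactly supported in the domain of a chart,
   whose integrals in these coordinates add up to z. By the change of variables
   formula z does not depend on the splitting. *)
Definition is_integral (A : set chart) (m : coord_field R[i]) (z : R[i]) : Prop :=
  exists (n : nat) (c : 'I_n -> chart) (mu : 'I_n -> coord_field R[i]),
  [/\ forall i, A (c i) /\ density A (mu i),
      forall i, exists K : set M,
        [/\ compact K, K `<=` cdom (c i) & vanishes_off A K (mu i)],
      forall d y, A d -> cimg d y -> m d y = \sum_(i < n) mu i d y &
      z = \sum_(i < n) cint4 (fun y => if y \in cimg (c i) then mu i (c i) y else 0)].

(* the inner product <v, w> is the integral of w^* v *)
Definition is_inner (A : set chart) (v w : coord_field 'cV[R[i]]_2) (z : R[i]) : Prop :=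
  is_integral A (fun c y => (adjmx (w c y) *m v c y) 0 0) z.

(* The local coefficients F^alpha, G of a first order operator *)
Record operator := Operator {
  opF : 'I_4 -> coord_field 'M[R[i]]_2;
  opG : coord_field 'M[R[i]]_2
}.

Definition op_apply (L : operator) (v : coord_field 'cV[R[i]]_2) : coord_field 'cV[R[i]]_2 :=
  fun c y =>
    \sum_(a < 4) opF L a c y *m (\col_i cpartial a (fun z => v c z i 0) y)
    + opG L c y *m v c y.

(* the local expressions F^alpha d_alpha + G define one operator on
   half-densities *)
Definition is_diffop (A : set chart) (L : operator) : Prop :=
  [/\ forall c a i j, A c -> csmooth_on (cimg c) (fun y => opF L a c y i j),
      forall c i j, A c -> csmooth_on (cimg c) (fun y => opG L c y i j) &
      forall U v, open U -> half_density A U v -> half_density A U (op_apply L v)].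

Definition formally_selfadjoint (A : set chart) (L : operator) : Prop :=
  forall v w, half_density A setT v -> half_density A setT w ->
    compactly_supported A v -> compactly_supported A w ->
    exists2 z, is_inner A (op_apply L v) w z & is_inner A v (op_apply L w) z.

Definition Lprin (L : operator) (c : chart) (y p : 'rV[R]_4) : 'M[R[i]]_2 :=
  'i *: \sum_(a < 4) (p 0 a)%:C *: opF L a c y.

Definition nondegenerate (A : set chart) (L : operator) : Prop :=
  forall c y p, A c -> cimg c y -> p != 0 -> Lprin L c y p != 0.

Definition corresponds_to (A : set chart) (g : coord_field 'M[R]_4) (L : operator) :=
  forall c y p, A c -> cimg c y ->
    \det (Lprin L c y p) = (- (p *m invmx (g c y) *m p^T) 0 0)%:C.

Definition is_tetrad (A : set chart) (L : operator)
    (e : 'I_4 -> coord_field 'rV[R]_4) : Prop :=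
  forall c y p, A c -> cimg c y ->
    Lprin L c y p = \sum_(j < 4) ((p *m (e j c y)^T) 0 0)%:C *: pauli j.

Definition top_charge (A O : set chart) (L : operator) (s : int) : Prop :=
  exists2 e, is_tetrad A L e &
    forall c y, O c -> cimg c y -> sgz (\det (frame_mx e c y)) = s.

Definition tem_charge (A : set chart) (q : coord_field 'rV[R]_4) (L : operator)
    (s : int) : Prop :=
  forall c y, A c -> cimg c y ->
    sgz (complex.Re (\tr (Lprin L c y (q c y)))) = s.

Definition admissible (A O : set chart) (g : coord_field 'M[R]_4) (q : coord_field 'rV[R]_4)
    (ctop ctem : int) (L : operator) : Prop :=
  [/\ is_diffop A L /\ formally_selfadjoint A L, nondegenerate A L,
      corresponds_to A g L, top_charge A O L ctop & tem_charge A q L ctem].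

Definition an_equiv (A : set chart) (L L' : operator) : Prop :=
  exists S : M -> 'M[R[i]]_2,
  [/\ smooth_cmx A S, forall x, SL2 (S x) &
      forall c x p, A c -> cdom c x ->
        Lprin L' c (cmap c x) p =
        adjmx (S x) *m Lprin L c (cmap c x) p *m S x].

Definition an_class (A O : set chart) (g : coord_field 'M[R]_4) (q : coord_field 'rV[R]_4)
    (ctop ctem : int) (L : operator) : set operator :=
  [set L' | admissible A O g q ctop ctem L' /\ an_equiv A L L'].

Definition an_spin_structures (A O : set chart) (g : coord_field 'M[R]_4)
    (q : coord_field 'rV[R]_4) (ctop ctem : int) : set (set operator) :=
  an_class A O g q ctop ctem @` admissible A O g q ctop ctem.

(* real and imaginary parts of the entries *)
Definition realify (h : 'M[R[i]]_2) : 'rV[R]_(2 * 2 + 2 * 2) :=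
  row_mx (mxvec (map_mx (@complex.Re R) h)) (mxvec (map_mx (@complex.Im R) h)).

(* smoothness on M x SL(2,C), where SL(2,C) is a submanifold of C^(2 x 2) = R^8:
   in charts, u extends locally to a smooth function on an open set of R^(4+8) *)
Definition smooth_MSL2 (A : set chart) (u : M * 'M[R[i]]_2 -> R) : Prop :=
  forall c x0 h0, A c -> cdom c x0 -> SL2 h0 ->
  exists (W : set 'rV[R]_(4 + (2 * 2 + 2 * 2))) (f : _ -> R),
  [/\ open W, W (row_mx (cmap c x0) (realify h0)), smooth_on W f &
      forall x h, cdom c x -> SL2 h -> W (row_mx (cmap c x) (realify h)) ->
        u (x, h) = f (row_mx (cmap c x) (realify h))].

(* Maps on M x SL(2,C) are represented by total functions on M x C^(2 x 2) whose
   values off M x SL(2,C) are irrelevant. The component in M of a map that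
   commutes with the projections is smooth, so smoothness is that of the entries
   of the matrix component. *)
Definition equivariant_map (A : set chart)
    (Phi : M * 'M[R[i]]_2 -> M * 'M[R]_4) : Prop :=
  [/\ forall j k, smooth_MSL2 A (fun z => (Phi z).2 j k),
      set_fun ([set: M] `*` SL2) ([set: M] `*` SOplus) Phi,
      forall x h, SL2 h -> (Phi (x, h)).1 = x &
      forall x h, SL2 h ->
        Phi (x, h) = ((Phi (x, 1%:M)).1, (Phi (x, 1%:M)).2 *m Ad h)].

Definition trad_equiv (A : set chart)
    (Phi1 Phi2 : M * 'M[R[i]]_2 -> M * 'M[R]_4) : Prop :=
  exists B : M * 'M[R[i]]_2 -> M * 'M[R[i]]_2,
  [/\ (forall i j, smooth_MSL2 A (fun z => complex.Re ((B z).2 i j)) /\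
                   smooth_MSL2 A (fun z => complex.Im ((B z).2 i j))),
      set_fun ([set: M] `*` SL2) ([set: M] `*` SL2) B,
      forall x h, SL2 h -> (B (x, h)).1 = x,
      forall x h, SL2 h ->
        B (x, h) = ((B (x, 1%:M)).1, (B (x, 1%:M)).2 *m h) &
      forall x h, SL2 h -> Phi2 (B (x, h)) = Phi1 (x, h)].

Definition trad_class (A : set chart) (Phi : M * 'M[R[i]]_2 -> M * 'M[R]_4) :
    set (M * 'M[R[i]]_2 -> M * 'M[R]_4) :=
  [set Phi' | equivariant_map A Phi' /\ trad_equiv A Phi Phi'].

Definition trad_spin_structures (A : set chart) :
    set (set (M * 'M[R[i]]_2 -> M * 'M[R]_4)) :=
  trad_class A @` equivariant_map A.

(* f is the function f_L: the framing e of L satisfies e_k = sum_j b_j f^j_k *)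
Definition is_fL (A : set chart) (b : 'I_4 -> coord_field 'rV[R]_4) (L : operator)
    (f : M -> 'M[R]_4) : Prop :=
  [/\ smooth_mx A f, forall x, SOplus (f x) &
      exists2 e, is_tetrad A L e &
        forall c x k, A c -> cdom c x ->
          e k c (cmap c x) = \sum_(j < 4) f x j k *: b j c (cmap c x)].

Definition Phi_of (f : M -> 'M[R]_4) (z : M * 'M[R[i]]_2) : M * 'M[R]_4 :=
  (z.1, f z.1 *m Ad z.2).

End Manifold.

Arguments chart : clear implicits.
Arguments operator : clear implicits.
Arguments coord_field : clear implicits.

Lemma Ad_spec (R : realType) (S : 'M[R[i]]_2) (j : 'I_4) :
  adjmx S *m pauli j *m S = \sum_(k < 4) (Ad S j k)%:C *: pauli k.
Proof.
have adjmxM m n p (X : 'M[R[i]]_(m, n)) (Y : 'M[R[i]]_(n, p)) :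
    adjmx (X *m Y) = adjmx Y *m adjmx X.
  by rewrite /adjmx map_mxM trmx_mul.
have adjK m n (X : 'M[R[i]]_(m, n)) : adjmx (adjmx X) = X.
  by apply/matrixP => a b; rewrite !mxE conjcK.
have pauliH k : adjmx (pauli k) = pauli k :> 'M[R[i]]_2.
  by apply/matrixP => -[[|[|//]] ?] [[|[|//]] ?];
     case: k => -[|[|[|[|//]]]] ?; rewrite !mxE /=; simpc.
set H := adjmx S *m pauli j *m S.
have HH : adjmx H = H by rewrite /H !adjmxM adjK pauliH mulmxA.
have AdE k : Ad S j k = complex.Re (\tr (pauli k *m H)) / 2 by rewrite mxE.
rewrite (eq_bigr _ (fun k _ => congr1 (fun t => t%:C *: _) (AdE k))).
move: H HH {AdE} => H /matrixP HH.
have h00 := HH 0 0; have h01 := HH 0 1; have h11 := HH 1 1.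
rewrite !mxE in h00 h01 h11.
have ord2 (P : 'I_2 -> Prop) : P 0 -> P 1 -> forall a, P a.
  move=> P0 P1 [[|[|//]] lt2].
    by rewrite (_ : Ordinal lt2 = 0) //; apply/val_inj.
  by rewrite (_ : Ordinal lt2 = 1) //; apply/val_inj.
have sum2 (V : nmodType) (u : 'I_2 -> V) : \sum_(a < 2) u a = u 0 + u 1.
  by rewrite big_ord_recl big_ord1; congr (_ + u _); apply/val_inj.
have sum4 (V : nmodType) (u : 'I_4 -> V) :
    \sum_(a < 4) u a = u 0 + (u 1 + (u (inord 2) + u (inord 3))).
  by rewrite !big_ord_recl big_ord0 addr0; congr (u _ + (u _ + (u _ + u _)));
     apply/val_inj; rewrite /= ?inordK.
apply/matrixP.
apply: (@ord2 _); apply: (@ord2 _).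
all: rewrite sum4 !mxE /mxtrace !sum2 !mxE !sum2 /=.
all: move: h00 h01 h11.
all: case: (H 0 0) (H 0 1) (H 1 0) (H 1 1) => [a a'] [b b'] [c c'] [d d'] /=.
all: rewrite /pauli /= !inordK //= !mxE /=.
all: move=> [] ha [] hb hb' [] hd.
all: by apply/eqP; rewrite eq_complex /=; apply/andP; split; apply/eqP; lra.
Qed.

(* Main.v *)
From HB Require Import structures.
From mathcomp Require Import all_boot all_order all_algebra.
From mathcomp Require Import all_classical all_reals all_analysis.
From mathcomp Require Import complex lra ring.
Require Import Defs.
Set Implicit Arguments.
Unset Strict Implicit.
Unset Printing Implicit Defensive.
Import Order.TTheory GRing.Theory Num.Theory.
Import numFieldNormedType.Exports.
Local Open Scope classical_set_scope.
Local Open Scope complex_scope.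
Local Open Scope ring_scope.

(** Both kinds of spin structure are equivalence classes of smooth maps
    [f : M -> SO^+(3, 1)], where [f] and [f'] are equivalent when
    [f' = f * Ad S] for a smooth [S : M -> SL(2, C)] ([Ad_related]).

    On the analytic side, the Pauli matrices turn a covector [p] into the Hermitian
    matrix [herm p], with [det (herm p)] minus the Minkowski square of [p]. The
    principal symbol of an operator with tetrad [e] is [herm] of the components
    [p(e_j)]. The operator corresponds to the metric if and only if [e] is
    orthonormal, and the charges fix the orientation and the time orientation of
    [e]. Hence [e = b f] for a unique [f], which takes values in the identity
    component because that component is singled out by the signs of the determinant
    and of the time entry ([SOplusP], [SOplus_frame], [admissible_fL]), as every matrix
    with these signs is some [Ad h] ([Ad_surj]). The symbol is
    [herm (p B^T f)], with [B] the matrix of the reference framing, so replacing it by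
    its congruence under [S] replaces [f] by [f * Ad S] ([an_equivP]).

    On the traditional side, an equivariant map [Phi] is determined by the map
    [f x = (Phi (x, 1)).2], and precomposing with an automorphism given by [S]
    replaces [f] by [f * Ad S] ([trad_equivP]). Since [Phi_L] has [f_L] as its map,
    [L |-> Phi_L] is well defined and injective on classes.

    Surjectivity requires an admissible operator for every [f]. The operator
    [weyl_op] of the tetrad [b f] is the sum of the matrices [- i s^j] times the Lie
    derivatives of half-densities along the vectors of the tetrad. It is well defined
    because these Lie derivatives do not depend on the coordinates, which comes from
    the transformation rule of the divergence ([divergence_change], [lie_real_hd]).
    It is formally self-adjoint because [w^* L v - (L w)^* v] is a divergence
    ([weyl_divergence]); a partition of unity moves the integral to single charts,
    where the divergence theorem applies ([weyl_selfadjoint]). *)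

(** * Continuously differentiable functions are differentiable *)

Section Differentiability.
Context {R : realType}.

Lemma MVT_line (V : normedModType R) (f : V -> R) (z v : V) (s : R) :
  (forall t : R, `|t| <= `|s| -> derivable f (z + t *: v) v) ->
  exists2 t : R, `|t| <= `|s| & f (z + s *: v) - f z = s * 'D_v f (z + t *: v).
Proof.
move=> df.
pose g (t : R) := f (z + t *: v).
have gE (t : R) : (fun h : R => h^-1 *: ((g \o shift t) (h *: 1) - g t)) =
            (fun h : R => h^-1 *: ((f \o shift (z + t *: v)) (h *: v) - f (z + t *: v))).
  apply/funext => h; rewrite /g /=; congr (_ *: (f _ - _)).
  by rewrite [h *: 1]mulr1 scalerDl addrCA.
have dg (t : R) : `|t| <= `|s| -> is_derive t (1:R) g ('D_v f (z + t *: v)).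
  move=> ts; apply: DeriveDef; first by rewrite /derivable gE; exact: df.
  by rewrite /derive gE.
have cg (a b : R) : (forall t, a <= t <= b -> `|t| <= `|s|) -> {within `[a, b], continuous g}.
  move=> ab; apply: derivable_within_continuous => t; rewrite in_itv /= => tab.
  exact: (@ex_derive _ _ _ _ _ _ _ (dg _ (ab _ tab))).
have [s0|s0] := leP 0 s.
- have le0 (t : R) : 0 <= t <= s -> `|t| <= `|s|.
    by move=> /andP[t0 ts]; rewrite !ger0_norm // (le_trans t0).
  have [|t] := @MVT_segment R g (fun t => 'D_v f (z + t *: v)) 0 s s0 _ (cg _ _ le0).
    by move=> t; rewrite in_itv /= => /andP[t0 ts]; apply/dg/le0; rewrite !ltW.
  rewrite in_itv /= => ts; rewrite /g scale0r addr0 subr0 => ->.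
  by exists t; [exact: le0|rewrite mulrC].
- have le0 (t : R) : s <= t <= 0 -> `|t| <= `|s|.
    by move=> /andP[t0 ts]; rewrite !ler0_norm ?lerN2// (le_trans t0).
  have [|t] := @MVT_segment R g (fun t => 'D_v f (z + t *: v)) s 0 (ltW s0) _ (cg _ _ le0).
    by move=> t; rewrite in_itv /= => /andP[t0 ts]; apply/dg/le0; rewrite !ltW.
  rewrite in_itv /= => ts; rewrite /g scale0r addr0 sub0r => e.
  by exists t; [exact: le0|rewrite -[LHS]opprB e mulrN opprK mulrC].
Qed.

Lemma differentiable_from (V : normedModType R) (f : V -> R)
    (df : {linear V -> R}) (x : V) :
  continuous df ->
  (forall e : R, 0 < e -> \forall h \near (0 : V), `|f (h + x) - f x - df h| <= e * `|h|) ->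
  differentiable f x.
Proof.
move=> dfc dfe.
have o : f \o shift x = cst (f x) + df +o_ 0 id.
  apply/eqaddoP => e e0; apply: filterS (dfe e e0) => h.
  by rewrite /= opprD addrA.
by apply/diff_locallyP; rewrite (diff_unique dfc o).
Qed.

Lemma mx_coord_le n (h : 'rV[R]_n) (a : 'I_n) : `|h 0 a| <= `|h|.
Proof. by rewrite [leRHS]mx_normrE; exact: (le_bigmax _ (fun ij : 'I_1 * 'I_n => `|h ij.1 ij.2|) (0, a)). Qed.

(** Going from [y] to [y + h] one coordinate at a time turns the increment of [f]
    into a sum of one-variable increments, each given by the mean value theorem. *)
Lemma C1_differentiable n (f : 'rV[R]_n -> R) (y : 'rV[R]_n) :
  (\forall z \near y, forall a, derivable f z (delta_mx 0 a)) ->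
  (forall a, {for y, continuous (partial a f)}) ->
  differentiable f y.
Proof.
move=> df cf.
pose D (h : 'rV[R]_n) := \sum_(a < n) h 0 a * partial a f y.
have Dlin : linear D.
  move=> k u v; rewrite /D scaler_sumr -big_split /=; apply: eq_bigr => a _.
  by rewrite !mxE mulrDl -mulrA.
pose DM := GRing.isLinear.Build _ _ _ _ _ Dlin.
have [DL DLE] : exists DL : {linear 'rV[R]_n -> R}, DL = D :> (_ -> _).
  by unshelve eexists; first exact: (HB.pack D DM).
apply: (@differentiable_from _ f DL).
  rewrite DLE (_ : D = \sum_(a < n) (fun h : 'rV[R]_n => h 0 a * partial a f y)).
    apply: (@big_ind _ (fun g : 'rV[R]_n -> R => continuous g)).
    - exact: (@cst_continuous _ _ (0 : R)).
    - by move=> u v cu cv x; exact: (cvgD (cu x) (cv x)).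
    - by move=> a aT x; exact: (cvgM (@coord_continuous R 1 n 0 a x) (cvg_cst _)).
  by apply/funext => h; rewrite fct_sumE.
move=> e e0.
pose e' := e / n.+1%:R.
have e'0 : 0 < e' by rewrite divr_gt0.
have cfn : \forall z \near y, forall a, `|partial a f z - partial a f y| <= e'.
  apply: (@filter_forall _ _ (fun a z => `|partial a f z - partial a f y| <= e') (nbhs y) _) => a.
  have /cvgrPdist_le /(_ _ e'0) := cf a.
  by apply: filterS => z; rewrite distrC.
have [r /= r0 rP] := (nbhs_ballP _ _).1 (filterI df cfn).
have : \forall h \near (0 : 'rV[R]_n), `|h| < r.
  exact: nbhs0_lt.
apply: filterS => h hr.
(* [tr k] keeps the first [k] coordinates of [h] *)
pose tr (k : nat) := \row_(j < n) (if (j < k)%N then h 0 j else 0).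
have trS (k : 'I_n) : tr k.+1 = tr k + h 0 k *: delta_mx 0 k.
  apply/rowP => j; rewrite !mxE /= ltnS leq_eqVlt.
  have [jk|jk] := eqVneq j k; first by rewrite jk eqxx ltnn mulr1 add0r.
  by rewrite -[(j == k :> nat)]/(j == k) (negbTE jk) /= mulr0 addr0.
have tr0 : tr 0%N = 0 by apply/rowP => j; rewrite !mxE.
have trn : tr n = h by apply/rowP => j; rewrite !mxE ltn_ord.
have step (k : 'I_n) :
   `|f (tr k.+1 + y) - f (tr k + y) - h 0 k * partial k f y| <= e' * `|h|.
  have pin (t : R) : `|t| <= `|h 0 k| -> `|(tr k + y + t *: delta_mx 0 k) - y| < r.
    move=> th; apply: le_lt_trans hr; rewrite addrAC addrK.
    rewrite [leLHS]mx_normrE; apply/bigmax_leP; split => // -[i j] _ /=.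
    rewrite !mxE ord1 eqxx /=.
    have [jk|jk] := eqVneq j k; first by rewrite jk ltnn add0r mulr1 (le_trans th)// mx_coord_le.
    by rewrite mulr0 addr0; case: ifP => _; rewrite ?normr0// mx_coord_le.
  have pin' (t : R) : `|t| <= `|h 0 k| -> ball y r (tr k + y + t *: delta_mx 0 k).
    by move=> /pin; rewrite -ball_normE /= distrC.
  have [t th e1] := @MVT_line _ f (tr k + y) (delta_mx 0 k) (h 0 k)
     (fun t th => (rP _ (pin' t th)).1 k).
  rewrite trS (addrAC (tr k)) e1 -mulrBr normrM mulrC ler_pM// ?mx_coord_le//.
  exact: (rP _ (pin' t th)).2.
have -> : f (h + y) - f y - DL h =
   \sum_(k < n) (f (tr k.+1 + y) - f (tr k + y) - h 0 k * partial k f y).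
  rewrite DLE sumrB; congr (_ - _).
  rewrite -(big_mkord xpredT (fun k => f (tr k.+1 + y) - f (tr k + y))).
  by rewrite (telescope_sumr (fun k => f (tr k + y)))// tr0 trn add0r.
apply: le_trans (ler_norm_sum _ _ _) _.
apply: le_trans (ler_sum _ (fun k _ => step k)) _.
rewrite sumr_const card_ord -mulr_natl mulrA ler_wpM2r//.
by rewrite /e' mulrCA ler_piMr ?(ltW e0)// ler_pdivrMr// mul1r ler_nat.
Qed.

End Differentiability.

(** * Sums and products of smooth functions *)

Section SmoothAlgebra.
Context {R : realType}.
Implicit Types (n : nat).

Lemma open_near (T : topologicalType) (U : set T) (y : T) :
  open U -> U y -> \forall z \near y, U z.
Proof. by move=> oU Uy; apply: open_nbhs_nbhs; split. Qed.

Lemma partial_ext n (U : set 'rV[R]_n) (f g : 'rV[R]_n -> R) a y :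
  open U -> U y -> (forall z, U z -> f z = g z) -> partial a f y = partial a g y.
Proof.
by move=> oU Uy fg; apply: near_eq_derive; apply: filterS (open_near oU Uy) => z /fg.
Qed.

Lemma Ck_ext n k (U : set 'rV[R]_n) (f g : 'rV[R]_n -> R) :
  open U -> (forall z, U z -> f z = g z) -> Ck k U f -> Ck k U g.
Proof.
move=> oU; elim: k f g => [|k IH] f g fg /= [cf df].
  split=> // y Uy; have e : {near y, f =1 g} by apply: filterS (open_near oU Uy) => z /fg.
  by apply: cvg_trans (near_eq_cvg e) _; rewrite -(fg _ Uy); exact: cf.
split.
  move=> y Uy; have e : {near y, f =1 g} by apply: filterS (open_near oU Uy) => z /fg.
  by apply: cvg_trans (near_eq_cvg e) _; rewrite -(fg _ Uy); exact: cf.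
move=> a; have [dfa Cfa] := df a; split.
  move=> y Uy; apply: near_eq_derivable (dfa y Uy).
  by apply: filterS (open_near oU Uy) => z /fg.
by apply: IH Cfa => y Uy; exact: partial_ext oU Uy fg.
Qed.

Lemma Ck_sub n k (U V : set 'rV[R]_n) (f : 'rV[R]_n -> R) :
  V `<=` U -> Ck k U f -> Ck k V f.
Proof.
move=> VU; elim: k f => [|k IH] f /= [cf df]; split => //.
- by move=> y /VU; exact: cf.
- by move=> y /VU; exact: cf.
- by move=> a; have [dfa Cfa] := df a; split=> [y /VU/dfa //|]; exact: IH.
Qed.

Lemma Ck_local n k (U : set 'rV[R]_n) (f : 'rV[R]_n -> R) :
  (forall y, U y -> exists2 V : set 'rV[R]_n, V y & Ck k V f) -> Ck k U f.
Proof.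
elim: k f => [|k IH] f H /=; split => //.
- by move=> y /H[V Vy [cf _]]; exact: cf.
- by move=> y /H[V Vy [cf _]]; exact: cf.
- move=> a; split=> [y /H[V Vy [_ df]]|]; first exact: (df a).1.
  by apply: IH => y /H[V Vy [_ df]]; exists V => //; exact: (df a).2.
Qed.

Lemma Ck_prev n k (U : set 'rV[R]_n) (f : 'rV[R]_n -> R) : Ck k.+1 U f -> Ck k U f.
Proof.
elim: k f => [|k IH] f /= [cf df]; split => // a.
by have [dfa Cfa] := df a; split => //; exact: IH.
Qed.

Lemma Ck_cst n k (U : set 'rV[R]_n) (c : R) : Ck k U (fun=> c).
Proof.
elim: k c => [|k IH] c /=; split => //; try by move=> y _; exact: cst_continuous.
move=> a; split=> [y _|]; first exact: derivable_cst.
rewrite (_ : partial a _ = fun=> 0) //.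
by apply/funext => y; rewrite /partial derive_cst.
Qed.

Lemma partialD n (f g : 'rV[R]_n -> R) a y :
  derivable f y (delta_mx 0 a) -> derivable g y (delta_mx 0 a) ->
  partial a (fun z => f z + g z) y = partial a f y + partial a g y.
Proof. exact: deriveD. Qed.

Lemma partialM n (f g : 'rV[R]_n -> R) a y :
  derivable f y (delta_mx 0 a) -> derivable g y (delta_mx 0 a) ->
  partial a (fun z => f z * g z) y = partial a f y * g y + f y * partial a g y.
Proof.
by move=> df dg; rewrite /partial [LHS]deriveM // addrC; congr (_ + _); exact: mulrC.
Qed.

Lemma derive_sumE (V : normedModType R) (I : Type) (r : seq I) (F : I -> V -> R) (y v : V) :
  (forall i, derivable (F i) y v) ->
  'D_v (fun z => \sum_(i <- r) F i z) y = \sum_(i <- r) 'D_v (F i) y.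
Proof.
move=> dF; suff [] : derivable (fun z => \sum_(i <- r) F i z) y v /\
  'D_v (fun z => \sum_(i <- r) F i z) y = \sum_(i <- r) 'D_v (F i) y by [].
elim: r => [|i r [d e]].
  rewrite (_ : (fun z => _) = fun=> 0); last by apply/funext => z; rewrite big_nil.
  by split; [exact: derivable_cst|rewrite derive_cst big_nil].
rewrite (_ : (fun z => _) = F i + (fun z => \sum_(i <- r) F i z)); last first.
  by apply/funext => z; rewrite big_cons.
by split; [exact: derivableD|rewrite deriveD// e big_cons].
Qed.

Lemma CkD n k (U : set 'rV[R]_n) (f g : 'rV[R]_n -> R) :
  open U -> Ck k U f -> Ck k U g -> Ck k U (fun y => f y + g y).
Proof.
move=> oU; elim: k f g => [|k IH] f g /= [cf df] [cg dg]; split => //.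
- by move=> y Uy; exact: (cvgD (cf _ Uy) (cg _ Uy)).
- by move=> y Uy; exact: (cvgD (cf _ Uy) (cg _ Uy)).
- move=> a; have [dfa Cfa] := df a; have [dga Cga] := dg a; split.
    by move=> y Uy; apply: derivableD; [exact: dfa|exact: dga].
  apply: Ck_ext (IH _ _ Cfa Cga) => // y Uy.
  by rewrite partialD //; [exact: dfa|exact: dga].
Qed.

Lemma CkM n k (U : set 'rV[R]_n) (f g : 'rV[R]_n -> R) :
  open U -> Ck k U f -> Ck k U g -> Ck k U (fun y => f y * g y).
Proof.
move=> oU; elim: k f g => [|k IH] f g Hf Hg.
  case: Hf Hg => [cf _] [cg _]; split => // y Uy.
  by exact: (cvgM (cf _ Uy) (cg _ Uy)).
have Hf' := Ck_prev Hf; have Hg' := Ck_prev Hg.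
case: Hf Hg => [cf df] [cg dg]; split => //.
  by move=> y Uy; exact: (cvgM (cf _ Uy) (cg _ Uy)).
move=> a; have [dfa Cfa] := df a; have [dga Cga] := dg a; split.
  by move=> y Uy; apply: derivableM; [exact: dfa|exact: dga].
apply: Ck_ext (CkD oU (IH _ _ Cfa Hg') (IH _ _ Hf' Cga)) => // y Uy.
by rewrite partialM //; [exact: dfa|exact: dga].
Qed.

Lemma is_derive_coord n (b : 'I_n) (y v : 'rV[R]_n) :
  is_derive y v (fun y : 'rV[R]_n => y 0 b) (v 0 b).
Proof.
have dd := @differentiable_coord R 1 n y 0 b.
apply: DeriveDef; first exact: diff_derivable.
pose L (y : 'rV[R]_n) : R := y 0 b.
have Llin : linear L by move=> r u w; rewrite /L !mxE.
pose LM := GRing.isLinear.Build _ _ _ _ _ Llin.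
have [LL LLE] : exists LL : {linear 'rV[R]_n -> R}, LL = L :> (_ -> _).
  by unshelve eexists; first exact: (HB.pack L LM).
by rewrite deriveE // -[X in 'd X _]LLE diff_lin ?LLE //; exact: coord_continuous.
Qed.

Lemma partial_coord n (b : 'I_n) (y v : 'rV[R]_n) : 'D_v (fun y : 'rV[R]_n => y 0 b) y = v 0 b.
Proof. exact: (@derive_val _ _ _ _ _ _ _ (is_derive_coord b y v)). Qed.

Lemma Ck_coord n k (U : set 'rV[R]_n) (b : 'I_n) : Ck k U (fun y => y 0 b).
Proof.
have c (y : 'rV[R]_n) : {for y, continuous (fun y : 'rV[R]_n => y 0 b)} by exact: coord_continuous.
have d := is_derive_coord b.
case: k => [|k]; split => //.
move=> a; split=> [y _|]; first exact: (@ex_derive _ _ _ _ _ _ _ (d y _)).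
rewrite (_ : partial a _ = fun=> (delta_mx 0 a : 'rV[R]_n) 0 b); first exact: Ck_cst.
by apply/funext => y; rewrite /partial (@derive_val _ _ _ _ _ _ _ (d y _)).
Qed.

Lemma smooth_ext n (U : set 'rV[R]_n) (f g : 'rV[R]_n -> R) :
  open U -> (forall z, U z -> f z = g z) -> smooth_on U f -> smooth_on U g.
Proof. by move=> oU fg sf k; exact: Ck_ext oU fg (sf k). Qed.

Lemma smooth_sub n (U V : set 'rV[R]_n) (f : 'rV[R]_n -> R) :
  V `<=` U -> smooth_on U f -> smooth_on V f.
Proof. by move=> VU sf k; exact: Ck_sub VU (sf k). Qed.

Lemma smooth_local n (U : set 'rV[R]_n) (f : 'rV[R]_n -> R) :
  (forall y, U y -> exists2 V : set 'rV[R]_n, V y & smooth_on V f) -> smooth_on U f.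
Proof. by move=> H k; apply: Ck_local => y /H[V Vy sV]; exists V. Qed.

Lemma smooth_cst n (U : set 'rV[R]_n) (c : R) : smooth_on U (fun=> c).
Proof. by move=> k; exact: Ck_cst. Qed.

Lemma smooth_coord n (U : set 'rV[R]_n) (b : 'I_n) : smooth_on U (fun y => y 0 b).
Proof. by move=> k; exact: Ck_coord. Qed.

Lemma smoothD n (U : set 'rV[R]_n) (f g : 'rV[R]_n -> R) :
  open U -> smooth_on U f -> smooth_on U g -> smooth_on U (fun y => f y + g y).
Proof. by move=> oU sf sg k; exact: CkD. Qed.

Lemma smoothM n (U : set 'rV[R]_n) (f g : 'rV[R]_n -> R) :
  open U -> smooth_on U f -> smooth_on U g -> smooth_on U (fun y => f y * g y).
Proof. by move=> oU sf sg k; exact: CkM. Qed.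

Lemma smoothN n (U : set 'rV[R]_n) (f : 'rV[R]_n -> R) :
  open U -> smooth_on U f -> smooth_on U (fun y => - f y).
Proof.
move=> oU sf; apply: smooth_ext (smoothM oU (smooth_cst _ (-1)) sf) => // y _.
by rewrite mulN1r.
Qed.

Lemma smoothB n (U : set 'rV[R]_n) (f g : 'rV[R]_n -> R) :
  open U -> smooth_on U f -> smooth_on U g -> smooth_on U (fun y => f y - g y).
Proof. by move=> oU sf sg; apply: smoothD => //; exact: smoothN. Qed.

Lemma smooth_sum n (I : Type) (r : seq I) (P : pred I) (U : set 'rV[R]_n)
    (F : I -> 'rV[R]_n -> R) :
  open U -> (forall i, P i -> smooth_on U (F i)) ->
  smooth_on U (fun y => \sum_(i <- r | P i) F i y).
Proof.
move=> oU sF; elim: r => [|i r IH].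
  by apply: smooth_ext (smooth_cst U 0) => // y _; rewrite big_nil.
apply: (@smooth_ext _ U (fun y => (if P i then F i y else 0) + \sum_(i <- r | P i) F i y)) => //.
  by move=> y _; rewrite big_cons; case: (P i); rewrite ?add0r.
apply: smoothD => //; case: (boolP (P i)) => [/sF//|_]; exact: smooth_cst.
Qed.

Lemma smooth_prod n (I : Type) (r : seq I) (P : pred I) (U : set 'rV[R]_n)
    (F : I -> 'rV[R]_n -> R) :
  open U -> (forall i, P i -> smooth_on U (F i)) ->
  smooth_on U (fun y => \prod_(i <- r | P i) F i y).
Proof.
move=> oU sF; elim: r => [|i r IH].
  by apply: smooth_ext (smooth_cst U 1) => // y _; rewrite big_nil.
apply: (@smooth_ext _ U (fun y => (if P i then F i y else 1) * \prod_(i <- r | P i) F i y)) => //.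
  by move=> y _; rewrite big_cons; case: (P i); rewrite ?mul1r.
apply: smoothM => //; case: (boolP (P i)) => [/sF//|_]; exact: smooth_cst.
Qed.

Lemma smooth_partial n (U : set 'rV[R]_n) (f : 'rV[R]_n -> R) a :
  smooth_on U f -> smooth_on U (partial a f).
Proof. by move=> sf k; have [_ /(_ a)[]] := sf k.+1. Qed.

Lemma smooth_continuous n (U : set 'rV[R]_n) (f : 'rV[R]_n -> R) y :
  smooth_on U f -> U y -> {for y, continuous f}.
Proof. by move=> sf Uy; exact: (sf 0%N).1. Qed.

Lemma smooth_derivable n (U : set 'rV[R]_n) (f : 'rV[R]_n -> R) y a :
  smooth_on U f -> U y -> derivable f y (delta_mx 0 a).
Proof. by move=> sf Uy; exact: ((sf 1%N).2 a).1. Qed.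

Lemma smooth_differentiable n (U : set 'rV[R]_n) (f : 'rV[R]_n -> R) y :
  open U -> smooth_on U f -> U y -> differentiable f y.
Proof.
move=> oU sf Uy; apply: C1_differentiable.
  by apply: filterS (open_near oU Uy) => z Uz a; exact: smooth_derivable sf Uz.
by move=> a; apply: smooth_continuous (smooth_partial a sf) Uy.
Qed.

End SmoothAlgebra.

(** * Compositions of smooth functions *)

Section SmoothComposition.
Context {R : realType}.

Lemma Ck_continuous n k (U : set 'rV[R]_n) (f : 'rV[R]_n -> R) y :
  Ck k U f -> U y -> {for y, continuous f}.
Proof. by case: k => [|k] [cf _] Uy; exact: cf. Qed.

Lemma derive_line (V : normedModType R) (f : V -> R) (y v : V) :
  'D_v f y = 'D_(1:R) (fun h : R => f (h *: v + y)) 0.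
Proof.
have e : (fun h : R => h^-1 *: ((f \o shift y) (h *: v) - f y)) = (fun h : R =>
    h^-1 *: (((fun h : R => f (h *: v + y)) \o shift 0) (h *: 1) - f (0 *: v + y))).
  by apply/funext => h /=; rewrite scale0r add0r [h *: 1]mulr1 addr0.
by rewrite /derive e.
Qed.

Lemma mx_continuous (T : topologicalType) m n (phi : T -> 'M[R]_(m, n)) y :
  (forall i j, {for y, continuous (fun z => phi z i j)}) -> {for y, continuous phi}.
Proof.
move=> c; apply/cvg_ballP => e e0.
have h : \forall z \near y, forall i j, ball (phi y i j) e (phi z i j).
  apply: (@filter_forall _ _ (fun i z => forall j, ball (phi y i j) e (phi z i j)) (nbhs y) _) => i.
  apply: (@filter_forall _ _ (fun j z => ball (phi y i j) e (phi z i j)) (nbhs y) _) => j.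
  by have /cvg_ballP := c i j; apply.
by apply: filterS h => z hz; split.
Qed.

Lemma rV_continuous (T : topologicalType) n (phi : T -> 'rV[R]_n) y :
  (forall j, {for y, continuous (fun z => phi z 0 j)}) -> {for y, continuous phi}.
Proof. by move=> c; apply: mx_continuous => i j; rewrite ord1. Qed.

Lemma diff_rV n (f : 'rV[R]_n -> R) (z v : 'rV[R]_n) :
  differentiable f z -> 'd f z v = \sum_b v 0 b * partial b f z.
Proof.
move=> df; rewrite [in LHS](row_sum_delta v) linear_sum; apply: eq_bigr => b _.
by rewrite linearZ /= /partial deriveE.
Qed.

Lemma derive_chain n (V : normedModType R) (f : 'rV[R]_n -> R) (phi : V -> 'rV[R]_n) (y v : V) :
  differentiable f (phi y) ->
  (forall b, derivable (fun z => phi z 0 b) y v) ->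
  derivable (fun z => f (phi z)) y v /\
  'D_v (fun z => f (phi z)) y =
     \sum_b 'D_v (fun z => phi z 0 b) y * partial b f (phi y).
Proof.
move=> df dphi.
pose c (h : R) := phi (h *: v + y).
have dcb b : derivable (fun h => c h 0 b) 0 (1:R).
  by have /derivable1P := dphi b.
have dc : derivable c 0 (1:R) by apply/derivable_mxP => i b; rewrite ord1.
have diffc : differentiable c 0 by apply/derivable1_diffP.
have c0 : c 0 = phi y by rewrite /c scale0r add0r.
have df' : differentiable f (c 0) by rewrite c0.
have dfc := differentiable_comp diffc df'.
split; first by apply/derivable1P; exact/derivable1_diffP.
have e : (fun h : R => f (phi (h *: v + y))) = f \o c by [].
rewrite derive_line e deriveE // diff_comp //= c0.
rewrite -(deriveE (1:R) diffc) derive_mx // diff_rV //; apply: eq_bigr => b _.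
by rewrite mxE [in RHS]derive_line.
Qed.

Lemma partial_chain n m (f : 'rV[R]_m -> R) (phi : 'rV[R]_n -> 'rV[R]_m) y a :
  differentiable f (phi y) ->
  (forall b, derivable (fun z => phi z 0 b) y (delta_mx 0 a)) ->
  partial a (fun z => f (phi z)) y =
     \sum_b partial a (fun z => phi z 0 b) y * partial b f (phi y).
Proof. by move=> df dphi; exact: (derive_chain df dphi).2. Qed.

Lemma Ck_sum n k (I : Type) (r : seq I) (U : set 'rV[R]_n) (F : I -> 'rV[R]_n -> R) :
  open U -> (forall i, Ck k U (F i)) -> Ck k U (fun y => \sum_(i <- r) F i y).
Proof.
move=> oU sF; elim: r => [|i r IH].
  by apply: Ck_ext (Ck_cst k U 0) => // y _; rewrite big_nil.
by apply: Ck_ext (CkD oU (sF i) IH) => // y _; rewrite big_cons.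
Qed.

(** The chain rule writes the partial derivatives of the composite as sums of
    products of functions that are one order less regular, so induction applies. *)
Lemma Ck_comp n m k (U : set 'rV[R]_n) (V : set 'rV[R]_m) (f : 'rV[R]_m -> R)
    (phi : 'rV[R]_n -> 'rV[R]_m) :
  open U -> open V -> (forall y, U y -> V (phi y)) ->
  Ck k V f -> (forall b, Ck k U (fun y => phi y 0 b)) -> Ck k U (fun y => f (phi y)).
Proof.
move=> oU oV UV; elim: k f => [|k IH] f Cf Cphi.
  split => // y Uy; have cphi : {for y, continuous phi}.
    by apply: rV_continuous => b; exact: (Cphi b).1.
  by apply: continuous_comp => //; exact: Cf.1 (UV _ Uy).
have cphi y : U y -> {for y, continuous phi}.
  by move=> Uy; apply: rV_continuous => b; exact: (Cphi b).1.
have df y : U y -> differentiable f (phi y).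
  move=> Uy; apply: C1_differentiable.
    by apply: filterS (open_near oV (UV _ Uy)) => z Vz a; exact: (Cf.2 a).1.
  by move=> a; case: (Cf.2 a) => _; case: (k) => [|k'] [+ _]; apply; exact: UV.
split=> [y Uy|a].
  by apply: continuous_comp; [exact: cphi|exact: Cf.1 (UV _ Uy)].
split=> [y Uy|].
  exact: (derive_chain (df y Uy) (fun b => ((Cphi b).2 a).1 y Uy)).1.
apply: (@Ck_ext _ _ _ U (fun y => \sum_b partial a (fun z => phi z 0 b) y * partial b f (phi y))) => //.
  by move=> y Uy; rewrite (partial_chain (df y Uy) (fun b => ((Cphi b).2 a).1 y Uy)).
apply: Ck_sum => // b; apply: CkM => //; first exact: ((Cphi b).2 a).2.
by apply: IH; [exact: (Cf.2 b).2|move=> b'; exact: Ck_prev].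
Qed.

Lemma smooth_comp n m (U : set 'rV[R]_n) (V : set 'rV[R]_m) (f : 'rV[R]_m -> R)
    (phi : 'rV[R]_n -> 'rV[R]_m) :
  open U -> open V -> (forall y, U y -> V (phi y)) ->
  smooth_on V f -> (forall b, smooth_on U (fun y => phi y 0 b)) ->
  smooth_on U (fun y => f (phi y)).
Proof. by move=> oU oV UV sf sphi k; apply: Ck_comp (sf k) (fun b => sphi b k). Qed.

Lemma diff_R (g : R -> R) (t u : R) : differentiable g t -> 'd g t u = u * 'D_(1:R) g t.
Proof.
move=> dg; have -> : u = u *: (1 : R) :> R by rewrite [RHS]mulr1.
by rewrite linearZ /= -(deriveE _ dg) [_ *: 1]mulr1.
Qed.

Lemma is_derive_comp1 (V : normedModType R) (g : R -> R) (f : V -> R) (y v : V) dg :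
  is_derive (f y) (1:R) g dg -> derivable f y v ->
  is_derive y v (fun z => g (f z)) (dg * 'D_v f y).
Proof.
move=> dgf df; pose c (h : R) := f (h *: v + y).
have dc : derivable c 0 (1:R) by exact: (derivable1P f y v).1 df.
have c0 : c 0 = f y by rewrite /c scale0r add0r.
have diffc : differentiable c 0 by apply/derivable1_diffP.
have dg0 : derivable g (c 0) 1 by rewrite c0; exact: ex_derive.
have diffg : differentiable g (c 0) by apply/derivable1_diffP.
have dgc := differentiable_comp diffc diffg.
apply: DeriveDef; first by apply/derivable1P; exact/derivable1_diffP.
have e : (fun h : R => g (f (h *: v + y))) = g \o c by [].
rewrite derive_line e deriveE // diff_comp //=.
rewrite (diff_R _ diffg) (diff_R _ diffc) mul1r (derive_line f y v) -/c mulrC.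
by congr (_ * _); rewrite c0; exact: derive_val.
Qed.

(** The functions [t ^- m], [sqrt |t| * t ^- m] and [t ^- m * exp (- 1 / t)]
    each form a family whose derivatives stay in the family.  Composition with
    such a family preserves smoothness by a single induction. *)
Lemma smooth_family n (D : set R) (G : nat -> R -> R) (al be : nat -> R)
    (U : set 'rV[R]_n) (f : 'rV[R]_n -> R) m :
  (forall m t, D t -> is_derive t (1:R) (G m) (al m * G m.+1 t + be m * G m.+2 t)) ->
  open U -> (forall y, U y -> D (f y)) -> smooth_on U f ->
  smooth_on U (fun y => G m (f y)).
Proof.
move=> dG oU UD sf k; elim: k m => [|k IH] m.
  split => // y Uy; apply: continuous_comp; first exact: smooth_continuous sf Uy.
  apply: differentiable_continuous; apply/derivable1_diffP.
  exact: (@ex_derive _ _ _ _ _ _ _ (dG m _ (UD _ Uy))).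
have dGf y a : U y -> is_derive y (delta_mx 0 a) (fun z => G m (f z))
    ((al m * G m.+1 (f y) + be m * G m.+2 (f y)) * partial a f y).
  by move=> Uy; have := is_derive_comp1 (dG m _ (UD _ Uy)) (@smooth_derivable R n U f y a sf Uy).
split=> [y Uy|a]; first exact: Ck_continuous (IH m) Uy.
split=> [y Uy|]; first exact: (@ex_derive _ _ _ _ _ _ _ (dGf y a Uy)).
apply: (@Ck_ext _ _ _ U (fun y => (al m * G m.+1 (f y) + be m * G m.+2 (f y)) * partial a f y)) => //.
  by move=> y Uy; rewrite /partial (@derive_val _ _ _ _ _ _ _ (dGf y a Uy)).
apply: CkM => //; last exact: smooth_partial.
by apply: CkD => //; apply: CkM => //; exact: Ck_cst.
Qed.

End SmoothComposition.

(** * Inverses, square roots and cutoffs *)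

Section SmoothFunctions.
Context {R : realType}.

Lemma is_derive_invX (m : nat) (t : R) : t != 0 ->
  is_derive t (1:R) (fun t : R => t^-1 ^+ m) (- m%:R * t^-1 ^+ m.+1).
Proof.
move=> t0; have dV := is_deriveV (f := id) t0 (is_derive_id t (1:R)).
have dX := is_deriveX m dV.
rewrite (_ : (fun t : R => _) = (fun y : R => y^-1) ^+ m); last first.
  by apply/funext => u; elim: m {dX} => // m IH; rewrite !exprS IH.
apply: is_derive_eq dX _.
rewrite [_%:A]mulr1 -exprVn -[LHS]/(_ * _); case: m => [|m].
  by rewrite oppr0 !mul0r.
by rewrite mulrN mulNr -mulrA -exprD addn2.
Unshelve. all: by [].
Qed.

Lemma smooth_inv n (U : set 'rV[R]_n) (f : 'rV[R]_n -> R) :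
  open U -> (forall y, U y -> f y != 0) -> smooth_on U f -> smooth_on U (fun y => (f y)^-1).
Proof.
move=> oU f0 sf.
apply: (@smooth_family R n (fun t => t != 0) (fun m t => t^-1 ^+ m)
  (fun m => - m%:R) (fun=> 0) U f 1%N _ oU f0 sf) => m t t0.
by rewrite mul0r addr0; exact: is_derive_invX.
Qed.

Lemma is_derive_sqrt_norm (t : R) : t != 0 ->
  is_derive t (1:R) (fun t : R => Num.sqrt `|t|) (2^-1 * (Num.sqrt `|t| * t^-1)).
Proof.
have key (u : R) : 0 < u -> (2 * Num.sqrt u)^-1 = 2^-1 * (Num.sqrt u * u^-1).
  move=> u0; have s0 : Num.sqrt u != 0 by rewrite gt_eqF// sqrtr_gt0.
  rewrite -[X in _ * X^-1](sqr_sqrtr (ltW u0)) expr2; by field.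
rewrite neq_lt => /orP[t0|t0]; last first.
  apply: (@near_eq_is_derive _ _ _ Num.sqrt).
    by near=> u; rewrite gtr0_norm//; near: u; exact: lt_nbhsr.
  by rewrite gtr0_norm// -key//; exact: is_derive1_sqrt.
apply: (@near_eq_is_derive _ _ _ (Num.sqrt \o -%R)).
  by near=> u; rewrite /= ltr0_norm//; near: u; exact: lt_nbhsl.
have Nt0 : 0 < - t by rewrite oppr_gt0.
have dN : is_derive t (1:R) (-%R : R -> R) (- 1).
  exact: (is_deriveN (is_derive_id t (1:R))).
have d := is_derive1_comp (is_derive1_sqrt Nt0) dN.
apply: is_derive_eq d _.
by rewrite ltr0_norm// key// invrN !mulrN mulr1 opprK.
Unshelve. all: by end_near.
Qed.

Lemma smooth_sqrt_norm n (U : set 'rV[R]_n) (f : 'rV[R]_n -> R) :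
  open U -> (forall y, U y -> f y != 0) -> smooth_on U f ->
  smooth_on U (fun y => Num.sqrt `|f y|).
Proof.
move=> oU f0 sf.
have := (@smooth_family R n (fun t => t != 0) (fun m t => Num.sqrt `|t| * t^-1 ^+ m)
  (fun m => 2^-1 - m%:R) (fun=> 0) U f 0%N _ oU f0 sf).
have d m (t : R) : t != 0 -> is_derive t (1:R) (fun t : R => Num.sqrt `|t| * t^-1 ^+ m)
    ((2^-1 - m%:R) * (Num.sqrt `|t| * t^-1 ^+ m.+1) + 0 * (Num.sqrt `|t| * t^-1 ^+ m.+2)).
  move=> t0; have d1 := is_derive_sqrt_norm t0; have d2 := is_derive_invX m t0.
  apply: is_derive_eq (is_deriveM d1 d2) _; rewrite -![_ *: _]/(_ * _).
  by rewrite exprS; field.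
by move=> /(_ d); apply: smooth_ext => // y Uy; rewrite expr0 mulr1.
Qed.

(** [flat m] is the function [t ^- m * exp (- 1 / t)], extended by [0] to [t <= 0].
    All its derivatives are combinations of such functions, with larger [m]. *)
Definition flat (m : nat) (t : R) : R :=
  if 0 < t then t^-1 ^+ m * expR (- t^-1) else 0.

Lemma flat_pos m (t : R) : 0 < t -> 0 < flat m t.
Proof. by move=> t0; rewrite /flat t0 mulr_gt0 ?expR_gt0// exprn_gt0// invr_gt0. Qed.

(** The exponential [exp (1 / t)] is at least [t ^- (m + 1) / (m + 1)!]. *)
Lemma flat_le m (t : R) : `|flat m t| <= (m.+1)`!%:R * `|t|.
Proof.
rewrite /flat; case: ifPn => t0; last by rewrite normr0 mulr_ge0.
rewrite ger0_norm ?mulr_ge0 ?expR_ge0 ?exprn_ge0 ?invr_ge0 ?(ltW t0)//.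
rewrite gtr0_norm// expRN ler_pdivrMr ?expR_gt0//.
have s0 : 0 <= t^-1 by rewrite invr_ge0 ltW.
have := expR_ge1Dxn m s0; set E := expR _ => h.
have {}h : t^-1 ^+ m.+1 <= (m.+1)`!%:R * E.
  rewrite mulrC -ler_pdivrMr ?ltr0n ?fact_gt0//; apply: le_trans h.
  by rewrite lerDr.
rewrite mulrAC -ler_pdivrMr// mulrC -exprS //.
Qed.

Lemma flatS m (t : R) : flat m t = t * flat m.+1 t.
Proof.
rewrite /flat; case: ifPn => t0; last by rewrite mulr0.
by rewrite exprS !mulrA mulfV ?mul1r// gt_eqF.
Qed.

Lemma is_derive_quadratic (g : R -> R) (C : R) :
  (forall t, `|g t| <= C * t ^+ 2) -> is_derive (0:R) (1:R) g 0.
Proof.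
move=> gC; have C0 : 0 <= C by have := gC 1; rewrite expr1n mulr1; exact: le_trans.
have g0 : g 0 = 0.
  by apply/eqP; rewrite -normr_le0 (le_trans (gC 0))// expr0n/= mulr0.
have c : (fun h : R => h^-1 *: ((g \o shift 0) (h *: 1) - g 0)) @ 0^' --> (0 : R).
  apply/cvgrPdist_le => e e0; near=> h.
  have h0 : h != 0 by near: h; exact: nbhs_dnbhs_neq.
  have hC : `|h| < e / (C + 1) by near: h; apply: dnbhs0_lt; rewrite divr_gt0// ltr_wpDl.
  rewrite /= g0 subr0 addr0 [h *: 1]mulr1 sub0r normrN normrM normfV.
  rewrite mulrC ler_pdivrMr ?normr_gt0//; apply: le_trans (gC _) _.
  rewrite -[h ^+ 2]real_normK ?num_real// expr2 mulrA.
  rewrite ler_wpM2r//; move: hC; rewrite ltr_pdivlMr ?ltr_wpDl// => hC.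
  by rewrite mulrC (le_trans _ (ltW hC))// ler_wpM2l// lerDl.
apply: DeriveDef; first exact: cvgP c.
exact: cvg_lim c.
Unshelve. all: by end_near.
Qed.

(** At [0], writing [flat m t = t * flat (m + 1) t] shows that [flat m] is of order
    [t ^ 2]. *)
Lemma is_derive_flat m (t : R) :
  is_derive t (1:R) (flat m) (- m%:R * flat m.+1 t + 1 * flat m.+2 t).
Proof.
have [t0|t0|->] := ltgtP t 0; last first.
- rewrite [X in is_derive _ _ _ X](_ : _ = 0); last by rewrite /flat ltxx !mulr0 addr0.
  apply: (@is_derive_quadratic _ (m.+2)`!%:R) => u; rewrite flatS normrM.
  rewrite -[u ^+ 2]real_normK ?num_real// mulrC expr2 mulrA ler_wpM2r//.
  exact: flat_le.
- apply: (@near_eq_is_derive _ _ _ (fun t : R => t^-1 ^+ m * expR (- t^-1))).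
    by near=> u; rewrite /flat ifT//; near: u; exact: lt_nbhsr.
  have tn0 : t != 0 by rewrite gt_eqF.
  have d1 := is_derive_invX m tn0.
  have d2 := is_deriveN (is_derive_invX 1 tn0).
  have d3 := @is_derive1_comp R expR (fun t => - t^-1) t _ _ (is_derive_expR _) d2.
  have d4 := is_deriveM d1 d3; apply: is_derive_eq d4 _.
  rewrite /flat t0 -![_ *: _]/(_ * _) /=; rewrite !exprS expr0.
  ring.
- apply: (@near_eq_is_derive _ _ _ (fun=> 0)).
    by near=> u; rewrite /flat ifF//; apply/negbTE; rewrite -leNgt ltW//; near: u; exact: lt_nbhsl.
  have nt : (0 < t) = false by apply/negbTE; rewrite -leNgt ltW.
  by rewrite /flat nt !mulr0 addr0; exact: is_derive_cst.
Unshelve. all: by end_near.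
Qed.

Lemma smooth_flat n (U : set 'rV[R]_n) (f : 'rV[R]_n -> R) m :
  open U -> smooth_on U f -> smooth_on U (fun y => flat m (f y)).
Proof.
move=> oU sf.
by apply: (@smooth_family R n setT flat _ _ U f m _ oU _ sf) => // k t _; exact: is_derive_flat.
Qed.

Definition step (t : R) : R := flat 0 t / (flat 0 t + flat 0 (1 - t)).

Lemma step_den (t : R) : 0 < flat 0 t + flat 0 (1 - t).
Proof.
have fge (u : R) : 0 <= flat 0 u.
  by have [/(flat_pos 0)/ltW//|u0] := ltP 0 u; rewrite /flat ltNge u0.
have [t0|t0] := ltP 0 t; first by rewrite ltr_pwDl// flat_pos.
by rewrite ltr_wpDl// flat_pos// subr_gt0 (le_lt_trans t0).
Qed.

Lemma step0 (t : R) : t <= 0 -> step t = 0.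
Proof. by move=> t0; rewrite /step {1}/flat ltNge t0 mul0r. Qed.

Lemma step1 (t : R) : 1 <= t -> step t = 1.
Proof.
move=> t1; rewrite /step {3}/flat subr_gt0 ltNge t1 /= addr0 divff//.
by rewrite gt_eqF// flat_pos// (lt_le_trans _ t1).
Qed.

Lemma smooth_step n (U : set 'rV[R]_n) (f : 'rV[R]_n -> R) :
  open U -> smooth_on U f -> smooth_on U (fun y => step (f y)).
Proof.
move=> oU sf; apply: smoothM => //; first exact: smooth_flat.
apply: smooth_inv => //; first by move=> y _; rewrite gt_eqF// step_den.
apply: smoothD => //; apply: smooth_flat => //.
by apply: smoothB => //; exact: smooth_cst.
Qed.

End SmoothFunctions.

(** * Symmetry of second derivatives *)

Section SecondDerivatives.
Context {R : realType}.

Lemma derivable_translate (V : normedModType R) (f : V -> R) (c z v : V) :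
  derivable f (z + c) v -> derivable (fun u => f (u + c)) z v.
Proof.
have e : (fun h : R => h^-1 *: (((fun u => f (u + c)) \o shift z) (h *: v) - f (z + c))) =
  (fun h : R => h^-1 *: ((f \o shift (z + c)) (h *: v) - f (z + c))).
  by apply/funext => h /=; rewrite addrA.
by rewrite /derivable e.
Qed.

Lemma derive_translate (V : normedModType R) (f : V -> R) (c z v : V) :
  'D_v (fun u => f (u + c)) z = 'D_v f (z + c).
Proof.
have e : (fun h : R => h^-1 *: (((fun u => f (u + c)) \o shift z) (h *: v) - f (z + c))) =
  (fun h : R => h^-1 *: ((f \o shift (z + c)) (h *: v) - f (z + c))).
  by apply/funext => h /=; rewrite addrA.
by rewrite /derive e.
Qed.

(** The mean value theorem is applied in the direction [a] to the difference of [f]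
    in the direction [b], then in the direction [b] to the derivative. *)
Lemma second_difference n (f : 'rV[R]_n -> R) (y : 'rV[R]_n) (a b : 'I_n) (s : R) :
  (forall t u : R, `|t| <= `|s| -> `|u| <= `|s| ->
    let z := y + t *: delta_mx 0 a + u *: delta_mx 0 b in
    derivable f z (delta_mx 0 a) /\ derivable (partial a f) z (delta_mx 0 b)) ->
  exists t u : R, [/\ `|t| <= `|s|, `|u| <= `|s| &
   f (y + s *: delta_mx 0 a + s *: delta_mx 0 b) - f (y + s *: delta_mx 0 a)
     - (f (y + s *: delta_mx 0 b) - f y) =
   s * (s * partial b (partial a f) (y + t *: delta_mx 0 a + u *: delta_mx 0 b))].
Proof.
move=> df.
have zle : `|(0:R)| <= `|s| by rewrite normr0.
pose g z := f (z + s *: delta_mx 0 b) - f z.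
have dfa (t : R) : `|t| <= `|s| -> derivable f (y + t *: delta_mx 0 a) (delta_mx 0 a).
  by move=> ts; have [] := df t 0 ts zle; rewrite scale0r addr0.
have dfs (t : R) : `|t| <= `|s| ->
    derivable (fun z => f (z + s *: delta_mx 0 b)) (y + t *: delta_mx 0 a) (delta_mx 0 a).
  by move=> ts; apply: derivable_translate; have [] := df t s ts (lexx _).
have dg (t : R) : `|t| <= `|s| -> derivable g (y + t *: delta_mx 0 a) (delta_mx 0 a).
  by move=> ts; apply: derivableB; [exact: dfs|exact: dfa].
have [t ts e1] := MVT_line dg.
have [u us e2] := @MVT_line _ _ (partial a f) (y + t *: delta_mx 0 a) (delta_mx 0 b) s
   (fun u us => (df t u ts us).2).
exists t, u; split => //.
rewrite /partial in e2 *; rewrite -e2 -[LHS]/(g (y + s *: delta_mx 0 a) - g y) e1.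
by congr (_ * _); rewrite deriveB; [rewrite derive_translate|exact: dfs|exact: dfa].
Qed.

(** Schwarz's theorem. The second difference of [f] over a small square is symmetric
    in [a] and [b]; by [second_difference] it is the value of either mixed
    derivative near [y], and both are continuous. *)
Lemma partial_comm n (U : set 'rV[R]_n) (f : 'rV[R]_n -> R) (y : 'rV[R]_n) (a b : 'I_n) :
  open U -> smooth_on U f -> U y ->
  partial a (partial b f) y = partial b (partial a f) y.
Proof.
move=> oU sf Uy; apply/eqP; rewrite -subr_eq0 -normr_le0; apply/ler_addgt0Pl => e e0.
rewrite addr0; have e20 : 0 < e / 2 by rewrite divr_gt0.
have tri (p q w : R) : `|q - w| <= e / 2 -> `|p - w| <= e / 2 -> `|p - q| <= e.
  move=> h1 h2; apply: le_trans (ler_distD w _ _) _.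
  by rewrite (splitr e) lerD// distrC.
have cf c d : \forall z \near y, `|partial c (partial d f) y - partial c (partial d f) z| <= e / 2.
  have := @smooth_continuous R n U _ y (smooth_partial c (smooth_partial d sf)) Uy.
  by move=> /cvgrPdist_le /(_ _ e20).
have [r /= r0 rP] := (nbhs_ballP _ _).1 (filterI (open_near oU Uy) (filterI (cf a b) (cf b a))).
(* [r / 3], since the points used differ from [y] by at most [2 s] *)
pose s := r / 3.
have s0 : 0 < s by rewrite divr_gt0.
have near_y (c d : 'I_n) (t u : R) : `|t| <= `|s| -> `|u| <= `|s| ->
    ball y r (y + t *: delta_mx 0 c + u *: delta_mx 0 d).
  move=> ts us; rewrite -ball_normE /= -addrA opprD addrA subrr sub0r normrN.
  have dle (k : 'I_n) (w : R) : `|w| <= `|s| -> `|w *: delta_mx 0 k : 'rV[R]_n| <= s.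
    move=> ws; rewrite [leLHS]mx_normrE; apply/bigmax_leP; split; first exact: ltW.
    move=> [i j] _; rewrite !mxE normrM.
    by case: (_ && _); rewrite ?normr1 ?normr0 ?mulr1 ?mulr0 ?(ltW s0)// (le_trans ws)// gtr0_norm.
  apply: le_lt_trans (ler_normD _ _) _.
  apply: le_lt_trans (lerD (dle _ _ ts) (dle _ _ us)) _.
  rewrite /s; lra.
have dU (c d : 'I_n) (t u : R) : `|t| <= `|s| -> `|u| <= `|s| ->
    let z := y + t *: delta_mx 0 c + u *: delta_mx 0 d in
    derivable f z (delta_mx 0 c) /\ derivable (partial c f) z (delta_mx 0 d).
  move=> ts us /=; have [Uz _] := rP _ (near_y c d t u ts us).
  split; first exact: smooth_derivable sf Uz.
  exact: smooth_derivable (smooth_partial c sf) Uz.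
have [t [u [ts us e1]]] := second_difference (dU a b).
have [t' [u' [ts' us' e2]]] := second_difference (dU b a).
have e3 : partial b (partial a f) (y + t *: delta_mx 0 a + u *: delta_mx 0 b) =
          partial a (partial b f) (y + t' *: delta_mx 0 b + u' *: delta_mx 0 a).
  have sn : s != 0 by rewrite gt_eqF.
  apply: (mulfI sn); apply: (mulfI sn); apply: (etrans (esym e1)); apply: (etrans _ e2).
  by rewrite [y + s *: _ + s *: delta_mx 0 a]addrAC opprB opprB; ring.
have [_ [_ h1]] := rP _ (near_y a b t u ts us).
have [_ [h2 _]] := rP _ (near_y b a t' u' ts' us').
rewrite /= in h1 h2; rewrite e3 in h1.
exact: (tri _ _ _ h1 h2).
Qed.

End SecondDerivatives.

(** * The derivative of the determinant *)

Section Determinant.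
Context {R : realType}.

Lemma det_add_delta n (A : 'M[R]_n) (i j : 'I_n) (h : R) :
  \det (A + h *: delta_mx i j) = \det A + h * cofactor A i j.
Proof.
have cof k : cofactor (A + h *: delta_mx i j) i k = cofactor A i k.
  rewrite /cofactor; congr (_ * \det _); apply/matrixP => p q; rewrite !mxE.
  by rewrite eq_sym (negbTE (neq_lift _ _)) /= mulr0 addr0.
rewrite (expand_det_row _ i) [in RHS](expand_det_row _ i).
under eq_bigr => k _ do rewrite cof !mxE eqxx /= mulrDl.
rewrite big_split /=; congr (_ + _); rewrite (bigD1 j)//= eqxx mulr1 big1 ?addr0// => k kj.
by rewrite (negbTE kj) mulr0 mul0r.
Qed.

Lemma smooth_det n m (U : set 'rV[R]_n) (A : 'rV[R]_n -> 'M[R]_m) :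
  open U -> (forall i j, smooth_on U (fun y => A y i j)) -> smooth_on U (fun y => \det (A y)).
Proof.
move=> oU sA; apply: smooth_sum => // s _; apply: smoothM => //; first exact: smooth_cst.
by apply: smooth_prod => // i _; exact: sA.
Qed.

Lemma partial_det_vec m (v : 'rV[R]_(m * m)) i j :
  partial (mxvec_index i j) (fun v => \det (vec_mx v)) v = cofactor (vec_mx v) i j.
Proof.
have e : (fun h : R => h^-1 *: (((fun v : 'rV[R]_(m * m) => \det (vec_mx v)) \o shift v)
    (h *: delta_mx 0 (mxvec_index i j)) - \det (vec_mx v))) =
    (fun h : R => h^-1 * (h * cofactor (vec_mx v) i j)).
  apply/funext => h /=; rewrite linearP /= vec_mx_delta [_ + vec_mx v]addrC det_add_delta.
  by rewrite addrAC subrr add0r.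
rewrite /partial /derive e; apply: cvg_lim => //.
apply: (@cvg_trans _ ((fun=> cofactor (vec_mx v) i j) @ 0^')); last exact: cvg_cst.
apply: near_eq_cvg; near=> h; have h0 : h != 0 by near: h; exact: nbhs_dnbhs_neq.
by rewrite mulKf.
Unshelve. all: by end_near.
Qed.

(** Jacobi's formula: the determinant is a polynomial in the entries, and by Laplace
    expansion its derivative in the entry [(i, j)] is the cofactor. *)
Lemma derive_det (V : normedModType R) m (A : V -> 'M[R]_m) (y v : V) :
  (forall i j, derivable (fun z => A z i j) y v) ->
  'D_v (fun z => \det (A z)) y =
    \sum_i \sum_j 'D_v (fun z => A z i j) y * cofactor (A y) i j.
Proof.
move=> dA; pose f (v : 'rV[R]_(m * m)) := \det (vec_mx v).
have sf : smooth_on setT f.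
  apply: smooth_det; first exact: openT.
  by move=> i j; apply: (smooth_ext openT _ (smooth_coord _ (mxvec_index i j))) => z _; rewrite mxE.
have dfv (w : 'rV[R]_(m * m)) : differentiable f w by exact: smooth_differentiable openT sf _.
have -> : (fun z => \det (A z)) = (fun z => f (mxvec (A z))).
  by apply/funext => z; rewrite /f mxvecK.
have dvec b : derivable (fun z => mxvec (A z) 0 b) y v.
  by case/mxvec_indexP: b => i j; rewrite (_ : (fun z => _) = fun z => A z i j) //;
     apply/funext => z; rewrite mxvecE.
rewrite (derive_chain (dfv _) dvec).2 pair_big /=.
rewrite (reindex _ (curry_mxvec_bij m m)) /=.
apply: eq_bigr => -[i j] _ /=; rewrite partial_det_vec mxvecK; congr (_ * _).
by congr ('D_v _ y); apply/funext => z; rewrite mxvecE.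
Qed.

End Determinant.

(** * Integrals over a bounded interval *)

Section CompactIntegral.
Context {R : realType}.
Local Notation mu := (@lebesgue_measure R).

Definition within_box (r : R) (f : R -> R) := forall s, r < `|s| -> f s = 0.

Lemma within_box_restrict (r : R) (f : R -> R) : within_box r f -> f \_ `[- r, r] = f.
Proof.
move=> fr; apply/funext => s; rewrite patchE; case: ifPn => // /negP ns.
apply/esym/fr; rewrite ltNge; apply/negP => rs; apply: ns.
by rewrite inE /= in_itv /= -ler_norml.
Qed.

Lemma integrable_box (r : R) (f : R -> R) :
  continuous f -> within_box r f -> mu.-integrable setT (EFin \o f).
Proof.
move=> cf fr.
have : mu.-integrable `[- r, r] (EFin \o f).
  apply: continuous_compact_integrable; first exact: segment_compact.
  exact: continuous_subspaceT.
move/integrable_mkcond => /(_ (measurable_itv _)).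
by rewrite restrict_EFin within_box_restrict.
Qed.

(** The integrable function that dominates every function bounded by [C] and
    vanishing off the box. *)
Definition box_bound (r C : R) : R -> R := (fun=> C) \_ `[- r, r].

Lemma integrable_box_bound (r C : R) : mu.-integrable setT (EFin \o box_bound r C).
Proof.
have : mu.-integrable `[- r, r] (EFin \o (fun=> C)).
  apply: continuous_compact_integrable; first exact: segment_compact.
  by apply: continuous_subspaceT => x; exact: cst_continuous.
move/integrable_mkcond => /(_ (measurable_itv _)).
by rewrite restrict_EFin.
Qed.

Lemma box_boundP (r C : R) (f : R -> R) : (forall s, `|f s| <= C) -> within_box r f ->
  forall s, `|f s| <= box_bound r C s.
Proof.
move=> fC fr s; rewrite /box_bound patchE; case: ifPn => // /negP ns.
rewrite fr ?normr0//; rewrite ltNge; apply/negP => rs; apply: ns.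
by rewrite inE /= in_itv /= -ler_norml.
Qed.

Lemma Rintegral_box_le (r C : R) (f : R -> R) :
  continuous f -> (forall s, `|f s| <= C) -> within_box r f ->
  `|(\int[mu]_(s in setT) f s)%R| <= (\int[mu]_(s in setT) box_bound r C s)%R.
Proof.
move=> cf fC fr; apply: le_trans (le_normr_Rintegral measurableT (integrable_box cf fr)) _.
apply: le_Rintegral => //; last by move=> s _; exact: box_boundP.
- have cn : continuous (fun s => `|f s|).
    by move=> s; apply: continuous_comp; [exact: cf|exact: norm_continuous].
  by apply: (@integrable_box r _ cn) => s rs; rewrite fr ?normr0.
- exact: integrable_box_bound.
Qed.

Lemma Rintegral_box_continuous (r C : R) (F : R -> R -> R) :
  (forall t, continuous (F t)) -> (forall s, continuous (F ^~ s)) ->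
  (forall t s, `|F t s| <= C) -> (forall t, within_box r (F t)) ->
  continuous (fun t => \int[mu]_(s in setT) F t s)%R.
Proof.
move=> cF1 cF2 FC Fr t.
apply: (@continuity_under_integral R _ _ mu F setT measurableT (t - 1) (t + 1)
  _ _ (box_bound r C)) => //.
- by move=> u _; exact: integrable_box (cF1 u) (Fr u).
- by apply: aeW => s _ u _; exact: cF2.
- exact: integrable_box_bound.
- by move=> u _; apply: aeW => s _; exact: box_boundP (FC u) (Fr u) s.
- by rewrite inE /= in_itv /=; apply/andP; split; lra.
Qed.

Lemma Rintegral_box_derive (r C : R) (F : R -> R -> R) (t : R) :
  (forall t, continuous (F t)) -> (forall t, within_box r (F t)) ->
  (forall t s, derivable (F ^~ s) t 1) ->
  (forall t s, `|'D_1 (F ^~ s) t| <= C) -> 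
  derivable (fun t => \int[mu]_(s in setT) F t s)%R t 1 /\
  'D_1 (fun t => \int[mu]_(s in setT) F t s)%R t = (\int[mu]_(s in setT) 'D_1 (F ^~ s) t)%R.
Proof.
move=> cF Fr dF dFC.
have C0 : 0 <= C by exact: le_trans (dFC 0 0).
have It : [set` `]t - 1, t + 1[%R] t by rewrite /= in_itv /=; apply/andP; split; lra.
have iF u : [set` `]t - 1, t + 1[%R] u -> mu.-integrable setT (EFin \o F u).
  by move=> _; exact: integrable_box (cF u) (Fr u).
have g0 s : 0 <= box_bound r C s by rewrite /box_bound patchE; case: ifP.
have dr u : within_box r (fun s => 'D_1 (F ^~ s) u).
  move=> s rs; rewrite (_ : F ^~ s = fun=> 0) ?derive_cst//.
  by apply/funext => w; exact: Fr.
have bd u s : [set` `]t - 1, t + 1[%R] u -> setT s -> `|partial1of2 F u s| <= box_bound r C s.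
  by move=> _ _; rewrite partial1of2E; exact: box_boundP (dFC u) (dr u) s.
have dF' u s : [set` `]t - 1, t + 1[%R] u -> setT s -> derivable (F ^~ s) u 1 by [].
split.
  exact: (derivable_under_integral measurableT It iF dF' g0 (integrable_box_bound r C) bd).
have := differentiation_under_integral measurableT It iF dF' g0 (integrable_box_bound r C) bd.
rewrite derive1E => ->; apply: eq_Rintegral => s _; exact: partial1of2E.
Qed.

Lemma Rintegral_box_derivative (r : R) (F : R -> R) :
  0 <= r -> within_box r F -> (forall t, derivable F t 1) ->
  continuous (fun t => 'D_1 F t) -> (\int[mu]_(t in setT) 'D_1 F t)%R = 0.
Proof.
move=> r0 Fr dF cF; pose r1 := r + 1.
have dr : within_box r1 (fun t => 'D_1 F t).
  move=> t rt; rewrite (@near_eq_derive _ _ _ F (fun=> 0)) ?derive_cst//.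
  have tn : r < `|t| by apply: le_lt_trans rt; rewrite lerDl.
  have : \forall u \near t, r < `|u|.
    exact: (norm_continuous (lt_nbhsr tn)).
  by apply: filterS => u; exact: Fr.
rewrite -(within_box_restrict dr) -Rintegral_mkcond /Rintegral.
have r1N : - r1 < r1 by rewrite /r1; lra.
rewrite (continuous_FTC2 (F := F) r1N).
- have e1 : F r1 = 0 by apply: Fr; rewrite ger0_norm /r1; lra.
  have e2 : F (- r1) = 0 by apply: Fr; rewrite normrN ger0_norm /r1; lra.
  by rewrite e1 e2 -EFinB subrr.
- exact: continuous_subspaceT.
- split=> [t _||]; first exact: dF.
  + apply: cvg_at_right_filter; apply: differentiable_continuous; exact/derivable1_diffP.
  + apply: cvg_at_left_filter; apply: differentiable_continuous; exact/derivable1_diffP.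
- by move=> t _; rewrite derive1E.
Qed.

End CompactIntegral.

(** * The divergence theorem in four variables *)

Section IteratedIntegral.
Context {R : realType}.
Local Notation mu := (@lebesgue_measure R).

Definition upd n (a : 'I_n) (y : 'rV[R]_n) (t : R) : 'rV[R]_n :=
  \row_j (if j == a then t else y 0 j).

Definition int_coord n (a : 'I_n) (f : 'rV[R]_n -> R) (y : 'rV[R]_n) : R :=
  (\int[mu]_(t in setT) f (upd a y t))%R.

Definition int_coords n (l : seq 'I_n) (f : 'rV[R]_n -> R) : 'rV[R]_n -> R :=
  foldl (fun g a => int_coord a g) f l.

(** This class is stable under integrating out one coordinate [a], which removes [a]
    from [S]: the bound and the box make dominated convergence available, and only
    continuity along the coordinate lines is needed. *)
Definition tame n (S : {set 'I_n}) (r : R) (f : 'rV[R]_n -> R) : Prop :=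
  [/\ exists C, forall y, `|f y| <= C,
      forall (y : 'rV[R]_n) b, b \in S -> r < `|y 0 b| -> f y = 0 &
      forall c (y : 'rV[R]_n), continuous (fun t => f (upd c y t))].

Lemma upd_eq n (a : 'I_n) y t : upd a y t 0 a = t.
Proof. by rewrite mxE eqxx. Qed.

Lemma upd_neq n (a b : 'I_n) y t : b != a -> upd a y t 0 b = y 0 b.
Proof. by move=> ba; rewrite mxE (negbTE ba). Qed.

Lemma upd_idem n (a : 'I_n) y s t : upd a (upd a y s) t = upd a y t.
Proof. by apply/rowP => j; rewrite !mxE; case: (j == a). Qed.

Lemma upd_id n (a : 'I_n) y : upd a y (y 0 a) = y.
Proof. by apply/rowP => j; rewrite !mxE; case: ifP => [/eqP ->|]. Qed.

Lemma updC n (a b : 'I_n) y s t : a != b -> upd a (upd b y s) t = upd b (upd a y t) s.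
Proof.
move=> ab; apply/rowP => j; rewrite !mxE.
by have [->|ja] := eqVneq j a; rewrite ?(negbTE ab).
Qed.

Lemma updE n (a : 'I_n) y t : upd a y t = (t - y 0 a) *: delta_mx 0 a + y.
Proof.
apply/rowP => j; rewrite !mxE /=; case: eqVneq => [->|_]; first by rewrite mulr1 subrK.
by rewrite mulr0 add0r.
Qed.

Lemma upd_quotient n (a : 'I_n) (f : 'rV[R]_n -> R) y :
  (fun h : R => h^-1 *: (((fun t => f (upd a y t)) \o shift (y 0 a)) (h *: 1) - f (upd a y (y 0 a)))) =
  (fun h : R => h^-1 *: ((f \o shift y) (h *: delta_mx 0 a) - f y)).
Proof. by apply/funext => h /=; rewrite upd_id updE addrK [h *: 1]mulr1. Qed.

Lemma derivable_upd n (a : 'I_n) (f : 'rV[R]_n -> R) y s :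
  derivable f (upd a y s) (delta_mx 0 a) <-> derivable (fun t => f (upd a y t)) s 1.
Proof.
have := upd_quotient a f (upd a y s); rewrite upd_eq upd_idem.
have -> : (fun t => f (upd a (upd a y s) t)) = (fun t => f (upd a y t)).
  by apply/funext => t; rewrite upd_idem.
by rewrite /derivable => ->.
Qed.

Lemma partial_upd n (a : 'I_n) (f : 'rV[R]_n -> R) y s :
  partial a f (upd a y s) = 'D_1 (fun t => f (upd a y t)) s.
Proof.
have := upd_quotient a f (upd a y s); rewrite upd_eq upd_idem.
have -> : (fun t => f (upd a (upd a y s) t)) = (fun t => f (upd a y t)).
  by apply/funext => t; rewrite upd_idem.
by rewrite /partial /derive => ->.
Qed.

Lemma tame_box n (S : {set 'I_n}) r f a y : tame S r f -> a \in S ->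
  within_box r (fun t => f (upd a y t)).
Proof. by move=> [_ fS _] aS t rt; apply: (fS _ a) => //; rewrite upd_eq. Qed.

Lemma tame_int_coord n (S : {set 'I_n}) r f a :
  a \in S -> tame S r f -> tame (S :\ a) r (int_coord a f).
Proof.
move=> aS tf; have [[C fC] fS cf] := tf; split.
- eexists => y; apply: (@Rintegral_box_le R r C) => //; exact: tame_box tf aS.
- move=> y b; rewrite !inE => /andP[ba bS] rb.
  rewrite /int_coord (_ : (fun t => _) = fun=> 0) ?Rintegral_cst ?mul0r//.
  by apply/funext => t; apply: (fS _ b) => //; rewrite upd_neq.
- move=> c y; have [ca|ca] := eqVneq c a.
    rewrite ca (_ : (fun t => _) = fun=> int_coord a f y); first by move=> ?; exact: cst_continuous.
    by apply/funext => t; rewrite /int_coord; apply: eq_Rintegral => s _; rewrite upd_idem.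
  apply: (@Rintegral_box_continuous R r C (fun t s => f (upd a (upd c y t) s))) => //.
    move=> s; rewrite (_ : (fun t => _) = fun t => f (upd c (upd a y s) t)); first exact: cf.
    by apply/funext => t; rewrite updC// eq_sym.
  by move=> t; exact: tame_box tf aS.
Qed.

Lemma int_coord0 n (a : 'I_n) : int_coord a (fun=> 0) = fun=> 0.
Proof. by apply/funext => y; rewrite /int_coord Rintegral_cst ?mul0r. Qed.

Lemma int_coords0 n (l : seq 'I_n) : int_coords l (fun=> 0) = fun=> 0.
Proof. by elim: l => // a l IH; rewrite /int_coords /= int_coord0. Qed.

Lemma int_coord_partial n (S : {set 'I_n}) r V a b :
  b \in S -> a != b -> tame S r V -> (forall y, derivable V y (delta_mx 0 a)) ->
  tame S r (partial a V) ->
  (forall y, derivable (int_coord b V) y (delta_mx 0 a)) /\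
  partial a (int_coord b V) = int_coord b (partial a V).
Proof.
move=> bS ab tV dV tdV; have [_ _ cV] := tV; have [[C dC] _ _] := tdV.
have key y : derivable (int_coord b V) (upd a y (y 0 a)) (delta_mx 0 a) /\
   partial a (int_coord b V) (upd a y (y 0 a)) = int_coord b (partial a V) y.
  have Fs s : (fun t => V (upd b (upd a y t) s)) = fun t => V (upd a (upd b y s) t).
    by apply/funext => t; rewrite updC// eq_sym.
  have [||||h1 h2] := @Rintegral_box_derive R r C (fun t s => V (upd b (upd a y t) s)) (y 0 a).
  - by move=> t; exact: cV.
  - by move=> t; exact: tame_box tV bS.
  - by move=> t s /=; rewrite Fs; apply/derivable_upd.
  - by move=> t s /=; rewrite Fs -partial_upd.
  split; first exact/derivable_upd.
  rewrite partial_upd [LHS]h2; apply: eq_Rintegral => s _.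
  by rewrite /= Fs -partial_upd updC// upd_id.
split=> [y|]; first by have := (key y).1; rewrite upd_id.
by apply/funext => y; have := (key y).2; rewrite upd_id.
Qed.

Lemma int_coord_partial_same n (S : {set 'I_n}) r V a :
  0 <= r -> a \in S -> tame S r V -> (forall y, derivable V y (delta_mx 0 a)) ->
  tame S r (partial a V) -> int_coord a (partial a V) = fun=> 0.
Proof.
move=> r0 aS tV dV [_ _ cdV]; apply/funext => y; rewrite /int_coord.
under eq_Rintegral => t _ do rewrite partial_upd.
apply: (Rintegral_box_derivative r0); first exact: tame_box tV aS.
  by move=> t; apply/derivable_upd.
have := cdV a y; rewrite (_ : (fun t => partial a V _) = fun t => 'D_1 (fun t => V (upd a y t)) t)//.
by apply/funext => t; rewrite partial_upd.
Qed.

(** Integrating out a coordinate other than [a] commutes with the derivative in the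
    direction [a]; integrating out [a] itself gives [0] by the fundamental theorem
    of calculus. *)
Lemma int_coords_partial n (l : seq 'I_n) (S : {set 'I_n}) r V a :
  0 <= r -> uniq l -> {subset l <= S} -> a \in l ->
  tame S r V -> (forall y, derivable V y (delta_mx 0 a)) -> tame S r (partial a V) ->
  int_coords l (partial a V) = fun=> 0.
Proof.
move=> r0; elim: l S V => // b l IH S V /= /andP[bl ul] lS al tV dV tdV.
have bS : b \in S by apply: lS; rewrite mem_head.
have [ab|ab] := eqVneq a b.
  rewrite /int_coords /= -ab (int_coord_partial_same r0 _ tV)// ?ab// -/(int_coords _ _).
  exact: int_coords0.
have [d1 d2] := int_coord_partial bS ab tV dV tdV.
rewrite /int_coords /= -d2; apply: (IH (S :\ b)) => //.
- move=> c cl; rewrite !inE lS ?in_cons ?cl ?orbT// andbT.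
  by apply: contraNneq bl => <-.
- by move: al; rewrite in_cons (negbTE ab).
- exact: tame_int_coord.
- by rewrite d2; exact: tame_int_coord.
Qed.

Lemma tameD n (S : {set 'I_n}) r f g : tame S r f -> tame S r g -> tame S r (fun y => f y + g y).
Proof.
move=> [[C fC] fS cf] [[D gD] gS cg]; split.
- by exists (C + D) => y; rewrite (le_trans (ler_normD _ _))// lerD.
- by move=> y b bS rb; rewrite (fS _ b)// (gS _ b)// addr0.
- by move=> c y t; exact: (cvgD (cf c y t) (cg c y t)).
Qed.

Lemma tame0 n (S : {set 'I_n}) r : tame S r (fun=> 0).
Proof.
split=> //; first by exists 0 => y; rewrite normr0.
by move=> c y; exact: cst_continuous.
Qed.

Lemma int_coordsD n (l : seq 'I_n) (S : {set 'I_n}) r f g :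
  uniq l -> {subset l <= S} -> tame S r f -> tame S r g ->
  int_coords l (fun y => f y + g y) = fun y => int_coords l f y + int_coords l g y.
Proof.
elim: l S f g => // b l IH S f g /= /andP[bl ul] lS tf tg.
have bS : b \in S by apply: lS; rewrite mem_head.
rewrite /int_coords /= (_ : int_coord b _ = fun y => int_coord b f y + int_coord b g y).
  apply: (IH (S :\ b)) => //; [|exact: tame_int_coord..].
  move=> c cl; rewrite !inE lS ?in_cons ?cl ?orbT// andbT.
  by apply: contraNneq bl => <-.
have [_ _ cf] := tf; have [_ _ cg] := tg.
apply/funext => y; rewrite /int_coord RintegralD//.
- by apply: (integrable_box (cf b y)); exact: tame_box tf bS.
- by apply: (integrable_box (cg b y)); exact: tame_box tg bS.
Qed.

(** [int_coords] integrates out the head of the list first, and the last variable is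
    the innermost one in [int4]. *)
Definition coords4 : seq 'I_4 := [:: inord 3; inord 2; inord 1; inord 0].

Lemma int4E (f : 'rV[R]_4 -> R) : int4 f = int_coords coords4 f 0.
Proof.
rewrite /int4 /int_coords /= /int_coord.
apply: eq_Rintegral => t0 _; apply: eq_Rintegral => t1 _.
apply: eq_Rintegral => t2 _; apply: eq_Rintegral => t3 _.
congr (f _); apply/rowP => -[[|[|[|[|//]]]] i]; rewrite !mxE -!val_eqE /= !inordK //=.
Qed.

Lemma uniq_coords4 : uniq coords4.
Proof. by rewrite /coords4 /= !inE -!val_eqE /= !inordK. Qed.

Lemma mem_coords4 a : a \in coords4.
Proof. by case: a => [[|[|[|[|//]]]] i]; rewrite !inE -!val_eqE /= !inordK. Qed.

Lemma int4_tame_divergence r (V : 'I_4 -> 'rV[R]_4 -> R) : 0 <= r ->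
  (forall a, tame [set: 'I_4] r (V a)) -> (forall a y, derivable (V a) y (delta_mx 0 a)) ->
  (forall a, tame [set: 'I_4] r (partial a (V a))) ->
  int4 (fun y => \sum_a partial a (V a) y) = 0.
Proof.
move=> r0 tV dV tdV; rewrite int4E.
have sub : {subset coords4 <= [set: 'I_4]%SET} by move=> b _; rewrite inE.
have : tame [set: 'I_4] r (fun y => \sum_a partial a (V a) y) /\
    int_coords coords4 (fun y => \sum_a partial a (V a) y) = fun=> 0.
  elim: (index_enum _) => [|a s [t1 e1]].
    rewrite (_ : (fun y => _) = fun=> 0); first by rewrite int_coords0; split => //; exact: tame0.
    by apply/funext => y; rewrite big_nil.
  rewrite (_ : (fun y => _) = fun y => partial a (V a) y + \sum_(a <- s) partial a (V a) y); last first.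
    by apply/funext => y; rewrite big_cons.
  split; first exact: tameD.
  rewrite (@int_coordsD 4 coords4 _ r _ _ uniq_coords4 sub (tdV a) t1) e1.
  rewrite (@int_coords_partial 4 coords4 _ r _ _ r0 uniq_coords4 sub (mem_coords4 a) (tV a))//.
  by apply/funext => y; rewrite addr0.
by move=> [_ ->].
Qed.

Lemma tame_compact n (K : set 'rV[R]_n) r (f : 'rV[R]_n -> R) :
  compact K -> (forall y, K y -> `|y| <= r) -> smooth_on setT f -> (forall y, ~ K y -> f y = 0) ->
  tame [set: 'I_n] r f.
Proof.
move=> cK Kr sf fK; have cf : continuous f by move=> y; exact: smooth_continuous sf _.
split.
- have [K0|/set0P K0] := eqVneq K set0.
    by exists 0 => y; rewrite fK ?normr0// K0.
  have cn : continuous (fun y => `|f y|).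
    by move=> s; apply: continuous_comp; [exact: cf|exact: norm_continuous].
  have [c cKc cmax] := compact_EVT_max K0 cK (continuous_subspaceT cn).
  exists `|f c| => y; have [Ky|nKy] := pselect (K y); first by apply: cmax; rewrite inE.
  by rewrite fK// normr0.
- move=> y b _ rb; apply: fK => /Kr; apply/negP; rewrite -ltNge (lt_le_trans rb)//.
  exact: mx_coord_le.
- move=> c y t; apply: continuous_comp; last exact: cf.
  apply: rV_continuous => j; rewrite (_ : (fun z => _) = if j == c then id else fun=> y 0 j).
    by case: ifP => _; [exact: cvg_id|exact: cst_continuous].
  by apply/funext => z; rewrite mxE; case: ifP.
Qed.

Lemma partial_off_closed n (K : set 'rV[R]_n) (f : 'rV[R]_n -> R) a y :
  closed K -> (forall y, ~ K y -> f y = 0) -> ~ K y -> partial a f y = 0.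
Proof.
move=> cK fK nKy; rewrite (@partial_ext _ _ (~` K) f (fun=> 0) a y)//.
- by rewrite /partial derive_cst.
- exact: closed_openC.
Qed.

Lemma int4_divergence (K : set 'rV[R]_4) (V : 'I_4 -> 'rV[R]_4 -> R) :
  compact K -> (forall a, smooth_on setT (V a)) -> (forall a y, ~ K y -> V a y = 0) ->
  int4 (fun y => \sum_a partial a (V a) y) = 0.
Proof.
move=> cK sV VK.
have clK : closed K by apply: compact_closed => //; exact: norm_hausdorff.
have [r r0 Kr] : exists2 r : R, 0 <= r & forall y, K y -> `|y| <= r.
  have [m [_ mP]] := compact_bounded cK.
  exists (`|m| + 1) => [|y Ky]; first by rewrite addr_ge0.
  by apply: (mP (`|m| + 1)) => //; rewrite (le_lt_trans (ler_norm m))// ltrDl.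
apply: (@int4_tame_divergence r) => //.
- by move=> a; apply: (tame_compact cK Kr (sV a)) => y; exact: VK.
- by move=> a y; exact: smooth_derivable (sV a) _.
- move=> a; apply: (tame_compact cK Kr (smooth_partial a (sV a))) => y.
  by apply: partial_off_closed => // z; exact: VK.
Qed.

End IteratedIntegral.

(** * Hermitian matrices and Minkowski space *)

Section Spinors.
Context {R : realType}.
Local Notation C := R[i].

Definition o0 : 'I_4 := @Ordinal 4 0 isT.
Definition o1 : 'I_4 := @Ordinal 4 1 isT.
Definition o2 : 'I_4 := @Ordinal 4 2 isT.
Definition o3 : 'I_4 := @Ordinal 4 3 isT.

Lemma ord4P (P : 'I_4 -> Prop) : P o0 -> P o1 -> P o2 -> P o3 -> forall j, P j.
Proof.
move=> p0 p1 p2 p3 [[|[|[|[|//]]]] lt].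
- by rewrite (_ : Ordinal lt = o0) //; apply/val_inj.
- by rewrite (_ : Ordinal lt = o1) //; apply/val_inj.
- by rewrite (_ : Ordinal lt = o2) //; apply/val_inj.
- by rewrite (_ : Ordinal lt = o3) //; apply/val_inj.
Qed.

Lemma ord2P (P : 'I_2 -> Prop) : P 0 -> P 1 -> forall j, P j.
Proof.
move=> p0 p1 [[|[|//]] lt].
- by rewrite (_ : Ordinal lt = 0) //; apply/val_inj.
- by rewrite (_ : Ordinal lt = 1) //; apply/val_inj.
Qed.

Lemma sum4 (V : nmodType) (u : 'I_4 -> V) : \sum_(a < 4) u a = u o0 + u o1 + u o2 + u o3.
Proof.
by rewrite !big_ord_recl big_ord0 addr0 !addrA; congr (u _ + u _ + u _ + u _); apply/val_inj.
Qed.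

Lemma sum2 (V : nmodType) (u : 'I_2 -> V) : \sum_(a < 2) u a = u 0 + u 1.
Proof. by rewrite big_ord_recl big_ord1; congr (_ + u _); apply/val_inj. Qed.

Lemma adjmxM m n p (X : 'M[C]_(m, n)) (Y : 'M[C]_(n, p)) :
  adjmx (X *m Y) = adjmx Y *m adjmx X.
Proof. by rewrite /adjmx map_mxM trmx_mul. Qed.

Lemma adjmx1 n : adjmx (1%:M : 'M[C]_n) = 1%:M.
Proof. by rewrite /adjmx map_mx1 trmx1. Qed.

Lemma det_adjmx n (X : 'M[C]_n) : \det (adjmx X) = (\det X)^*%C.
Proof. by rewrite /adjmx det_tr det_map_mx. Qed.

Lemma mx2_eta (X : 'M[C]_2) : X = mx2 (X 0 0) (X 0 1) (X 1 0) (X 1 1).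
Proof. by apply/matrixP; apply: ord2P; apply: ord2P; rewrite !mxE. Qed.

Lemma mx2M (a b c d a' b' c' d' : C) :
  mx2 a b c d *m mx2 a' b' c' d' =
  mx2 (a * a' + b * c') (a * b' + b * d') (c * a' + d * c') (c * b' + d * d').
Proof. by apply/matrixP; apply: ord2P; apply: ord2P; rewrite !mxE sum2 !mxE. Qed.

Lemma adjmx_mx2 (a b c d : C) : adjmx (mx2 a b c d) = mx2 (a^*)%C (c^*)%C (b^*)%C (d^*)%C.
Proof. by apply/matrixP; apply: ord2P; apply: ord2P; rewrite !mxE. Qed.

Lemma det_mx2E (a b c d : C) : \det (mx2 a b c d) = a * d - b * c.
Proof.
rewrite (expand_det_row _ 0) sum2 /cofactor !det_mx11 !mxE /=.
by rewrite expr0 mul1r -[(0 + 1 %% 2)%N]/1%N expr1 mulN1r mulrN.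
Qed.

Lemma mx2_1 : mx2 1 0 0 1 = 1%:M :> 'M[C]_2.
Proof. by apply/matrixP; apply: ord2P; apply: ord2P; rewrite !mxE. Qed.

(** [p |-> herm p] identifies Minkowski space with the Hermitian matrices. All facts
    about [Ad] below come from this picture: [det] is minus the Minkowski form
    ([det_herm]), and [Ad S] is the congruence by [S] ([Ad_herm]). *)
Definition herm (p : 'rV[R]_4) : 'M[C]_2 := \sum_(j < 4) (p 0 j)%:C%C *: pauli j.

Lemma hermE (p : 'rV[R]_4) : herm p =
  mx2 ((p 0 o3 + p 0 o2) +i* 0) (p 0 o0 -i* p 0 o1) (p 0 o0 +i* p 0 o1) ((p 0 o3 - p 0 o2) +i* 0).
Proof.
rewrite /herm sum4; apply/matrixP; apply: ord2P; apply: ord2P; rewrite !mxE /=; simpc;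
  by apply/eqP; rewrite eq_complex /=; apply/andP; split; apply/eqP; ring.
Qed.

Lemma herm_inj : injective herm.
Proof.
move=> p q; rewrite !hermE => /matrixP e.
have := e 0 0; have := e 0 1; have := e 1 1.
rewrite !mxE /= => -[e1] [e2 e3] [e4].
apply/rowP; apply: ord4P => //; lra.
Qed.

Lemma herm_delta j : herm (delta_mx 0 j) = pauli j.
Proof.
rewrite /herm (bigD1 j)//= mxE !eqxx scale1r big1 ?addr0// => k kj.
by rewrite mxE (negbTE kj) scale0r.
Qed.

Lemma det_herm (p : 'rV[R]_4) : \det (herm p) = (- (p *m eta *m p^T) 0 0)%:C%C.
Proof.
rewrite hermE det_mx2E; simpc; apply/eqP; rewrite eq_complex /=; apply/andP; split; apply/eqP.
  rewrite !mxE sum4 !mxE !sum4 !mxE /=; ring.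
ring.
Qed.

Lemma Ad_herm (S : 'M[C]_2) (p : 'rV[R]_4) : adjmx S *m herm p *m S = herm (p *m Ad S).
Proof.
rewrite /herm mulmx_sumr mulmx_suml.
under eq_bigr => j _ do rewrite -scalemxAr -scalemxAl Ad_spec scaler_sumr.
rewrite exchange_big /=; apply: eq_bigr => k _.
rewrite !mxE rmorph_sum scaler_suml; apply: eq_bigr => j _.
by rewrite scalerA rmorphM.
Qed.

Lemma Ad_unique (S : 'M[C]_2) (m : 'M[R]_4) :
  (forall p, adjmx S *m herm p *m S = herm (p *m m)) -> Ad S = m.
Proof.
move=> H; apply/row_matrixP => j; rewrite !rowE; apply: herm_inj.
by rewrite -Ad_herm H.
Qed.

Lemma AdM (S T : 'M[C]_2) : Ad (S *m T) = Ad S *m Ad T.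
Proof.
by apply: Ad_unique => p; rewrite adjmxM !mulmxA -!Ad_herm !mulmxA.
Qed.

Lemma Ad1 : Ad (1%:M : 'M[C]_2) = 1%:M.
Proof. by apply: Ad_unique => p; rewrite adjmx1 mul1mx !mulmx1. Qed.

Lemma Ad_row (S : 'M[C]_2) j (p : 'rV[R]_4) :
  adjmx S *m pauli j *m S = herm p -> row j (Ad S) = p.
Proof. by move=> e; apply: herm_inj; rewrite rowE -Ad_herm herm_delta. Qed.

Lemma eta2 : eta *m eta = 1%:M :> 'M[R]_4.
Proof.
rewrite /eta mulmx_diag; apply/matrixP => i j; rewrite !mxE.
by rewrite -expr2 sqrr_sign.
Qed.

Lemma etaT : eta^T = eta :> 'M[R]_4.
Proof. by rewrite /eta tr_diag_mx. Qed.

Lemma Lorentz_tr (m : 'M[R]_4) : Lorentz m <-> m *m eta *m m^T = eta.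
Proof.
have key (n : 'M[R]_4) : n^T *m eta *m n = eta -> n *m eta *m n^T = eta.
  move=> e; have /mulmx1C : (eta *m n^T *m eta) *m n = 1%:M.
    by rewrite -2!mulmxA [n^T *m _]mulmxA e eta2.
  by rewrite !mulmxA => /(congr1 (mulmx^~ eta)); rewrite -(mulmxA _ eta eta) eta2 mulmx1 mul1mx.
split=> [/key//|e]; have := key m^T; rewrite trmxK => /(_ e).
by [].
Qed.

(** By polarization. *)
Lemma quadratic_form_inj n (A B : 'M[R]_n) : A^T = A -> B^T = B ->
  (forall p : 'rV[R]_n, (p *m A *m p^T) 0 0 = (p *m B *m p^T) 0 0) -> A = B.
Proof.
move=> symA symB H.
have ent (X : 'M[R]_n) i j : ((delta_mx 0 i : 'rV[R]_n) *m X *m (delta_mx 0 j : 'rV[R]_n)^T) 0 0 = X i j.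
  by rewrite -rowE trmx_delta -colE !mxE.
have bil (X : 'M[R]_n) (p q : 'rV[R]_n) : X^T = X ->
   ((p + q) *m X *m (p + q)^T) 0 0 = (p *m X *m p^T) 0 0 + (q *m X *m q^T) 0 0 + 2 * (p *m X *m q^T) 0 0.
  move=> sX; have e : (q *m X *m p^T) 0 0 = (p *m X *m q^T) 0 0.
    have -> : q *m X *m p^T = (p *m X *m q^T)^T by rewrite !trmx_mul trmxK sX mulmxA.
    by rewrite mxE.
  rewrite mulmxDl linearD /= mulmxDl !mulmxDr mxE [X in X + _]mxE [X in _ + X]mxE e; ring.
apply/matrixP => i j.
have := H (delta_mx 0 i + delta_mx 0 j); rewrite !bil// !H.
by rewrite !ent => /addrI /mulfI; apply; rewrite pnatr_eq0.
Qed.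

Lemma quadratic_eta (m : 'M[R]_4) :
  (forall p : 'rV[R]_4, (p *m m *m eta *m (p *m m)^T) 0 0 = (p *m eta *m p^T) 0 0) -> Lorentz m.
Proof.
move=> H; apply/Lorentz_tr; apply: quadratic_form_inj.
- by rewrite !trmx_mul trmxK etaT mulmxA.
- exact: etaT.
- by move=> p; rewrite -H trmx_mul !mulmxA.
Qed.

(** The congruence by a matrix of determinant [1] preserves the determinant, hence
    the Minkowski form. *)
Lemma Ad_Lorentz (S : 'M[C]_2) : SL2 S -> Lorentz (Ad S).
Proof.
move=> S1; apply: quadratic_eta => p.
have := congr1 (fun X => \det X) (Ad_herm S p).
rewrite !det_mulmx det_adjmx [\det S]S1 conjc1 mul1r mulr1 !det_herm.
by move=> [] /oppr_inj.
Qed.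

End Spinors.

(** * Ad maps into the identity component *)

Section LorentzComponent.
Context {R : realType}.
Local Notation C := R[i].

Lemma mulmx_continuous n (m : 'M[R]_n) : continuous (mulmx m : 'M[R]_n -> 'M[R]_n).
Proof.
move=> x; apply: mx_continuous => i j.
rewrite (_ : (fun z => _) = \sum_k (fun z : 'M[R]_n => m i k * z k j)).
  apply: (@big_ind _ (fun g : 'M[R]_n -> R => {for x, continuous g})).
  - exact: (@cst_continuous _ _ (0 : R)).
  - by move=> u v cu cv; exact: (cvgD cu cv).
  - by move=> k kT; exact: (cvgM (cvg_cst _) (@coord_continuous R n n k j x)).
by apply/funext => z; rewrite fct_sumE mxE.
Qed.

Lemma LorentzM (m n : 'M[R]_4) : Lorentz m -> Lorentz n -> Lorentz (m *m n).
Proof.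
rewrite /Lorentz /= => hm hn; rewrite trmx_mul.
have -> : n^T *m m^T *m eta *m (m *m n) = n^T *m (m^T *m eta *m m) *m n by rewrite !mulmxA.
by rewrite hm.
Qed.

Lemma SOplus_Lorentz (m : 'M[R]_4) : SOplus m -> Lorentz m.
Proof. by move=> [D [_ DL _] Dm]; exact: DL. Qed.

(** If [D] and [E] are connected sets of Lorentz matrices that contain the identity,
    with [m] in [D] and [n] in [E], then [D] and [m E] meet in [m]. *)
Lemma SOplusM (m n : 'M[R]_4) : SOplus m -> SOplus n -> SOplus (m *m n).
Proof.
move=> [D [D1 DL cD] Dm] [E [E1 EL cE] En].
exists (D `|` (mulmx m @` E)); last by right; exists n.
split; first by left.
- move=> x [/DL//|[y Ey <-]]; apply: LorentzM; [exact: DL|exact: EL].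
- apply: connectedU => //; first by exists m; split => //; exists 1%:M; rewrite ?mulmx1.
  by apply: connected_continuous_connected => //; apply: continuous_subspaceT; exact: mulmx_continuous.
Qed.

(** Along the affine line [1 + t N], [Ad] is a quadratic polynomial in [t]. *)
Lemma Ad_line_continuous (N : 'M[C]_2) :
  continuous (fun t : R => Ad (1%:M + t%:C%C *: N)).
Proof.
(* the coefficient of [t] *)
pose B : 'M[R]_4 := \matrix_(j < 4, k < 4)
  (complex.Re (\tr (pauli k *m (adjmx N *m pauli j + pauli j *m N))) / 2).
have e t : Ad (1%:M + t%:C%C *: N) = Ad 1%:M + t *: B + (t * t) *: Ad N.
  have adjt : adjmx (t%:C%C *: N) = t%:C%C *: adjmx N.
    apply/matrixP => i j; rewrite !mxE; case: (N j i) => a b; simpc.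
    by apply/eqP; rewrite eq_complex /=; apply/andP; split; apply/eqP; ring.
  have adjD (X Y : 'M[C]_2) : adjmx (X + Y) = adjmx X + adjmx Y.
    by apply/matrixP => i j; rewrite !mxE rmorphD.
  have ReZ (x : R) (z : C) : complex.Re (x%:C%C * z) = x * complex.Re z.
    by case: z => a b /=; rewrite mul0r subr0.
  have eqM (s : 'M[C]_2) : adjmx (1%:M + t%:C%C *: N) *m s *m (1%:M + t%:C%C *: N) =
     s + t%:C%C *: (adjmx N *m s + s *m N) + (t * t)%:C%C *: (adjmx N *m s *m N).
    rewrite adjD adjmx1 adjt mulmxDl mul1mx mulmxDr mulmx1 mulmxDl rmorphM scalerDr.
    by rewrite -!scalemxAl -!scalemxAr -?scalemxAl scalerA !addrA.
  have ReD (x y : C) : complex.Re (x + y) = complex.Re x + complex.Re y.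
    by case: x y => [? ?] [? ?].
  apply/matrixP => j k; rewrite [LHS]mxE eqM !mulmxDr -!scalemxAr !mxtraceD !mxtraceZ.
  rewrite 2!ReD 2!ReZ !mxE adjmx1 mul1mx mulmx1.
  rewrite mulmxDr mxtraceD ReD; ring.
rewrite (_ : (fun t => _) = fun t => Ad 1%:M + t *: B + (t * t) *: Ad N); last exact/funext.
move=> t; apply: mx_continuous => i j.
rewrite (_ : (fun z => _) = fun z : R => Ad 1%:M i j + z * B i j + (z * z) * Ad N i j); last first.
  by apply/funext => z; rewrite [in LHS]mxE [in LHS]mxE [X in _ + X + _]mxE [X in _ + X]mxE.
apply: cvgD; last by apply: cvgM; [apply: cvgM; exact: cvg_id|exact: cvg_cst].
by apply: cvgD; [exact: cvg_cst|apply: cvgM; [exact: cvg_id|exact: cvg_cst]].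
Qed.

Lemma SOplus_line (N : 'M[C]_2) : (forall t : R, SL2 (1%:M + t%:C%C *: N)) ->
  SOplus (Ad (1%:M + N)).
Proof.
move=> SN; exists ((fun t : R => Ad (1%:M + t%:C%C *: N)) @` setT); last first.
  by exists 1; [|rewrite /= -[(1:R)%:C%C]/(1:C) scale1r].
split.
- by exists 0 => //=; rewrite scale0r addr0 Ad1.
- by move=> _ [t _ <-]; exact: Ad_Lorentz.
- apply: connected_continuous_connected; last first.
    by apply: continuous_subspaceT; exact: Ad_line_continuous.
  by apply/connected_intervalP => x y _ _ z _.
Qed.

(** The matrices with a single off-diagonal entry besides the unit diagonal generate
    [SL(2, C)], and each lies on a real line in [SL(2, C)] through the identity. *)
Lemma SOplus_Ad (h : 'M[C]_2) : SL2 h -> SOplus (Ad h).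
Proof.
(* upper and lower unitriangular matrices *)
have up z : SOplus (Ad (mx2 1 z 0 1 : 'M[C]_2)).
  have -> : mx2 1 z 0 1 = 1%:M + mx2 0 z 0 0 :> 'M[C]_2.
    by rewrite -mx2_1; apply/matrixP; apply: ord2P; apply: ord2P; rewrite !mxE /= ?addr0 ?add0r.
  apply: SOplus_line => t; rewrite /SL2 /= (_ : _ + _ = mx2 1 (t%:C%C * z) 0 1).
    by rewrite det_mx2E !mulr0 mulr1 subr0.
  by rewrite -mx2_1; apply/matrixP; apply: ord2P; apply: ord2P; rewrite !mxE /= ?mulr0 ?addr0 ?add0r.
have lo z : SOplus (Ad (mx2 1 0 z 1 : 'M[C]_2)).
  have -> : mx2 1 0 z 1 = 1%:M + mx2 0 0 z 0 :> 'M[C]_2.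
    by rewrite -mx2_1; apply/matrixP; apply: ord2P; apply: ord2P; rewrite !mxE /= ?addr0 ?add0r.
  apply: SOplus_line => t; rewrite /SL2 /= (_ : _ + _ = mx2 1 0 (t%:C%C * z) 1).
    by rewrite det_mx2E mul0r mulr1 subr0.
  by rewrite -mx2_1; apply/matrixP; apply: ord2P; apply: ord2P; rewrite !mxE /= ?mulr0 ?addr0 ?add0r.
(* a matrix with nonzero lower left entry is upper * lower * upper *)
have gen (k : 'M[C]_2) : SL2 k -> k 1 0 != 0 -> SOplus (Ad k).
  rewrite (mx2_eta k); move: (k 0 0) (k 0 1) (k 1 0) (k 1 1) => a b c d.
  rewrite /SL2 /= det_mx2E !mxE /= => d1 c0.
  have -> : mx2 a b c d = mx2 1 ((a - 1) / c) 0 1 *m mx2 1 0 c 1 *m mx2 1 ((d - 1) / c) 0 1 :> 'M[C]_2.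
    rewrite !mx2M; have -> : b = (a * d - 1) / c by rewrite -d1; field.
    by congr mx2; field.
  by rewrite !AdM; apply: SOplusM => //; apply: SOplusM.
move=> h1; have [h10|] := eqVneq (h 1 0) 0; last exact: gen.
(* when that entry is zero, one more factor makes it nonzero *)
have -> : h = (h *m mx2 1 0 1 1) *m mx2 1 0 (-1) 1.
  rewrite -mulmxA mx2M (_ : mx2 _ _ _ _ = 1%:M) ?mulmx1// -mx2_1.
  by congr mx2; ring.
have h11 : h 1 1 != 0.
  apply/eqP => h11; move: h1; rewrite /SL2 /= (mx2_eta h) det_mx2E h10 h11 !mulr0 subrr.
  by move/eqP; rewrite eq_sym oner_eq0.
rewrite AdM; apply: SOplusM => //; apply: gen.
  by rewrite /SL2 /= det_mulmx [\det h]h1 det_mx2E; ring.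
by rewrite mxE sum2 !mxE /= h10 mul0r add0r mulr1.
Qed.

Lemma Lorentz_det (m : 'M[R]_4) : Lorentz m -> \det m != 0.
Proof.
move=> hm; apply/eqP => d0; have := congr1 (fun X => \det X) hm.
rewrite !det_mulmx d0 mulr0 => /esym /eqP; apply/negP.
have := congr1 (fun X => \det X) (@eta2 R); rewrite det_mulmx det1.
by move=> e; apply/eqP => e0; move: e; rewrite e0 mul0r => /eqP; rewrite eq_sym oner_eq0.
Qed.

Lemma Lorentz_time (m : 'M[R]_4) : Lorentz m ->
  m o3 o3 ^+ 2 = 1 + m o0 o3 ^+ 2 + m o1 o3 ^+ 2 + m o2 o3 ^+ 2.
Proof.
move=> /matrixP /(_ o3 o3); rewrite !mxE !sum4 !mxE !sum4 !mxE /=; lra.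
Qed.

Lemma connected_pos (T : topologicalType) (D : set T) (f : T -> R) (x y : T) :
  connected D -> D x -> D y -> continuous f -> (forall z, D z -> f z != 0) -> 0 < f x -> 0 < f y.
Proof.
move=> cD Dx Dy cf f0 fx; rewrite ltNge; apply/negP => fy.
have : connected (f @` D).
  by apply: connected_continuous_connected => //; exact: continuous_subspaceT.
move/connected_intervalP => /(_ (f y) (f x)) /=.
move=> /(_ (ex_intro2 _ _ y Dy erefl) (ex_intro2 _ _ x Dx erefl) 0).
rewrite fy (ltW fx) => /(_ erefl) [z Dz z0].
by have := f0 z Dz; rewrite z0 eqxx.
Qed.

Lemma det_continuous : continuous (fun m : 'M[R]_4 => \det m).
Proof.
move=> m; rewrite (_ : (fun m => _) = (fun v => \det (vec_mx v)) \o (mxvec : 'M[R]_4 -> 'rV[R]_(4 * 4))).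
  apply: continuous_comp.
    apply: rV_continuous => j; case/mxvec_indexP: j => i j.
    rewrite (_ : (fun z => _) = fun z : 'M[R]_4 => z i j); first exact: coord_continuous.
    by apply/funext => z; rewrite mxvecE.
  apply: (@smooth_continuous R _ setT _ _ _ I).
  apply: smooth_det; first exact: openT.
  by move=> i j; apply: (smooth_ext openT _ (smooth_coord _ (mxvec_index i j))) => z _; rewrite mxE.
by apply/funext => z /=; rewrite mxvecK.
Qed.

(** Neither the determinant nor the time entry of a Lorentz matrix can vanish, the
    time entry because its square is at least [1]; so on a connected set they keep
    the sign that they have at the identity. *)
Lemma SOplus_pos (m : 'M[R]_4) : SOplus m -> 0 < \det m /\ 0 < m o3 o3.
Proof.
move=> [D [D1 DL cD] Dm]; split.
  apply: (connected_pos cD D1 Dm (@det_continuous)); last by rewrite det1.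
  by move=> z /DL /Lorentz_det.
apply: (connected_pos cD D1 Dm (@coord_continuous R 4 4 o3 o3)); last by rewrite mxE.
move=> z /DL /Lorentz_time h; apply/eqP => z0; move: h; rewrite z0; nra.
Qed.

End LorentzComponent.

(** * Ad maps onto the identity component *)

Section AdSurjective.
Context {R : realType}.
Local Notation C := R[i].

Lemma SL2_inv (h : 'M[C]_2) : SL2 h -> SL2 (invmx h).
Proof. by move=> h1; rewrite /SL2 /= det_inv [\det h]h1 invr1. Qed.

Lemma SL2_unit (h : 'M[C]_2) : SL2 h -> h \in unitmx.
Proof. by move=> h1; rewrite unitmxE [\det h]h1 unitr1. Qed.

Lemma SL2M (h k : 'M[C]_2) : SL2 h -> SL2 k -> SL2 (h *m k).
Proof. by move=> h1 k1; rewrite /SL2 /= det_mulmx [\det h]h1 [\det k]k1 mulr1. Qed.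

Lemma SL2_1 : SL2 (1%:M : 'M[C]_2).
Proof. exact: det1. Qed.

Lemma AdV (h : 'M[C]_2) : SL2 h -> Ad h *m Ad (invmx h) = 1%:M.
Proof. by move=> h1; rewrite -AdM mulmxV ?SL2_unit// Ad1. Qed.

Lemma VAd (h : 'M[C]_2) : SL2 h -> Ad (invmx h) *m Ad h = 1%:M.
Proof. by move=> h1; rewrite -AdM mulVmx ?SL2_unit// Ad1. Qed.

Lemma row_AdV (m : 'M[R]_4) (h : 'M[C]_2) j : SL2 h ->
  row j (Ad h) = row j m -> row j (m *m Ad (invmx h)) = delta_mx 0 j.
Proof. by move=> h1 e; rewrite row_mul -e -row_mul AdV// row1. Qed.

Lemma AdV_eq (m : 'M[R]_4) (h n : 'M[C]_2) : SL2 h -> m *m Ad (invmx h) = Ad n -> m = Ad (n *m h).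
Proof. by move=> h1 e; rewrite AdM -e -mulmxA VAd// mulmx1. Qed.

Lemma Lorentz_rows (m : 'M[R]_4) i j : Lorentz m ->
  m i o0 * m j o0 + m i o1 * m j o1 + m i o2 * m j o2 - m i o3 * m j o3 = eta i j.
Proof. move=> /Lorentz_tr <-; rewrite !mxE !sum4 !mxE !sum4 !mxE /=; ring. Qed.

Definition proper (m : 'M[R]_4) := Lorentz m /\ 0 < \det m.

Lemma proper_Ad (m : 'M[R]_4) (h : 'M[C]_2) : SL2 h -> proper m -> proper (m *m Ad h).
Proof.
move=> h1 [Lm dm]; split; first exact: LorentzM Lm (Ad_Lorentz h1).
by rewrite det_mulmx mulr_gt0// (SOplus_pos (SOplus_Ad h1)).1.
Qed.

(** The rotation with half the angle: [c = cos theta], [a = cos (theta / 2)], and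
    [(u, v)] has length [sin (theta / 2)] in the direction of [(x, y)]. For
    [theta = pi] that direction is free, and the choice [v = 0] gives the last
    clause, which serves for rotations about a fixed axis. *)
Lemma half_angle (c x y : R) : c * c + x * x + y * y = 1 ->
  exists a u v, [/\ a * a + (u * u + v * v) = 1, a * a - (u * u + v * v) = c,
                    2 * (a * u) = x, 2 * (a * v) = y & y = 0 -> v = 0].
Proof.
move=> e; have [c1|c1] := eqVneq c (-1).
  exists 0, 1, 0; have xy : x * x + y * y = 0 by move: e; rewrite c1; lra.
  have x0 : x = 0 by nra.
  have y0 : y = 0 by nra.
  by rewrite c1 x0 y0; split => //; ring.
have cge : -1 < c.
  by rewrite lt_neqAle eq_sym c1 /=; nra.
pose w := (1 + c) / 2; have w0 : 0 < w by rewrite divr_gt0//; lra.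
pose a := Num.sqrt w; have a0 : 0 < a by rewrite sqrtr_gt0.
have aa : a * a = w by rewrite -expr2 sqr_sqrtr ?ltW.
have an : a != 0 by rewrite gt_eqF.
exists a, (x / (2 * a)), (y / (2 * a)).
have uv : x / (2 * a) * (x / (2 * a)) + y / (2 * a) * (y / (2 * a)) = (1 - c) / 2.
  have -> : x / (2 * a) * (x / (2 * a)) + y / (2 * a) * (y / (2 * a)) =
            (x * x + y * y) / (4 * (a * a)) by field.
  have -> : x * x + y * y = (1 - c) * (1 + c) by move: e; lra.
  by rewrite aa /w; field; lra.
rewrite uv aa /w; split; [lra|lra|by field|by field|by move=> ->; rewrite mul0r].
Qed.

(** The time row of a Lorentz matrix determines a positive definite Hermitian
    matrix of determinant one, and [h] is its Cholesky factor. *)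
Lemma Ad_time_row (m : 'M[R]_4) : Lorentz m -> 0 < m o3 o3 ->
  exists2 h : 'M[C]_2, SL2 h & row o3 (Ad h) = row o3 m.
Proof.
move=> Lm m0; have := Lorentz_rows o3 o3 Lm; rewrite !mxE /=.
set p0 := m o3 o0; set p1 := m o3 o1; set p2 := m o3 o2; set p3 := m o3 o3 => e.
have w0 : 0 < p3 + p2.
  have : 0 < p3 := m0; have : p2 * p2 < p3 * p3 by nra.
  by move=> *; nra.
pose a := Num.sqrt (p3 + p2); have a0 : 0 < a by rewrite sqrtr_gt0.
have aa : a * a = p3 + p2 by rewrite -expr2 sqr_sqrtr ?ltW.
pose b := a^-1; have ab : a * b = 1 by rewrite mulfV// gt_eqF.
have bb : b * b * (p3 + p2) = 1 by rewrite -aa -[RHS](mulr1 1) -ab; ring.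
exists (mx2 (a +i* 0) ((p0 * b) -i* (p1 * b)) 0 (b +i* 0)).
  rewrite /SL2 /= det_mx2E mulr0 subr0; simpc.
  by rewrite ab.
apply: Ad_row; rewrite adjmx_mx2 hermE /pauli /= !mx2M !mxE -/p0 -/p1 -/p2 -/p3.
have h1 : a * (p0 * b) = p0 by rewrite mulrCA ab mulr1.
have h2 : a * (p1 * b) = p1 by rewrite mulrCA ab mulr1.
have h3 : p0 * b * (p0 * b) + p1 * b * (p1 * b) + b * b = p3 - p2.
  rewrite -[RHS]mulr1 -bb.
  have -> : (p3 - p2) * (b * b * (p3 + p2)) = b * b * (p3 * p3 - p2 * p2) by ring.
  have -> : p3 * p3 - p2 * p2 = 1 + p0 * p0 + p1 * p1 by lra.
  ring.
congr mx2; apply/eqP; rewrite eq_complex /=; apply/andP; split; apply/eqP.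
- by rewrite -aa; ring.
- ring.
- by rewrite -[in RHS]h1; ring.
- by rewrite -[in RHS]h2; ring.
- by rewrite -[in RHS]h1; ring.
- by rewrite -[in RHS]h2; ring.
- by rewrite -h3; ring.
- ring.
Qed.

(** A spin matrix of a rotation that moves the third axis to the prescribed unit
    vector. *)
Lemma Ad_space_row (m : 'M[R]_4) : Lorentz m -> row o3 m = delta_mx 0 o3 ->
  exists h : 'M[C]_2, [/\ SL2 h, row o3 (Ad h) = row o3 m & row o2 (Ad h) = row o2 m].
Proof.
move=> Lm r3; have m3 k : m o3 k = (k == o3)%:R.
  by move: r3 => /rowP /(_ k); rewrite !mxE eqxx.
have m23 : m o2 o3 = 0 by have := Lorentz_rows o2 o3 Lm; rewrite !m3 !mxE /=; lra.
have e : m o2 o2 * m o2 o2 + m o2 o0 * m o2 o0 + m o2 o1 * m o2 o1 = 1.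
  by have := Lorentz_rows o2 o2 Lm; rewrite !m23 !mxE /=; lra.
have [a [u [v [h1 h2 h3 h4 _]]]] := half_angle e.
exists (mx2 (a +i* 0) (u -i* v) ((- u) -i* v) (a +i* 0)); split.
- rewrite /SL2 /= det_mx2E; simpc; apply/eqP; rewrite eq_complex /=.
  by apply/andP; split; apply/eqP; [rewrite -h1|]; ring.
- apply: Ad_row; rewrite r3 herm_delta adjmx_mx2 /pauli /= !mx2M.
  congr mx2; apply/eqP; rewrite eq_complex /=; apply/andP; split; apply/eqP;
    first [by ring | by rewrite -[in RHS]h1; ring].
- apply: Ad_row; rewrite adjmx_mx2 hermE /pauli /= !mx2M !mxE m23.
  congr mx2; apply/eqP; rewrite eq_complex /=; apply/andP; split; apply/eqP;
    rewrite -?h2 -?h3 -?h4; ring.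
Qed.

(** A spin matrix of a rotation about the third axis. *)
Lemma Ad_plane_row (m : 'M[R]_4) : Lorentz m ->
  row o3 m = delta_mx 0 o3 -> row o2 m = delta_mx 0 o2 ->
  exists h : 'M[C]_2, [/\ SL2 h, row o3 (Ad h) = row o3 m, row o2 (Ad h) = row o2 m &
    row o0 (Ad h) = row o0 m].
Proof.
move=> Lm r3 r2; have m3 k : m o3 k = (k == o3)%:R.
  by move: r3 => /rowP /(_ k); rewrite !mxE eqxx.
have m2 k : m o2 k = (k == o2)%:R.
  by move: r2 => /rowP /(_ k); rewrite !mxE eqxx.
have m03 : m o0 o3 = 0 by have := Lorentz_rows o0 o3 Lm; rewrite !m3 !mxE /=; lra.
have m02 : m o0 o2 = 0 by have := Lorentz_rows o0 o2 Lm; rewrite !m2 !mxE /=; lra.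
have e : m o0 o0 * m o0 o0 + m o0 o1 * m o0 o1 + 0 * 0 = 1.
  by have := Lorentz_rows o0 o0 Lm; rewrite !m03 !m02 !mxE /=; lra.
have [a [u [v [h1 h2 h3 _ /(_ erefl) v0]]]] := half_angle e.
rewrite v0 in h1 h2.
exists (mx2 (a +i* u) 0 0 (a -i* u)); split.
- rewrite /SL2 /= det_mx2E; simpc; apply/eqP; rewrite eq_complex /=.
  by apply/andP; split; apply/eqP; [rewrite -h1|]; ring.
- apply: Ad_row; rewrite r3 herm_delta adjmx_mx2 /pauli /= !mx2M.
  congr mx2; apply/eqP; rewrite eq_complex /=; apply/andP; split; apply/eqP;
    first [by ring | by rewrite -[in RHS]h1; ring].
- apply: Ad_row; rewrite r2 herm_delta adjmx_mx2 /pauli /= !mx2M.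
  congr mx2; apply/eqP; rewrite eq_complex /=; apply/andP; split; apply/eqP;
    first [by ring | by rewrite -[in RHS]h1; ring].
- apply: Ad_row; rewrite adjmx_mx2 hermE /pauli /= !mx2M !mxE m02 m03.
  congr mx2; apply/eqP; rewrite eq_complex /=; apply/andP; split; apply/eqP;
    rewrite -?h2 -?h3; ring.
Qed.

Lemma proper_eq1 (m : 'M[R]_4) : proper m ->
  row o3 m = delta_mx 0 o3 -> row o2 m = delta_mx 0 o2 -> row o0 m = delta_mx 0 o0 -> m = 1%:M.
Proof.
move=> [Lm dm] r3 r2 r0; have m3 k : m o3 k = (k == o3)%:R.
  by move: r3 => /rowP /(_ k); rewrite !mxE eqxx.
have m2 k : m o2 k = (k == o2)%:R.
  by move: r2 => /rowP /(_ k); rewrite !mxE eqxx.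
have m0 k : m o0 k = (k == o0)%:R.
  by move: r0 => /rowP /(_ k); rewrite !mxE eqxx.
have m13 : m o1 o3 = 0 by have := Lorentz_rows o1 o3 Lm; rewrite !m3 !mxE /=; lra.
have m12 : m o1 o2 = 0 by have := Lorentz_rows o1 o2 Lm; rewrite !m2 !mxE /=; lra.
have m10 : m o1 o0 = 0 by have := Lorentz_rows o1 o0 Lm; rewrite !m0 !mxE /=; lra.
have m11 : m o1 o1 * m o1 o1 = 1.
  by have := Lorentz_rows o1 o1 Lm; rewrite m13 m12 m10 !mxE /=; lra.
have mdiag : m = diag_mx (\row_k (if k == o1 then m o1 o1 else 1)).
  by apply/matrixP; apply: ord4P; apply: ord4P; rewrite !mxE ?m0 ?m2 ?m3 ?m10 ?m12 ?m13.
have m1 : m o1 o1 = 1.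
  move: dm; rewrite [X in \det X]mdiag det_diag (bigD1 o1)//= big1 ?mulr1; last first.
    by move=> k /negbTE k1; rewrite mxE k1.
  by rewrite mxE eqxx => dm; nra.
apply/matrixP; apply: ord4P; apply: ord4P; rewrite !mxE ?m0 ?m2 ?m3 ?m10 ?m12 ?m13 ?m1 //.
Qed.

(** The matrix is brought to the identity by factors [Ad h]: the first adjusts the
    time row, the next two are rotations that adjust two space rows. The remaining
    row is then determined by orthogonality and the sign of the determinant. *)
Lemma Ad_surj (m : 'M[R]_4) : proper m -> 0 < m o3 o3 -> exists2 h : 'M[C]_2, SL2 h & Ad h = m.
Proof.
move=> pm m0.
have [h h1 r3] := Ad_time_row pm.1 m0.
have pm1 := proper_Ad (SL2_inv h1) pm.
have r3' := row_AdV h1 r3.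
have [k [k1 s3 s2]] := Ad_space_row pm1.1 r3'.
have pm2 := proper_Ad (SL2_inv k1) pm1.
have s3' := row_AdV k1 s3; have s2' := row_AdV k1 s2.
have [l [l1 t3 t2 t0]] := Ad_plane_row pm2.1 s3' s2'.
have pm3 := proper_Ad (SL2_inv l1) pm2.
have := proper_eq1 pm3 (row_AdV l1 t3) (row_AdV l1 t2) (row_AdV l1 t0).
rewrite -Ad1 => /(AdV_eq l1)/(AdV_eq k1)/(AdV_eq h1) ->.
by eexists; last reflexivity; do 3! apply: SL2M => //; exact: SL2_1.
Qed.

(** One direction is [SOplus_pos]. Conversely a matrix with these signs is in the
    image of [Ad], which lies in the identity component. *)
Lemma SOplusP (m : 'M[R]_4) : SOplus m <-> [/\ Lorentz m, 0 < \det m & 0 < m o3 o3].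
Proof.
split=> [Sm|[Lm dm m0]].
  by have [dm m0] := SOplus_pos Sm; split => //; exact: SOplus_Lorentz.
by have [h h1 <-] := Ad_surj (conj Lm dm) m0; exact: SOplus_Ad.
Qed.

End AdSurjective.

(** * Charts, transition maps and Jacobians *)

Section Charts.
Context {R : realType} {M : topologicalType} (A : set (chart R M)).
Hypothesis hA : maximal_atlas A.
Implicit Types (c d e : chart R M) (x : M) (U : set M).

Lemma chart_at x : exists2 c, A c & cdom c x.
Proof. by have [_ + _ _] := hA; apply. Qed.

Lemma cdom_open c : A c -> open (cdom c).
Proof. by have [h _ _ _] := hA => /h[]. Qed.

Lemma cimg_open c : A c -> open (cimg c).
Proof. by have [h _ _ _] := hA => /h[]. Qed.

Lemma cmapK c x : A c -> cdom c x -> cinv c (cmap c x) = x.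
Proof. by have [h _ _ _] := hA => /h[_ _ _ _]; apply. Qed.

Lemma cimg_cmap c x : cdom c x -> cimg c (cmap c x).
Proof. by move=> cx; exists x. Qed.

Lemma cinv_dom c y : A c -> cimg c y -> cdom c (cinv c y).
Proof. by move=> Ac [x cx <-]; rewrite cmapK. Qed.

Lemma cinvK c y : A c -> cimg c y -> cmap c (cinv c y) = y.
Proof. by move=> Ac [x cx <-]; rewrite cmapK. Qed.

Lemma cmap_continuous c x : A c -> cdom c x -> {for x, continuous (cmap c)}.
Proof.
move=> Ac cx; have [h _ _ _] := hA; have [+ _ + _ _] := h _ Ac.
by move=> /(continuous_open_subspace (cmap c)) ->; apply; rewrite inE.
Qed.

Lemma cinv_continuous c y : A c -> cimg c y -> {for y, continuous (cinv c)}.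
Proof.
move=> Ac cy; have [h _ _ _] := hA; have [_ + _ + _] := h _ Ac.
by move=> /(continuous_open_subspace (cinv c)) ->; apply; rewrite inE.
Qed.

Definition cset c U := cmap c @` (U `&` cdom c).

Lemma csetP c U y : A c -> cset c U y <-> cimg c y /\ U (cinv c y).
Proof.
move=> Ac; split=> [[x [Ux cx] <-]|[cy Uy]]; first by rewrite cmapK//; split => //; exact: cimg_cmap.
by exists (cinv c y); rewrite ?cinvK//; split => //; exact: cinv_dom.
Qed.

Lemma cset_cimg c U : cset c U `<=` cimg c.
Proof. by move=> _ [x [_ cx] <-]; exact: cimg_cmap. Qed.

Lemma cset_dom c : cset c (cdom c) = cimg c.
Proof. by rewrite /cset setIid. Qed.

Lemma cset_setT c : cset c setT = cimg c.
Proof. by rewrite /cset setTI. Qed.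

Lemma cset_open c U : A c -> open U -> open (cset c U).
Proof.
move=> Ac oU; rewrite openE => y /csetP -/(_ Ac)[cy Uy].
have n1 := open_near (cimg_open Ac) cy.
have n2 : \forall z \near y, U (cinv c z) by exact: (cinv_continuous Ac cy (open_near oU Uy)).
by apply: filterS2 n1 n2 => z cz Uz; apply/csetP.
Qed.

Lemma cset_sub c U V : U `<=` V -> cset c U `<=` cset c V.
Proof. by move=> UV _ [x [/UV Ux cx] <-]; exists x. Qed.

Lemma cset_point c U x : U x -> cdom c x -> cset c U (cmap c x).
Proof. by move=> Ux cx; exists x. Qed.

Lemma transE c d x : A c -> cdom c x -> trans c d (cmap c x) = cmap d x.
Proof. by move=> Ac cx; rewrite /trans cmapK. Qed.

Lemma trans_cset c d U y : A c -> A d -> cset c (U `&` cdom d) y -> cset d (U `&` cdom c) (trans c d y).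
Proof. by move=> Ac Ad [x [[Ux dx] cx] <-]; rewrite transE//; exact: cset_point. Qed.

Lemma trans_smooth c d b : A c -> A d -> smooth_on (cset c (cdom d)) (fun y => trans c d y 0 b).
Proof.
move=> Ac Ad; have [_ _ h _] := hA.
by have [] := h _ _ Ac Ad b; rewrite /cset setIC.
Qed.

Lemma smooth_transfer c d U (f : 'rV[R]_4 -> R) : A c -> A d -> open U ->
  smooth_on (cset c U) f -> smooth_on (cset d (U `&` cdom c)) (fun y => f (trans d c y)).
Proof.
move=> Ac Ad oU sf; apply: smooth_comp sf _.
- by apply: cset_open => //; apply: openI => //; exact: cdom_open.
- exact: cset_open.
- by move=> y /(trans_cset Ad Ac); apply: cset_sub; exact: subIsetl.
- move=> b; apply: smooth_sub (trans_smooth b Ad Ac).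
  by apply: cset_sub; exact: subIsetr.
Qed.

(** Smoothness can be checked near each point in one chart of choice. *)
Lemma smooth_fun_at (u : M -> R) :
  (forall x, exists c U, [/\ A c, open U, U x, U `<=` cdom c & smooth_on (cset c U) (fun y => u (cinv c y))]) ->
  smooth_fun A u.
Proof.
move=> H d Ad; apply: smooth_local => y dy.
have [c [U [Ac oU Uy Uc su]]] := H (cinv d y).
exists (cset d (U `&` cdom c)).
  by apply/csetP => //; split => //; split => //; exact: Uc.
apply: smooth_ext (smooth_transfer Ac Ad oU su).
  by apply: cset_open => //; apply: openI => //; exact: cdom_open.
move=> _ [x [[Ux cx] dx] <-]; by rewrite transE// !cmapK.
Qed.

Lemma Jac_smooth c d a b : A c -> A d -> smooth_on (cset c (cdom d)) (fun y => Jac c d y a b).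
Proof.
move=> Ac Ad; apply: smooth_ext (smooth_partial a (trans_smooth b Ac Ad)) => [|y _].
  by apply: cset_open => //; exact: cdom_open.
by rewrite mxE.
Qed.

Lemma Jac_chain c d e x : A c -> A d -> A e -> cdom c x -> cdom d x -> cdom e x ->
  Jac c e (cmap c x) = Jac c d (cmap c x) *m Jac d e (cmap d x).
Proof.
move=> Ac Ad Ae cx dx ex; apply/matrixP => a b; rewrite !mxE.
have oV : open (cset c (cdom d `&` cdom e)).
  by apply: cset_open => //; apply: openI; exact: cdom_open.
rewrite (@partial_ext _ _ _ _ (fun z => trans d e (trans c d z) 0 b) _ _ oV).
- rewrite (@partial_chain _ _ _ (fun w => trans d e w 0 b) (trans c d)).
  + by apply: eq_bigr => k _; rewrite transE// !mxE.
  + apply: (smooth_differentiable _ (trans_smooth b Ad Ae)); last by rewrite transE//; exact: cset_point.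
    by apply: cset_open => //; exact: cdom_open.
  + by move=> k; apply: smooth_derivable (trans_smooth k Ac Ad) _; exact: cset_point.
- by apply: cset_point.
- by move=> _ [z [[dz ez] cz] <-]; rewrite !transE.
Qed.

Lemma Jac_id c y : A c -> cimg c y -> Jac c c y = 1%:M.
Proof.
move=> Ac cy; apply/matrixP => a b; rewrite !mxE.
rewrite (@partial_ext _ _ (cimg c) _ (fun z => z 0 b) _ _ (cimg_open Ac) cy).
  have -> : partial a (fun z : 'rV[R]_4 => z 0 b) y = (delta_mx 0 a : 'rV[R]_4) 0 b.
    by rewrite /partial partial_coord.
  by rewrite mxE eqxx eq_sym.
by move=> z cz; rewrite /trans cinvK.
Qed.

Lemma JacK c d x : A c -> A d -> cdom c x -> cdom d x ->
  Jac c d (cmap c x) *m Jac d c (cmap d x) = 1%:M.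
Proof.
by move=> Ac Ad cx dx; rewrite -Jac_chain// Jac_id//; exact: cimg_cmap.
Qed.

Lemma det_Jac_neq0 c d x : A c -> A d -> cdom c x -> cdom d x ->
  \det (Jac c d (cmap c x)) != 0.
Proof.
move=> Ac Ad cx dx; have /mulmx1_unit[+ _] := JacK Ac Ad cx dx.
by rewrite unitmxE unitfE.
Qed.

Lemma det_Jac_smooth c d : A c -> A d -> smooth_on (cset c (cdom d)) (fun y => \det (Jac c d y)).
Proof.
move=> Ac Ad; apply: smooth_det; first by apply: cset_open => //; exact: cdom_open.
by move=> i j; exact: Jac_smooth.
Qed.

(** The factor by which half-densities transform from the coordinates [d] to [c]. *)
Definition wt c d y : R := Num.sqrt `|\det (Jac c d y)|.

Lemma wt_smooth c d : A c -> A d -> smooth_on (cset c (cdom d)) (wt c d).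
Proof.
move=> Ac Ad; apply: smooth_sqrt_norm; last exact: det_Jac_smooth.
  by apply: cset_open => //; exact: cdom_open.
by move=> _ [x [dx cx] <-]; exact: det_Jac_neq0.
Qed.

Lemma wt_chain c d e x : A c -> A d -> A e -> cdom c x -> cdom d x -> cdom e x ->
  wt c e (cmap c x) = wt c d (cmap c x) * wt d e (cmap d x).
Proof.
by move=> Ac Ad Ae cx dx ex; rewrite /wt (Jac_chain Ac Ad Ae)// det_mulmx normrM sqrtrM.
Qed.

Lemma wt_id c y : A c -> cimg c y -> wt c c y = 1.
Proof. by move=> Ac cy; rewrite /wt Jac_id// det1 normr1 sqrtr1. Qed.

Lemma wtK c d x : A c -> A d -> cdom c x -> cdom d x ->
  wt c d (cmap c x) * wt d c (cmap d x) = 1.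
Proof.
by move=> Ac Ad cx dx; rewrite -wt_chain// wt_id//; exact: cimg_cmap.
Qed.

End Charts.

(** * Complex-valued functions *)

Section ComplexCalculus.
Context {R : realType}.
Local Notation C := R[i].

Lemma ReD (x y : C) : complex.Re (x + y) = complex.Re x + complex.Re y.
Proof. by case: x y => [? ?] [? ?]. Qed.

Lemma ImD (x y : C) : complex.Im (x + y) = complex.Im x + complex.Im y.
Proof. by case: x y => [? ?] [? ?]. Qed.

Lemma ReM (x y : C) :
  complex.Re (x * y) = complex.Re x * complex.Re y - complex.Im x * complex.Im y.
Proof. by case: x y => [? ?] [? ?]. Qed.

Lemma ImM (x y : C) :
  complex.Im (x * y) = complex.Re x * complex.Im y + complex.Im x * complex.Re y.
Proof. by case: x y => [? ?] [? ?]. Qed.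

Lemma complex_ext (x y : C) :
  complex.Re x = complex.Re y -> complex.Im x = complex.Im y -> x = y.
Proof. by case: x y => [? ?] [? ?] /= -> ->. Qed.

Lemma Re_sum (I : Type) (r : seq I) (F : I -> C) :
  complex.Re (\sum_(i <- r) F i) = \sum_(i <- r) complex.Re (F i).
Proof. by elim: r => [|i r IH]; rewrite ?big_nil// !big_cons ReD IH. Qed.

Lemma Im_sum (I : Type) (r : seq I) (F : I -> C) :
  complex.Im (\sum_(i <- r) F i) = \sum_(i <- r) complex.Im (F i).
Proof. by elim: r => [|i r IH]; rewrite ?big_nil// !big_cons ImD IH. Qed.

Section Smooth.
Context {n : nat} (U : set 'rV[R]_n).
Hypothesis oU : open U.
Implicit Types (f g : 'rV[R]_n -> C) (u : 'rV[R]_n -> R).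

Lemma csmooth_ext f g : (forall z, U z -> f z = g z) -> csmooth_on U f -> csmooth_on U g.
Proof.
by move=> fg [sr si]; split; [apply: smooth_ext sr|apply: smooth_ext si] => // z /fg ->.
Qed.

Lemma csmooth_cst (k : C) : csmooth_on U (fun=> k).
Proof. by split; exact: smooth_cst. Qed.

Lemma csmooth_real u : smooth_on U u -> csmooth_on U (fun y => (u y)%:C%C).
Proof. by move=> su; split => //=; exact: smooth_cst. Qed.

Lemma csmoothD f g : csmooth_on U f -> csmooth_on U g -> csmooth_on U (fun y => f y + g y).
Proof.
move=> [fr fi] [gr gi]; split.
  by apply: smooth_ext (smoothD oU fr gr) => // y _; rewrite ReD.
by apply: smooth_ext (smoothD oU fi gi) => // y _; rewrite ImD.
Qed.

Lemma csmoothM f g : csmooth_on U f -> csmooth_on U g -> csmooth_on U (fun y => f y * g y).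
Proof.
move=> [fr fi] [gr gi]; split.
  by apply: smooth_ext (smoothB oU (smoothM oU fr gr) (smoothM oU fi gi)) => // y _; rewrite ReM.
by apply: smooth_ext (smoothD oU (smoothM oU fr gi) (smoothM oU fi gr)) => // y _; rewrite ImM.
Qed.

Lemma csmoothN f : csmooth_on U f -> csmooth_on U (fun y => - f y).
Proof.
move=> sf; apply: csmooth_ext (csmoothM (csmooth_cst (-1)) sf) => y _.
by rewrite mulN1r.
Qed.

Lemma csmooth_conj f : csmooth_on U f -> csmooth_on U (fun y => (f y)^*%C).
Proof.
move=> [fr fi]; split.
  by apply: smooth_ext fr => // y _; case: (f y).
by apply: smooth_ext (smoothN oU fi) => // y _; case: (f y).
Qed.

Lemma csmooth_sum (I : Type) (r : seq I) (F : I -> 'rV[R]_n -> C) :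
  (forall i, csmooth_on U (F i)) -> csmooth_on U (fun y => \sum_(i <- r) F i y).
Proof.
move=> sF; elim: r => [|i r IH].
  by apply: csmooth_ext (csmooth_cst 0) => y _; rewrite big_nil.
by apply: csmooth_ext (csmoothD (sF i) IH) => y _; rewrite big_cons.
Qed.

Lemma csmooth_mulmx m k l (X : 'rV[R]_n -> 'M[C]_(m, k)) (Y : 'rV[R]_n -> 'M[C]_(k, l)) i j :
  (forall i j, csmooth_on U (fun y => X y i j)) -> (forall i j, csmooth_on U (fun y => Y y i j)) ->
  csmooth_on U (fun y => (X y *m Y y) i j).
Proof.
move=> sX sY; apply: (@csmooth_ext (fun y => \sum_k X y i k * Y y k j)).
  by move=> y _; rewrite mxE.
by apply: csmooth_sum => p; exact: csmoothM.
Qed.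

Lemma csmooth_adjmx m k (X : 'rV[R]_n -> 'M[C]_(m, k)) i j :
  (forall i j, csmooth_on U (fun y => X y i j)) -> csmooth_on U (fun y => adjmx (X y) i j).
Proof.
by move=> sX; apply: csmooth_ext (csmooth_conj (sX j i)) => y _; rewrite !mxE.
Qed.

Lemma cpartial_ext a f g y : U y -> (forall z, U z -> f z = g z) -> cpartial a f y = cpartial a g y.
Proof.
by move=> Uy fg; congr (_ +i* _); apply: partial_ext oU Uy _ => z /fg ->.
Qed.

Lemma cpartial_cst a (k : C) y : cpartial a (fun=> k : C) (y : 'rV[R]_n) = 0.
Proof. by rewrite /cpartial /partial !derive_cst. Qed.

Lemma cpartialD a f g y : csmooth_on U f -> csmooth_on U g -> U y ->
  cpartial a (fun z => f z + g z) y = cpartial a f y + cpartial a g y.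
Proof.
move=> [fr fi] [gr gi] Uy; rewrite /cpartial.
rewrite (_ : (fun z => complex.Re (f z + g z)) = fun z => complex.Re (f z) + complex.Re (g z)).
  rewrite (_ : (fun z => complex.Im (f z + g z)) = fun z => complex.Im (f z) + complex.Im (g z)).
    by rewrite (partialD (@smooth_derivable _ _ _ _ _ a fr Uy) (@smooth_derivable _ _ _ _ _ a gr Uy))
               (partialD (@smooth_derivable _ _ _ _ _ a fi Uy) (@smooth_derivable _ _ _ _ _ a gi Uy)).
  by apply/funext => z; rewrite ImD.
by apply/funext => z; rewrite ReD.
Qed.

Lemma cpartialM a f g y : csmooth_on U f -> csmooth_on U g -> U y ->
  cpartial a (fun z => f z * g z) y = cpartial a f y * g y + f y * cpartial a g y.
Proof.
move=> [fr fi] [gr gi] Uy; rewrite /cpartial.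
have dfr := @smooth_derivable _ _ _ _ _ a fr Uy; have dfi := @smooth_derivable _ _ _ _ _ a fi Uy.
have dgr := @smooth_derivable _ _ _ _ _ a gr Uy; have dgi := @smooth_derivable _ _ _ _ _ a gi Uy.
have d u w : derivable u y (delta_mx 0 a) -> derivable w y (delta_mx 0 a) ->
    derivable (fun z => u z * w z) y (delta_mx 0 a) by exact: derivableM.
rewrite (_ : (fun z => complex.Re (f z * g z)) =
  fun z => complex.Re (f z) * complex.Re (g z) + (-1) * (complex.Im (f z) * complex.Im (g z))); last first.
  by apply/funext => z; rewrite ReM mulN1r.
rewrite (_ : (fun z => complex.Im (f z * g z)) =
  fun z => complex.Re (f z) * complex.Im (g z) + complex.Im (f z) * complex.Re (g z)); last first.
  by apply/funext => z; rewrite ImM.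
have dc : derivable (fun=> -1 : R) y (delta_mx 0 a) by exact: derivable_cst.
rewrite (partialD (d _ _ dfr dgr) (d _ _ dc (d _ _ dfi dgi))) (partialM dc (d _ _ dfi dgi)).
rewrite (partialD (d _ _ dfr dgi) (d _ _ dfi dgr)).
rewrite (partialM dfr dgr) (partialM dfi dgi) (partialM dfr dgi) (partialM dfi dgr).
have -> : partial a (fun=> -1 : R) y = 0 by rewrite /partial derive_cst.
by apply: complex_ext; rewrite /= ?ReD ?ImD ?ReM ?ImM /=; ring.
Qed.

Lemma cpartial_conj a f y : csmooth_on U f -> U y ->
  cpartial a (fun z => (f z)^*%C) y = (cpartial a f y)^*%C.
Proof.
move=> [fr fi] Uy; rewrite /cpartial /= -/(partial _ _ _).
rewrite (_ : (fun z => complex.Re (f z)^*%C) = fun z => complex.Re (f z)); last first.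
  by apply/funext => z; case: (f z).
rewrite (_ : (fun z => complex.Im (f z)^*%C) = fun z => (-1) * complex.Im (f z)); last first.
  by apply/funext => z; rewrite mulN1r; case: (f z).
rewrite partialM; [|exact: derivable_cst|exact: smooth_derivable fi Uy].
have -> : partial a (fun=> -1 : R) y = 0 by rewrite /partial derive_cst.
by rewrite mul0r add0r mulN1r.
Qed.

Lemma cpartial_sum (I : Type) (r : seq I) a (F : I -> 'rV[R]_n -> C) y :
  (forall i, csmooth_on U (F i)) -> U y ->
  cpartial a (fun z => \sum_(i <- r) F i z) y = \sum_(i <- r) cpartial a (F i) y.
Proof.
move=> sF Uy; elim: r => [|i r IH].
  rewrite big_nil (_ : (fun z => _) = fun=> 0); first exact: cpartial_cst.
  by apply/funext => z; rewrite big_nil.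
rewrite big_cons -IH -cpartialD//; last exact: csmooth_sum.
by congr (cpartial a _ y); apply/funext => z; rewrite big_cons.
Qed.

Lemma cpartial_real a u y : cpartial a (fun z => (u z)%:C%C) y = (partial a u y)%:C%C.
Proof. by rewrite /cpartial /= /partial derive_cst. Qed.

Lemma cpartialZ a (k : C) f y : csmooth_on U f -> U y ->
  cpartial a (fun z => k * f z) y = k * cpartial a f y.
Proof.
by move=> sf Uy; rewrite cpartialM// ?cpartial_cst ?mul0r ?add0r//; exact: csmooth_cst.
Qed.

End Smooth.

Lemma smooth_Ad n (U : set 'rV[R]_n) (S : 'rV[R]_n -> 'M[C]_2) j k : open U ->
  (forall i l, csmooth_on U (fun y => S y i l)) -> smooth_on U (fun y => Ad (S y) j k).
Proof.
move=> oU sS; apply: (@smooth_ext _ _ _ (fun y =>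
   complex.Re (\sum_i (pauli k *m (adjmx (S y) *m pauli j *m S y)) i i) * 2^-1)) => //.
  by move=> y _; rewrite [RHS]mxE.
apply: smoothM => //; last exact: smooth_cst.
suff : csmooth_on U (fun y => \sum_i (pauli k *m (adjmx (S y) *m pauli j *m S y)) i i) by case.
apply: csmooth_sum => // i; apply: csmooth_mulmx => // [p r|p r]; first exact: csmooth_cst.
apply: csmooth_mulmx => // p' r'; apply: csmooth_mulmx => // [p'' r''|p'' r'']; last exact: csmooth_cst.
exact: csmooth_adjmx.
Qed.

End ComplexCalculus.

(** * The tetrad of an operator *)

Section Tetrads.
Context {R : realType} {M : topologicalType} (A : set (chart R M)).
Hypothesis hA : maximal_atlas A.
Local Notation C := R[i].
Implicit Types (c d : chart R M) (x : M) (L : operator R M).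
Implicit Types (e : 'I_4 -> coord_field R M 'rV[R]_4).

(** The frame [E] is orthonormal for the metric [G] if and only if the dual metric
    is the sum of the squares of its vectors, with signs. *)
Lemma frame_inverse (E G : 'M[R]_4) : G \in unitmx ->
  E *m G *m E^T = eta <-> E^T *m eta *m E = invmx G.
Proof.
move=> uG; split=> e.
  have : (E *m G) *m (E^T *m eta) = 1%:M by rewrite mulmxA e eta2.
  move=> /mulmx1C; rewrite !mulmxA => h.
  by rewrite -[LHS](mulmxK uG) h mul1mx.
have : E^T *m (eta *m E *m G) = 1%:M by rewrite !mulmxA e mulVmx.
move=> /mulmx1C; rewrite -!mulmxA => h.
by rewrite -[LHS]mul1mx -(@eta2 R) -!mulmxA h mulmx1.
Qed.

Lemma metric_unit g c y : lorentz_metric A g -> A c -> cimg c y -> g c y \in unitmx.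
Proof.
move=> [_ _ _ h] Ac cy; have [P _ e] := h c y Ac cy.
have : \det (P *m g c y *m P^T) != 0.
  rewrite e; apply/eqP => d0; have := congr1 (fun X => \det X) (@eta2 R).
  by rewrite det_mulmx d0 mul0r det1 => /eqP; rewrite eq_sym oner_eq0.
rewrite !det_mulmx unitmxE unitfE => h1; apply: contraNneq h1 => ->.
by rewrite mulr0 mul0r.
Qed.

Lemma Lprin_herm L e c y p : is_tetrad A L e -> A c -> cimg c y ->
  Lprin L c y p = herm (p *m (frame_mx e c y)^T).
Proof.
move=> te Ac cy; rewrite te// /herm; apply: eq_bigr => j _; congr (_%:C%C *: _).
by rewrite !mxE; apply: eq_bigr => k _; rewrite !mxE.
Qed.

Lemma Lprin_delta L c y a : Lprin L c y (delta_mx 0 a) = 'i *: opF L a c y.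
Proof.
rewrite /Lprin (bigD1 a)//= mxE !eqxx scale1r big1 ?addr0// => k ka.
by rewrite mxE (negbTE ka) scale0r.
Qed.

Lemma opF_herm L e c y a : is_tetrad A L e -> A c -> cimg c y ->
  'i *: opF L a c y = herm (\row_j e j c y 0 a).
Proof.
move=> te Ac cy; rewrite -Lprin_delta (Lprin_herm _ te)//; congr herm.
by rewrite -rowE; apply/rowP => j; rewrite !mxE.
Qed.

(** This is the half-density [(c_b - y0_b) w], in the coordinates [c]. It vanishes
    at the point [y0], so an operator applied to it gives [F^b w] there. Since the
    result is again a half-density, this determines how [F^b] transforms. *)
Definition probe c (y0 : 'rV[R]_4) (b : 'I_4) (w : 'cV[C]_2) : coord_field R M 'cV[C]_2 :=
  fun d z => (wt d c z * (trans d c z 0 b - y0 0 b))%:C%C *: w.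

Lemma probe_half_density c y0 b w : A c -> half_density A (cdom c) (probe c y0 b w).
Proof.
move=> Ac; split=> [d i Ad|d d' x Ad Ad' cx dx d'x].
  have oU : open (cset d (cdom c)) by apply: (cset_open hA) => //; exact: (cdom_open hA).
  apply: (@csmooth_ext _ _ _ oU (fun z => (wt d c z * (trans d c z 0 b - y0 0 b))%:C%C * w i 0)).
    by move=> z _; rewrite mxE.
  apply: csmoothM => //; last exact: csmooth_cst.
  apply: csmooth_real; apply: smoothM => //; first exact: (wt_smooth hA).
  by apply: smoothB => //; [exact: (trans_smooth hA)|exact: smooth_cst].
rewrite /probe -/(wt d d' (cmap d x)) scalerA -rmorphM mulrA -(wt_chain hA)//.
by rewrite !(transE hA).
Qed.

Lemma probe_op L c b w d x : A c -> A d -> cdom c x -> cdom d x ->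
  op_apply L (probe c (cmap c x) b w) d (cmap d x) =
  (wt d c (cmap d x))%:C%C *:
    ((\sum_(a < 4) (Jac d c (cmap d x) a b)%:C%C *: opF L a d (cmap d x)) *m w).
Proof.
move=> Ac Ad cx dx; set z0 := cmap d x; set y0 := cmap c x.
have oU : open (cset d (cdom c)) by apply: (cset_open hA) => //; exact: (cdom_open hA).
have Uz : cset d (cdom c) z0 by exact: cset_point.
have van : trans d c z0 0 b - y0 0 b = 0 by rewrite (transE hA)// subrr.
have sw := wt_smooth hA Ad Ac; have st := trans_smooth hA b Ad Ac.
have sB : smooth_on (cset d (cdom c)) (fun z => trans d c z 0 b - y0 0 b).
  by apply: smoothB => //; exact: smooth_cst.
have dprobe a : \col_i cpartial a (fun z => probe c y0 b w d z i 0) z0 =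
   (wt d c z0 * Jac d c z0 a b)%:C%C *: w.
  apply/colP => i; rewrite !mxE.
  rewrite (_ : (fun z => _) = fun z => w i 0 * (wt d c z * (trans d c z 0 b - y0 0 b))%:C%C); last first.
    by apply/funext => z; rewrite mxE mulrC.
  rewrite (@cpartialZ _ _ (cset d (cdom c))) ?cpartial_real//; last by apply: csmooth_real; exact: smoothM.
  rewrite mulrC; congr (_%:C%C * _).
  rewrite partialM; [|exact: smooth_derivable sw Uz|exact: smooth_derivable sB Uz].
  rewrite van mulr0 add0r; congr (_ * _).
  rewrite -[LHS]/(partial a (fun z => trans d c z 0 b + (- y0 0 b)) z0) partialD.
  - by rewrite /partial derive_cst addr0.
  - exact: smooth_derivable st Uz.
  - exact: derivable_cst.
rewrite /op_apply; under eq_bigr => a _ do rewrite dprobe.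
rewrite /probe van mulr0 scale0r mulmx0 addr0 mulmx_suml scaler_sumr.
by apply: eq_bigr => a _; rewrite -scalemxAr -scalemxAl scalerA rmorphM.
Qed.

Lemma opF_transform L c d x b : is_diffop A L -> A c -> A d -> cdom c x -> cdom d x ->
  opF L b c (cmap c x) = \sum_(a < 4) (Jac d c (cmap d x) a b)%:C%C *: opF L a d (cmap d x).
Proof.
move=> [_ _ hd] Ac Ad cx dx.
have key (w : 'cV[C]_2) : opF L b c (cmap c x) *m w =
    (\sum_(a < 4) (Jac d c (cmap d x) a b)%:C%C *: opF L a d (cmap d x)) *m w.
  have [_ tr] := hd _ _ (cdom_open hA Ac) (probe_half_density (cmap c x) b w Ac).
  have := tr c d x Ac Ad cx cx dx; rewrite !probe_op// -/(wt c d (cmap c x)).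
  rewrite scalerA -rmorphM (wtK hA)// scale1r (wt_id hA)//; last exact: cimg_cmap.
  rewrite scale1r => <-; congr (_ *m w).
  rewrite (bigD1 b)//= (Jac_id hA)//; last exact: cimg_cmap.
  rewrite mxE eqxx scale1r big1 ?addr0// => k kb.
  by rewrite mxE (negbTE kb) scale0r.
apply/matrixP => i j; have /colP /(_ i) := key (delta_mx j 0).
by rewrite -!colE !mxE.
Qed.

Lemma tetrad_vector L e k c d x : is_diffop A L -> is_tetrad A L e -> A c -> A d ->
  cdom c x -> cdom d x -> e k d (cmap d x) = e k c (cmap c x) *m Jac c d (cmap c x).
Proof.
move=> dL te Ac Ad cx dx; apply/rowP => b.
have := congr1 (fun X => 'i *: X) (opF_transform b dL Ad Ac dx cx).
rewrite (opF_herm _ te) ?scaler_sumr//; last exact: cimg_cmap.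
under eq_bigr => a _.
  rewrite scalerA mulrC -scalerA (opF_herm _ te)//; last exact: cimg_cmap.
  over.
have -> : \sum_(a < 4) (Jac c d (cmap c x) a b)%:C%C *: herm (\row_j e j c (cmap c x) 0 a) =
  herm (\row_j (e j c (cmap c x) *m Jac c d (cmap c x)) 0 b).
  under eq_bigr => a _ do rewrite /herm scaler_sumr.
  rewrite exchange_big /= /herm; apply: eq_bigr => j _.
  rewrite !mxE rmorph_sum scaler_suml; apply: eq_bigr => a _.
  by rewrite mxE scalerA mulrC rmorphM.
by move=> /herm_inj /rowP /(_ k); rewrite !mxE.
Qed.

Lemma herm_coords (p : 'rV[R]_4) :
  [/\ p 0 o0 = complex.Re (herm p 1 0), p 0 o1 = complex.Im (herm p 1 0),
      p 0 o2 = 2^-1 * (complex.Re (herm p 0 0) - complex.Re (herm p 1 1)) &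
      p 0 o3 = 2^-1 * (complex.Re (herm p 0 0) + complex.Re (herm p 1 1))].
Proof. rewrite hermE !mxE /=; split => //; lra. Qed.

(** The components of the tetrad are real-linear in the entries of the matrices
    [i F^a]. *)
Lemma tetrad_smooth L e k a c : is_diffop A L -> is_tetrad A L e -> A c ->
  smooth_on (cimg c) (fun y => e k c y 0 a).
Proof.
move=> [sF _ _] te Ac; have oU := cimg_open hA Ac.
have sH i j : csmooth_on (cimg c) (fun y => herm (\row_j e j c y 0 a) i j).
  apply: (@csmooth_ext _ _ _ oU (fun y => 'i * opF L a c y i j)).
    by move=> y cy; rewrite -(opF_herm _ te)// mxE.
  by apply: csmoothM => //; [exact: csmooth_cst|exact: sF].
have [h10r h10i] := sH 1 0; have [h00 _] := sH 0 0; have [h11 _] := sH 1 1.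
have hc y := herm_coords (\row_j e j c y 0 a).
move: k; apply: ord4P.
- by apply: smooth_ext h10r => // y _; have [] := hc y; rewrite mxE.
- by apply: smooth_ext h10i => // y _; have [] := hc y; rewrite !mxE.
- apply: smooth_ext (smoothM oU (smooth_cst _ 2^-1) (smoothB oU h00 h11)) => // y _.
  by have [_ _ + _] := hc y; rewrite mxE => ->.
- apply: smooth_ext (smoothM oU (smooth_cst _ 2^-1) (smoothD oU h00 h11)) => // y _.
  by have [_ _ _] := hc y; rewrite mxE => ->.
Qed.

Lemma tetrad_is_vector L e k : is_diffop A L -> is_tetrad A L e -> is_vector A (e k).
Proof.
move=> dL te; split=> [c a Ac|c d x Ac Ad cx dx]; first exact: tetrad_smooth te Ac.
exact: tetrad_vector te Ac Ad cx dx.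
Qed.

(** In the form given by [frame_inverse] this is an identity of symmetric matrices,
    whose quadratic forms are both minus the determinant of the principal symbol. *)
Lemma tetrad_orthonormal g L e c y : lorentz_metric A g -> corresponds_to A g L ->
  is_tetrad A L e -> A c -> cimg c y ->
  frame_mx e c y *m g c y *m (frame_mx e c y)^T = eta.
Proof.
move=> hg cg te Ac cy; have ug := metric_unit hg Ac cy.
apply/(frame_inverse _ ug); apply: quadratic_form_inj.
- by rewrite !trmx_mul trmxK etaT mulmxA.
- by rewrite trmx_inv; have [_ _ h _] := hg; rewrite h.
- move=> p; have := cg c y p Ac cy; rewrite (Lprin_herm _ te)// det_herm.
  by move=> [] /oppr_inj <-; rewrite trmx_mul trmxK !mulmxA.
Qed.

End Tetrads.

(** * Framings as maps into the Lorentz group *)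

Section FramingMaps.
Context {R : realType} {M : topologicalType} (A O : set (chart R M)).
Context (g : coord_field R M 'M[R]_4) (q : coord_field R M 'rV[R]_4).
Context (ctop ctem : int) (b : 'I_4 -> coord_field R M 'rV[R]_4).
Hypothesis hA : maximal_atlas A.
Hypothesis hg : lorentz_metric A g.
Hypothesis hO : orientation A O.
Hypothesis hqt : cotimelike A g q.
Hypothesis hb : is_framing A O g q ctop ctem b.
Local Notation C := R[i].
Implicit Types (c d : chart R M) (x : M) (L : operator R M) (f : M -> 'M[R]_4).
Implicit Types (e : 'I_4 -> coord_field R M 'rV[R]_4).
Local Notation E e c x := (frame_mx e c (cmap c x)).
Local Notation B c x := (frame_mx b c (cmap c x)).

Lemma frame_change e c d x : (forall k, is_vector A (e k)) -> A c -> A d -> cdom c x -> cdom d x ->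
  E e d x = E e c x *m Jac c d (cmap c x).
Proof.
move=> ve Ac Ad cx dx; apply/matrixP => j a; rewrite !mxE.
have [_ /(_ c d x Ac Ad cx dx) ->] := ve j; rewrite mxE.
by apply: eq_bigr => k _; rewrite !mxE.
Qed.

Lemma framing_orthonormal c y : A c -> cimg c y ->
  frame_mx b c y *m g c y *m (frame_mx b c y)^T = eta.
Proof.
move=> Ac cy; have [_ h _ _] := hb; apply/matrixP => j k; rewrite -(h c y j k Ac cy).
rewrite !mxE; apply: eq_bigr => a _; rewrite !mxE; congr (_ * _).
by apply: eq_bigr => a' _; rewrite !mxE.
Qed.

Lemma framing_unit c y : A c -> cimg c y -> frame_mx b c y \in unitmx.
Proof.
move=> Ac cy; rewrite unitmxE unitfE; apply/eqP => d0.
have := congr1 (fun X => \det X) (framing_orthonormal Ac cy).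
rewrite !det_mulmx d0 !mul0r => /esym e0.
have := congr1 (fun X => \det X) (@eta2 R); rewrite det_mulmx e0 mul0r det1.
by move/eqP; rewrite eq_sym oner_eq0.
Qed.

(** In a frame, the matrix [f] with [E = f^T B] is read off from the scalar
    products of the two frames, which are smooth and chart independent. *)
Definition frame_coef e c y : 'M[R]_4 :=
  (frame_mx e c y *m g c y *m (frame_mx b c y)^T *m eta)^T.

Lemma frame_coefP e c y : A c -> cimg c y ->
  frame_mx e c y = (frame_coef e c y)^T *m frame_mx b c y.
Proof.
move=> Ac cy; have ug := metric_unit hg Ac cy.
have /(frame_inverse _ ug) h := framing_orthonormal Ac cy.
by rewrite trmxK -!mulmxA [_^T *m _]mulmxA h mulmxA mulmxK.
Qed.

Lemma frame_coef_change e c d x : (forall k, is_vector A (e k)) -> A c -> A d -> cdom c x -> cdom d x ->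
  frame_coef e c (cmap c x) = frame_coef e d (cmap d x).
Proof.
move=> ve Ac Ad cx dx; rewrite /frame_coef; congr (_ *m _)^T.
have [vb _ _ _] := hb; have [_ h _ _] := hg.
rewrite (frame_change ve Ac Ad cx dx) (frame_change vb Ac Ad cx dx) (h c d x Ac Ad cx dx).
by rewrite trmx_mul !mulmxA.
Qed.

Lemma frame_coef_smooth e c i j : (forall k, is_vector A (e k)) -> A c ->
  smooth_on (cimg c) (fun y => frame_coef e c y i j).
Proof.
move=> ve Ac; have oU := cimg_open hA Ac; have [vb _ _ _] := hb; have [sg _ _ _] := hg.
apply: (@smooth_ext _ _ _ (fun y =>
   \sum_p (\sum_r (\sum_s e j c y 0 s * g c y s r) * b p c y 0 r) * eta p i)) => //.
  move=> y _; rewrite !mxE; apply: eq_bigr => p _; congr (_ * _); rewrite !mxE.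
  apply: eq_bigr => r _; rewrite !mxE; congr (_ * _); apply: eq_bigr => s _.
  by rewrite !mxE.
apply: smooth_sum => // p _; apply: smoothM => //; last exact: smooth_cst.
apply: smooth_sum => // r _; apply: smoothM => //; last exact: (vb p).1.
apply: smooth_sum => // s _; apply: smoothM => //; last exact: sg.
exact: (ve j).1.
Qed.

(** This formula carries the whole comparison: the principal symbol determines [f],
    and a congruence by [S] multiplies [f] on the right by [Ad S]. *)
Lemma is_fL_Lprin L f c x p : is_fL A b L f -> A c -> cdom c x ->
  Lprin L c (cmap c x) p = herm (p *m (B c x)^T *m f x).
Proof.
move=> [_ _ [e te h]] Ac cx; rewrite (Lprin_herm _ te)//; last exact: cimg_cmap.
congr herm; have -> : E e c x = (f x)^T *m B c x; last by rewrite trmx_mul trmxK mulmxA.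
apply/matrixP => k a; rewrite mxE (h c x k Ac cx) summxE [RHS]mxE.
by apply: eq_bigr => j _; rewrite !mxE.
Qed.

Lemma is_fL_unique L f f' : is_fL A b L f -> is_fL A b L f' -> f = f'.
Proof.
move=> h h'; apply/funext => x; have [c Ac cx] := chart_at hA x.
have uB : (B c x)^T \in unitmx by rewrite unitmx_tr; apply: framing_unit => //; exact: cimg_cmap.
apply: (can_inj (mulKmx uB)); apply/row_matrixP => k; rewrite !rowE.
by apply: herm_inj; rewrite !mulmxA -(is_fL_Lprin _ h)// -(is_fL_Lprin _ h').
Qed.

Lemma timelike_time_neq0 (v : 'rV[R]_4) : (v *m eta *m v^T) 0 0 < 0 -> v 0 o3 != 0.
Proof.
rewrite !mxE !sum4 !mxE !sum4 !mxE /= => h; apply/eqP => z; move: h; rewrite z.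
by move=> h; exfalso; nra.
Qed.

(** On timelike covectors the sign of the time component is not changed by a Lorentz
    matrix with positive time entry: in the time component of [v m], the term with
    the time component of [v] dominates the others, by the Cauchy-Schwarz
    inequality. *)
Lemma time_dominates (v : 'rV[R]_4) (m : 'M[R]_4) :
  (v *m eta *m v^T) 0 0 < 0 -> Lorentz m -> 0 < m o3 o3 ->
  sgz ((v *m m) 0 o3) = sgz (v 0 o3).
Proof.
rewrite mxE sum4 !mxE !sum4 !mxE /= => hv Lm m0; have := Lorentz_time Lm.
set f0 := m o0 o3; set f1 := m o1 o3; set f2 := m o2 o3; set f3 := m o3 o3 => hf.
have : v 0 o0 * v 0 o0 + v 0 o1 * v 0 o1 + v 0 o2 * v 0 o2 < v 0 o3 * v 0 o3.
  by move: hv; lra.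
have : f3 * f3 = 1 + f0 * f0 + f1 * f1 + f2 * f2 by move: hf; rewrite !expr2.
have {m0} : 0 < f3 := m0.
clear hv hf Lm; move: f0 f1 f2 f3 (v 0 o0) (v 0 o1) (v 0 o2) (v 0 o3) => f0 f1 f2 f3 v0 v1 v2 v3 f3_0 ff vv.
have key w0 w1 w2 w3 : 0 < w3 -> w0 * w0 + w1 * w1 + w2 * w2 < w3 * w3 ->
    0 < w0 * f0 + w1 * f1 + w2 * f2 + w3 * f3.
  move=> w3_0 ww; set S := w0 * f0 + w1 * f1 + w2 * f2.
  have CS : S * S <= (w0 * w0 + w1 * w1 + w2 * w2) * (f0 * f0 + f1 * f1 + f2 * f2).
    rewrite -subr_ge0 (_ : _ - _ = (w0 * f1 - w1 * f0) ^+ 2 + (w0 * f2 - w2 * f0) ^+ 2 +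
      (w1 * f2 - w2 * f1) ^+ 2); last by rewrite /S; ring.
    by rewrite !addr_ge0 ?sqr_ge0.
  have Q0 : 0 <= f0 * f0 + f1 * f1 + f2 * f2 by rewrite -!expr2 !addr_ge0 ?sqr_ge0.
  have h1 : S * S <= w3 * w3 * (f3 * f3 - 1).
    apply: le_trans CS _; have -> : f3 * f3 - 1 = f0 * f0 + f1 * f1 + f2 * f2 by rewrite ff; ring.
    by apply: ler_wpM2r => //; exact: ltW.
  have wf : 0 < w3 * f3 by exact: mulr_gt0.
  have h2 : S * S < (w3 * f3) * (w3 * f3).
    apply: le_lt_trans h1 _; rewrite (_ : _ * (f3 * f3 - 1) = (w3 * f3) * (w3 * f3) - w3 * w3); last by ring.
    by rewrite ltrBlDr ltrDl mulr_gt0.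
  rewrite ltNge; apply/negP => Sneg; move: h2; rewrite ltNge => /negP; apply.
  have h3 : w3 * f3 <= - S by rewrite -subr_le0 opprK addrC.
  by rewrite -[S * S]mulrNN; exact: (ler_pM (ltW wf) (ltW wf) h3 h3).
have [v3p|v3n|v3z] := ltgtP 0 v3.
- by rewrite !gtr0_sgz//; exact: key.
- have := key (- v0) (- v1) (- v2) (- v3); rewrite oppr_gt0 !mulrNN => /(_ v3n vv) h.
  by rewrite !ltr0_sgz//; move: h; rewrite !mulNr; lra.
- by move: vv; rewrite -v3z mulr0 => h; exfalso; nra.
Qed.

Lemma cotimelike_frame c y : A c -> cimg c y ->
  (q c y *m (frame_mx b c y)^T *m eta *m (q c y *m (frame_mx b c y)^T)^T) 0 0 < 0.
Proof.
move=> Ac cy; have ug := metric_unit hg Ac cy; have := hqt Ac cy.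
by have /(frame_inverse _ ug) <- := framing_orthonormal Ac cy; rewrite trmx_mul trmxK !mulmxA.
Qed.

Lemma time_pairing e c y : (q c y *m (e ord_max c y)^T) 0 0 = (q c y *m (frame_mx e c y)^T) 0 o3.
Proof.
rewrite !mxE; apply: eq_bigr => a _; rewrite !mxE; congr (_ * e _ _ _ _ _).
exact/val_inj.
Qed.

(** From [E = m^T B], the Gram matrix of [E] is [m^T eta m], and the charges of [E]
    differ from those of [B] by the signs of the determinant and of the time entry
    of [m], to which [SOplusP] applies. *)
Lemma SOplus_frame e c x (m : 'M[R]_4) : O c -> cdom c x ->
  E e c x = m^T *m B c x ->
  SOplus m <-> [/\ E e c x *m g c (cmap c x) *m (E e c x)^T = eta,
                   sgz (\det (E e c x)) = ctop &
                   sgz ((q c (cmap c x) *m (e ord_max c (cmap c x))^T) 0 0) = ctem].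
Proof.
move=> Oc cx eE; have Ac : A c by have [h _ _] := hO; exact: h.
have cy := cimg_cmap cx; have [_ _ hd ht] := hb.
have sd := hd c _ Oc cy; have st := ht c _ Ac cy.
rewrite time_pairing in st; rewrite time_pairing; have tq := cotimelike_frame Ac cy.
have eL : E e c x *m g c (cmap c x) *m (E e c x)^T = m^T *m eta *m m.
  by rewrite eE trmx_mul trmxK -(framing_orthonormal Ac cy) !mulmxA.
have eq3 : q c (cmap c x) *m (E e c x)^T = q c (cmap c x) *m (B c x)^T *m m.
  by rewrite eE trmx_mul trmxK mulmxA.
have edet : \det (E e c x) = \det m * \det (B c x) by rewrite eE det_mulmx det_tr.
have dB : \det (B c x) != 0.
  by have := framing_unit Ac cy; rewrite unitmxE unitfE.
rewrite eL edet eq3 sgzM; split=> [/SOplusP [Lm dm m0]|[Lm dm tm]].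
  by split => //; [rewrite (gtr0_sgz dm) mul1r|rewrite (time_dominates tq Lm m0)].
apply/SOplusP; split => //.
  rewrite -sgz_gt0; have : sgz (\det m) * sgz (\det (B c x)) = 1 * sgz (\det (B c x)).
    by rewrite dm mul1r.
  by move/(mulIf _) => -> //; rewrite sgz_eq0.
set v := q c (cmap c x) *m (B c x)^T in tq tm st.
have v3 : v 0 o3 != 0 by exact: timelike_time_neq0.
have m3 : m o3 o3 != 0.
  by apply/eqP => z; have := Lorentz_time Lm; rewrite z; nra.
rewrite lt_neqAle eq_sym m3 /= leNgt; apply/negP => mneg.
(* otherwise [- m] preserves the sign of the time component, so [m] reverses it *)
have LN : Lorentz (- m).
  have e1 : (- m)^T = - m^T by apply/matrixP => i j; rewrite !mxE.
  by rewrite /Lorentz /= e1 mulmxN !mulNmx opprK.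
have := time_dominates tq LN; rewrite mxE oppr_gt0 => /(_ mneg).
rewrite mulmxN mxE sgzN tm st => /eqP; rewrite eq_sym -subr_eq0 opprK -mulr2n mulrn_eq0 /=.
by rewrite -st sgz_eq0 (negbTE v3).
Qed.

(** The tetrad of the operator consists of vector fields, so it is an orthonormal
    frame with the prescribed charges, and [frame_coef] is its map into [SOplus]. *)
Lemma admissible_fL L : admissible A O g q ctop ctem L -> exists f, is_fL A b L f.
Proof.
move=> [[dL _] _ cg [e te sdet] stem].
have ve k := tetrad_is_vector hA k dL te.
(* at each point some chart is chosen; the value does not depend on it *)
pose pick x := s2val (cid2 (chart_at hA x)).
pose f x := frame_coef e (pick x) (cmap (pick x) x).
have fE c x : A c -> cdom c x -> f x = frame_coef e c (cmap c x).
  by move=> Ac cx; apply: frame_coef_change => //; rewrite /pick; case: cid2.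
exists f; split.
- move=> i j c Ac; apply: smooth_ext (frame_coef_smooth i j ve Ac); first exact: (cimg_open hA).
  by move=> y cy; rewrite (fE c)// ?(cinvK hA)//; exact: (cinv_dom hA).
- move=> x; have [_ hOx _] := hO; have [c Oc cx] := hOx x.
  have Ac : A c by have [h _ _] := hO; exact: h.
  have cy := cimg_cmap cx.
  apply/(SOplus_frame Oc cx (e := e)); first by rewrite (fE c)// -frame_coefP.
  split; [exact: (tetrad_orthonormal hg cg te Ac cy)|exact: sdet|].
  have := stem c _ Ac cy; rewrite (Lprin_herm _ te)// time_pairing.
  set w := _ *m _; rewrite (_ : complex.Re (\tr (herm w)) = 2 * w 0 o3); last first.
    by rewrite /mxtrace sum2 ReD hermE !mxE /=; ring.
  by rewrite sgzM gtr0_sgz ?mul1r.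
- exists e => // c x k Ac cx; apply/rowP => a.
  have /matrixP /(_ k a) := frame_coefP e Ac (cimg_cmap cx).
  rewrite mxE => ->; rewrite -(fE c)// !mxE summxE; apply: eq_bigr => j _.
  by rewrite !mxE.
Qed.

(** The relation on maps into [SO^+(3, 1)] to which both equivalences reduce: by
    [an_equivP] for operators and by [trad_equivP] for equivariant maps. *)
Definition Ad_related (f f' : M -> 'M[R]_4) : Prop :=
  exists S : M -> 'M[C]_2,
    [/\ smooth_cmx A S, forall x, SL2 (S x) & forall x, f' x = f x *m Ad (S x)].

Lemma an_equivP L L' f f' : is_fL A b L f -> is_fL A b L' f' ->
  an_equiv A L L' <-> Ad_related f f'.
Proof.
move=> h h'; split=> -[S [sS S1 SE]]; exists S; split => //.
- move=> x; have [c Ac cx] := chart_at hA x.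
  have uB : (B c x)^T \in unitmx by rewrite unitmx_tr; apply: framing_unit => //; exact: cimg_cmap.
  apply: (can_inj (mulKmx uB)); apply/row_matrixP => k; rewrite !rowE.
  apply: herm_inj; have := SE c x (delta_mx 0 k) Ac cx.
  by rewrite (is_fL_Lprin _ h)// (is_fL_Lprin _ h')// Ad_herm !mulmxA.
- move=> c x p Ac cx; rewrite (is_fL_Lprin _ h)// (is_fL_Lprin _ h')// Ad_herm SE.
  by rewrite !mulmxA.
Qed.

End FramingMaps.

(** * Equivariant maps and their values at the identity *)

Section TraditionalMaps.
Context {R : realType} {M : topologicalType} (A : set (chart R M)).
Hypothesis hA : maximal_atlas A.
Local Notation C := R[i].
Local Notation N8 := (2 * 2 + 2 * 2)%N.
Implicit Types (c d : chart R M) (x : M) (f : M -> 'M[R]_4).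

Definition unrealify (v : 'rV[R]_N8) : 'M[C]_2 :=
  \matrix_(i < 2, j < 2) (vec_mx (lsubmx v) i j +i* vec_mx (rsubmx v) i j).

Lemma realifyK h : unrealify (realify h) = h :> 'M[C]_2.
Proof.
apply/matrixP => i j; rewrite mxE /realify row_mxKl row_mxKr !mxvecK !mxE.
by case: (h i j).
Qed.

Lemma unrealify_smooth n (U : set 'rV[R]_n) (phi : 'rV[R]_n -> 'rV[R]_N8) i j :
  open U -> (forall k, smooth_on U (fun w => phi w 0 k)) ->
  csmooth_on U (fun w => unrealify (phi w) i j).
Proof.
move=> oU sphi; split.
  by apply: smooth_ext (sphi (lshift _ (mxvec_index i j))) => // w _; rewrite !mxE.
by apply: smooth_ext (sphi (rshift _ (mxvec_index i j))) => // w _; rewrite !mxE.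
Qed.

Definition prod_dom c : set 'rV[R]_(4 + N8) := [set w | cimg c (lsubmx w)].

Lemma prod_dom_open c : A c -> open (prod_dom c).
Proof.
move=> Ac; rewrite openE => w cw.
have cl : {for w, continuous (fun w : 'rV[R]_(4 + N8) => lsubmx w)}.
  apply: rV_continuous => j; rewrite (_ : (fun z => _) = fun z : 'rV[R]_(4 + N8) => z 0 (lshift N8 j)).
    exact: coord_continuous.
  by apply/funext => z; rewrite mxE.
exact: (cl _ (open_near (cimg_open hA Ac) cw)).
Qed.

(** The functions that occur are defined for all complex matrices, so the local
    extension can be chosen on the whole product of [cimg c] and [R^8]. *)
Lemma smooth_MSL2_intro (u : M * 'M[C]_2 -> R) :
  (forall c, A c -> smooth_on (prod_dom c) (fun w => u (cinv c (lsubmx w), unrealify (rsubmx w)))) ->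
  smooth_MSL2 A u.
Proof.
move=> H c x0 h0 Ac cx0 _.
exists (prod_dom c), (fun w => u (cinv c (lsubmx w), unrealify (rsubmx w))); split.
- exact: prod_dom_open.
- by rewrite /prod_dom /= row_mxKl; exact: cimg_cmap.
- exact: H.
- by move=> x h cx _ _; rewrite row_mxKl row_mxKr (cmapK hA)// realifyK.
Qed.

Lemma smooth_fst c (u : M -> R) : smooth_fun A u -> A c ->
  smooth_on (prod_dom c) (fun w => u (cinv c (lsubmx w))).
Proof.
move=> su Ac; apply: (@smooth_comp R _ _ (prod_dom c) (cimg c) (fun y => u (cinv c y)) (fun w => lsubmx w)).
- exact: prod_dom_open.
- exact: (cimg_open hA).
- by [].
- exact: su.
- move=> k; apply: smooth_ext (smooth_coord _ (lshift N8 k)); first exact: prod_dom_open.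
  by move=> w _; rewrite mxE.
Qed.

Lemma csmooth_fst c (S : M -> 'M[C]_2) i j : smooth_cmx A S -> A c ->
  csmooth_on (prod_dom c) (fun w => S (cinv c (lsubmx w)) i j).
Proof.
by move=> sS Ac; have [sr si] := sS i j; split; [exact: (smooth_fst sr)|exact: (smooth_fst si)].
Qed.

Lemma csmooth_snd c i j : A c -> csmooth_on (prod_dom c) (fun w => unrealify (rsubmx w) i j).
Proof.
move=> Ac; apply: unrealify_smooth; first exact: prod_dom_open.
move=> k; apply: smooth_ext (smooth_coord _ (rshift 4 k)); first exact: prod_dom_open.
by move=> w _; rewrite mxE.
Qed.

Lemma smooth_MSL2_slice (u : M * 'M[C]_2 -> R) :
  smooth_MSL2 A u -> smooth_fun A (fun x => u (x, 1%:M)).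
Proof.
move=> su c Ac; apply: smooth_local => y0 cy0.
have [W [f [oW W0 sf uf]]] := su c (cinv c y0) 1%:M Ac (cinv_dom hA Ac cy0) (@SL2_1 R).
rewrite (cinvK hA)// in W0.
pose phi (y : 'rV[R]_4) : 'rV[R]_(4 + N8) := row_mx y (realify 1%:M).
have sphi (U : set 'rV[R]_4) b : open U -> smooth_on U (fun y => phi y 0 b).
  move=> oU; case: (split_ordP b) => k ->.
    by apply: smooth_ext (smooth_coord _ k) => // y _; rewrite row_mxEl.
  by apply: smooth_ext (smooth_cst _ (realify 1%:M 0 k)) => // y _; rewrite row_mxEr.
have cphi y : {for y, continuous phi}.
  by apply: rV_continuous => b; exact: (smooth_continuous (sphi setT b openT)).
have oV : open (cimg c `&` phi @^-1` W).
  rewrite openE => y [cy Wy].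
  have n1 := open_near (cimg_open hA Ac) cy.
  have n2 : \forall z \near y, W (phi z) by exact: (cphi y _ (open_near oW Wy)).
  exact: filterI n1 n2.
exists (cimg c `&` phi @^-1` W); first by split.
apply: (@smooth_ext _ _ _ (fun y => f (phi y))) => //.
  move=> y [cy Wy]; have := uf (cinv c y) 1%:M (cinv_dom hA Ac cy) (@SL2_1 R).
  by rewrite (cinvK hA)// => ->.
apply: (smooth_comp oV oW _ sf) => [y []//|b]; exact: sphi.
Qed.

Lemma Ad_related_refl f : Ad_related A f f.
Proof.
exists (fun=> 1%:M); split=> [i j|x|x]; last by rewrite Ad1 mulmx1.
  by split=> c Ac; exact: smooth_cst.
exact: SL2_1.
Qed.

Lemma SL2_invE (h : 'M[C]_2) : SL2 h -> invmx h = mx2 (h 1 1) (- h 0 1) (- h 1 0) (h 0 0).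
Proof.
move=> h1; have uh := SL2_unit h1; apply: (can_inj (mulKmx uh)); rewrite mulmxV//.
have h1' : h 0 0 * h 1 1 - h 0 1 * h 1 0 = 1 by rewrite -[RHS]h1 [in RHS](mx2_eta h) det_mx2E.
rewrite [X in _ = X *m _]mx2_eta mx2M -mx2_1.
by congr mx2; first [by ring | by rewrite -[LHS]h1'; ring].
Qed.

Lemma Ad_related_sym f f' : Ad_related A f f' -> Ad_related A f' f.
Proof.
move=> [S [sS S1 SE]]; exists (fun x => invmx (S x)); split=> [i j|x|x].
- have cs k : csmooth_on (cimg k) (fun y => invmx (S (cinv k y)) i j) \/ ~ A k.
    have [Ak|] := pselect (A k); [left|by right].
    have oU := cimg_open hA Ak.
    have s p r : csmooth_on (cimg k) (fun y => S (cinv k y) p r).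
      by have [sr si] := sS p r; split; [exact: sr|exact: si].
    apply: (@csmooth_ext _ _ _ oU (fun y => mx2 (S (cinv k y) 1 1) (- S (cinv k y) 0 1)
        (- S (cinv k y) 1 0) (S (cinv k y) 0 0) i j)).
      by move=> y _; rewrite SL2_invE.
    by move: i j; apply: ord2P; apply: ord2P;
      (apply: (@csmooth_ext _ _ _ oU _ _ (fun y _ => esym (mxE _ _ _ _)));
       rewrite //=; try exact: csmoothN; exact: s).
  by split=> k Ak; have [[]|] := cs k.
- exact: SL2_inv.
- by rewrite SE -mulmxA AdV// mulmx1.
Qed.

Lemma Ad_related_trans f f' f'' : Ad_related A f f' -> Ad_related A f' f'' -> Ad_related A f f''.
Proof.
move=> [S [sS S1 SE]] [T [sT T1 TE]]; exists (fun x => S x *m T x); split=> [i j|x|x].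
- have cs k : A k -> csmooth_on (cimg k) (fun y => (S (cinv k y) *m T (cinv k y)) i j).
    move=> Ak; apply: csmooth_mulmx => [|p r|p r]; first exact: (cimg_open hA).
      by have [sr si] := sS p r; split; [exact: sr|exact: si].
    by have [sr si] := sT p r; split; [exact: sr|exact: si].
  by split=> k Ak; have [] := cs k Ak.
- exact: SL2M.
- by rewrite TE SE AdM mulmxA.
Qed.

Lemma Phi_of_equivariant f : smooth_mx A f -> (forall x, SOplus (f x)) ->
  equivariant_map A (Phi_of f).
Proof.
move=> sf Sf; split.
- move=> j k; apply: smooth_MSL2_intro => c Ac; have oU := prod_dom_open Ac.
  apply: (@smooth_ext _ _ _ (fun w => \sum_l f (cinv c (lsubmx w)) j l * Ad (unrealify (rsubmx w)) l k)) => //.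
    by move=> w _; rewrite /Phi_of /= mxE.
  apply: smooth_sum => // l _; apply: smoothM => //; first exact: (smooth_fst (sf j l)).
  by apply: smooth_Ad => // i r; exact: csmooth_snd.
- move=> [x h] [_ /= h1]; split => //=; apply: SOplusM => //; exact: SOplus_Ad.
- by [].
- by move=> x h h1; rewrite /Phi_of /= Ad1 mulmx1.
Qed.

Definition fiber_map (Phi : M * 'M[C]_2 -> M * 'M[R]_4) (x : M) : 'M[R]_4 := (Phi (x, 1%:M)).2.

Lemma fiber_mapE Phi x h : equivariant_map A Phi -> SL2 h -> Phi (x, h) = (x, fiber_map Phi x *m Ad h).
Proof.
by move=> [_ _ p1 p2] h1; rewrite p2// p1//; exact: SL2_1.
Qed.

Lemma fiber_Phi_of f : fiber_map (Phi_of f) = f.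
Proof. by apply/funext => x; rewrite /fiber_map /= Ad1 mulmx1. Qed.

Lemma fiber_map_smooth Phi : equivariant_map A Phi -> smooth_mx A (fiber_map Phi).
Proof. by move=> [s _ _ _] i j; exact: smooth_MSL2_slice (s i j). Qed.

Lemma fiber_map_SOplus Phi x : equivariant_map A Phi -> SOplus (fiber_map Phi x).
Proof. by move=> [_ s _ _]; have [] := s (x, 1%:M) (conj I (@SL2_1 R)). Qed.

(** An equivariant map is determined by its values at the identity, and an
    automorphism [(x, h) |-> (x, S x h)] multiplies these on the right by
    [Ad (S x)]. *)
Lemma trad_equivP Phi1 Phi2 : equivariant_map A Phi1 -> equivariant_map A Phi2 ->
  trad_equiv A Phi1 Phi2 <-> Ad_related A (fiber_map Phi2) (fiber_map Phi1).
Proof.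
move=> e1 e2; split=> [[B [sB SB B1 _ BP]]|[S [sS S1 SE]]].
  exists (fun x => (B (x, 1%:M)).2); split=> [i j|x|x].
  - by have [sr si] := sB i j; split; [exact: smooth_MSL2_slice sr|exact: smooth_MSL2_slice si].
  - by have [] := SB (x, 1%:M) (conj I (@SL2_1 R)).
  - have SBx : SL2 (B (x, 1%:M)).2 by have [] := SB (x, 1%:M) (conj I (@SL2_1 R)).
    have eB : B (x, 1%:M) = (x, (B (x, 1%:M)).2).
      by have := B1 x 1%:M (@SL2_1 R); case: (B (x, 1%:M)) => y T /= ->.
    have := @fiber_mapE _ x _ e2 SBx; rewrite -eB BP; last exact: SL2_1.
    by move/(congr1 snd).
exists (fun z => (z.1, S z.1 *m z.2)); split=> /=.
- move=> i j.
  have cs c : A c -> csmooth_on (prod_dom c) (fun w =>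
      (S (cinv c (lsubmx w)) *m unrealify (rsubmx w)) i j).
    move=> Ac; apply: csmooth_mulmx => [|p r|p r]; first exact: prod_dom_open.
      exact: csmooth_fst.
    exact: csmooth_snd.
  by split; apply: smooth_MSL2_intro => c Ac; have [] := cs c Ac.
- by move=> [x h] [_ /= h1]; split => //=; exact: SL2M.
- by [].
- by move=> x h h1; rewrite mulmx1.
- move=> x h h1; rewrite !fiber_mapE//; last exact: SL2M.
  by rewrite SE AdM mulmxA.
Qed.

End TraditionalMaps.

(** * Lie derivatives of half-densities *)

Section LieDerivative.
Context {R : realType} {M : topologicalType} (A : set (chart R M)).
Hypothesis hA : maximal_atlas A.
Local Notation C := R[i].
Implicit Types (c d : chart R M) (x : M) (U : set M) (X : coord_field R M 'rV[R]_4).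
Implicit Types (u : coord_field R M R) (e : 'I_4 -> coord_field R M 'rV[R]_4).

(** The real and imaginary parts of the components of a 2-column of
    half-densities. *)
Definition real_hd U u : Prop :=
  (forall c, A c -> smooth_on (cset c U) (u c)) /\
  (forall c d x, A c -> A d -> U x -> cdom c x -> cdom d x ->
     u c (cmap c x) = wt c d (cmap c x) * u d (cmap d x)).

Definition divergence X c y : R := \sum_(a < 4) partial a (fun z => X c z 0 a) y.

(** The Lie derivative of a half-density, which does not depend on the
    coordinates. *)
Definition lie X u : coord_field R M R := fun c y =>
  \sum_(a < 4) X c y 0 a * partial a (u c) y + 2^-1 * (divergence X c y * u c y).

(** By Schwarz's theorem, the derivative of the Jacobian matrix contributes the
    trace of [J^-1 X(J)], which Jacobi's formula identifies with [X (log |det J|)]. *)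
Lemma divergence_change X c d x : is_vector A X -> A c -> A d -> cdom c x -> cdom d x ->
  divergence X d (cmap d x) * \det (Jac c d (cmap c x)) =
  divergence X c (cmap c x) * \det (Jac c d (cmap c x)) +
  \sum_(a < 4) X c (cmap c x) 0 a * partial a (fun z => \det (Jac c d z)) (cmap c x).
Proof.
move=> [sX tX] Ac Ad cx dx; set y := cmap c x; set z := cmap d x.
have oV : open (cset c (cdom d)) by apply: (cset_open hA) => //; exact: (cdom_open hA).
have oV' : open (cset d (cdom c)) by apply: (cset_open hA) => //; exact: (cdom_open hA).
have Vy : cset c (cdom d) y by exact: cset_point.
have Vz : cset d (cdom c) z by exact: cset_point.
have sJ a b := Jac_smooth hA a b Ac Ad.
have sXV a : smooth_on (cset c (cdom d)) (fun w => X c w 0 a).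
  by apply: smooth_sub (sX c a Ac); exact: cset_cimg.
(* [h b] is the component [b] of [X] in the chart [d], as a function of the coordinates of [c] *)
pose h b w := \sum_(a < 4) X c w 0 a * Jac c d w a b.
have sh b : smooth_on (cset c (cdom d)) (h b).
  by apply: smooth_sum => // a _; apply: smoothM.
have dh b k : partial k (h b) y = \sum_(a < 4) (partial k (fun w => X c w 0 a) y * Jac c d y a b +
    X c y 0 a * partial k (fun w => Jac c d w a b) y).
  rewrite /h /partial derive_sumE; last first.
    by move=> a; apply: smooth_derivable (smoothM oV (sXV a) (sJ a b)) Vy.
  apply: eq_bigr => a _; rewrite -[LHS]/(partial k (fun w => X c w 0 a * Jac c d w a b) y) partialM//.
    exact: smooth_derivable (sXV a) Vy.
  exact: smooth_derivable (sJ a b) Vy.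
have dXd b : partial b (fun w => X d w 0 b) z = \sum_(k < 4) Jac d c z b k * partial k (h b) y.
  rewrite (@partial_ext _ _ _ _ (fun w => h b (trans d c w)) _ _ oV' Vz).
    rewrite (@partial_chain _ _ _ (h b) (trans d c)).
    - by rewrite (transE hA)//; apply: eq_bigr => k _; rewrite mxE.
    - by apply: (smooth_differentiable oV (sh b)); rewrite (transE hA).
    - by move=> k; apply: smooth_derivable (trans_smooth hA k Ad Ac) Vz.
  by move=> _ [x' [cx' dx'] <-]; rewrite (transE hA)// (tX c d x')// mxE.
have JK : Jac c d y *m Jac d c z = 1%:M by exact: (JacK hA).
have KJ : Jac d c z *m Jac c d y = 1%:M by exact: (JacK hA).
have schwarz a b k : partial k (fun w => Jac c d w a b) y = partial a (fun w => Jac c d w k b) y.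
  have st := trans_smooth hA b Ac Ad.
  rewrite (@partial_ext _ _ _ _ (partial a (fun w => trans c d w 0 b)) _ _ oV Vy); last by move=> w _; rewrite mxE.
  rewrite (partial_comm _ _ oV st Vy); apply: (@partial_ext _ _ _ _ _ _ _ oV Vy) => w _.
  by rewrite mxE.
have detK k b : \det (Jac c d y) * Jac d c z b k = cofactor (Jac c d y) k b.
  have uJ : Jac c d y \in unitmx by have [] := mulmx1_unit JK.
  have -> : Jac d c z = invmx (Jac c d y).
    by rewrite -[LHS]mulmx1 -(mulmxV uJ) mulmxA KJ mul1mx.
  rewrite /invmx uJ !mxE mulrA mulfV ?mul1r//.
  by move: uJ; rewrite unitmxE unitfE.
have jac a : partial a (fun w => \det (Jac c d w)) y =
    \sum_(k < 4) \sum_(b < 4) partial a (fun w => Jac c d w k b) y * cofactor (Jac c d y) k b.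
  by apply: derive_det => k b; apply: smooth_derivable (sJ k b) Vy.
have expand : divergence X d z = divergence X c y +
    \sum_(a < 4) X c y 0 a * \sum_(k < 4) \sum_(b < 4)
      Jac d c z b k * partial a (fun w => Jac c d w k b) y.
  rewrite /divergence; under eq_bigr => b _ do rewrite dXd.
  under eq_bigr => b _ do under eq_bigr => k _ do rewrite dh big_split /= mulrDr.
  under eq_bigr => b _ do rewrite big_split.
  rewrite big_split /=; congr (_ + _).
    have -> : \sum_(b < 4) \sum_(k < 4) Jac d c z b k *
        (\sum_(a < 4) partial k (fun w => X c w 0 a) y * Jac c d y a b) =
      \sum_(a < 4) \sum_(k < 4) partial k (fun w => X c w 0 a) y * (Jac c d y *m Jac d c z) a k.
      under eq_bigr => b _ do under eq_bigr => k _ do rewrite mulr_sumr.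
      under eq_bigr => b _ do rewrite exchange_big /=.
      rewrite exchange_big /=; apply: eq_bigr => a _.
      rewrite exchange_big /=; apply: eq_bigr => k _.
      by rewrite mxE mulr_sumr; apply: eq_bigr => b _; ring.
    apply: eq_bigr => a _; rewrite JK (bigD1 a)//= mxE eqxx mulr1 big1 ?addr0// => k ka.
    by rewrite mxE eq_sym (negbTE ka) mulr0.
  under eq_bigr => b _ do under eq_bigr => k _ do rewrite mulr_sumr.
  under eq_bigr => b _ do rewrite exchange_big /=.
  rewrite exchange_big /=; apply: eq_bigr => a _.
  rewrite exchange_big /= mulr_sumr; apply: eq_bigr => k _.
  by rewrite mulr_sumr; apply: eq_bigr => b _; rewrite schwarz; ring.
rewrite expand mulrDl; congr (_ + _); rewrite mulr_suml; apply: eq_bigr => a _.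
rewrite jac -mulrA; congr (_ * _); rewrite mulr_suml; apply: eq_bigr => k _.
rewrite mulr_suml; apply: eq_bigr => b _.
by rewrite -detK; ring.
Qed.

Lemma partial_sqrt_norm n (u : 'rV[R]_n -> R) y a : u y != 0 ->
  derivable u y (delta_mx 0 a) ->
  partial a (fun z => Num.sqrt `|u z|) y * u y = 2^-1 * (Num.sqrt `|u y| * partial a u y).
Proof.
move=> n0 du; have h := is_derive_comp1 (is_derive_sqrt_norm n0) du.
rewrite /partial (@derive_val _ _ _ _ _ _ _ h); move: (Num.sqrt _) ('D_ _ _ _) => r s.
by field.
Qed.

Lemma partial_wt c d x a : A c -> A d -> cdom c x -> cdom d x ->
  partial a (wt c d) (cmap c x) * \det (Jac c d (cmap c x)) =
  2^-1 * (wt c d (cmap c x) * partial a (fun z => \det (Jac c d z)) (cmap c x)).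
Proof.
move=> Ac Ad cx dx; have n0 := det_Jac_neq0 hA Ac Ad cx dx.
have Vy : cset c (cdom d) (cmap c x) by exact: cset_point.
apply: partial_sqrt_norm => //; exact: smooth_derivable (det_Jac_smooth hA Ac Ad) Vy.
Qed.

(** The derivative of the weight [wt] in the direction [X] is half the logarithmic
    derivative of the Jacobian determinant times [wt]. By [divergence_change] this
    is what the divergence term compensates. *)
Lemma lie_real_hd U X u : open U -> is_vector A X -> real_hd U u -> real_hd U (lie X u).
Proof.
move=> oU vX [su tu]; have [sX tX] := vX; split=> [c Ac|c d x Ac Ad Ux cx dx].
  have oV : open (cset c U) by exact: (cset_open hA).
  have sXV a : smooth_on (cset c U) (fun w => X c w 0 a).
    by apply: smooth_sub (sX c a Ac); exact: cset_cimg.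
  apply: smoothD => //.
    by apply: smooth_sum => // a _; apply: smoothM => //; apply: smooth_partial; exact: su.
  apply: smoothM => //; first exact: smooth_cst.
  apply: smoothM => //; last exact: su.
  by apply: smooth_sum => // a _; exact: smooth_partial (sXV a).
set y := cmap c x; set z := cmap d x.
pose V := U `&` cdom d.
have oV : open (cset c V) by apply: (cset_open hA) => //; apply: openI => //; exact: (cdom_open hA).
have Vy : cset c V y by exact: cset_point.
have sw : smooth_on (cset c V) (wt c d).
  by apply: smooth_sub (wt_smooth hA Ac Ad); apply: cset_sub; exact: subIsetr.
have sud : smooth_on (cset c V) (fun w => u d (trans c d w)).
  by apply: (smooth_transfer hA Ad Ac oU); exact: su.
have duc a : partial a (u c) y = partial a (wt c d) y * u d z +
    wt c d y * \sum_(b < 4) Jac c d y a b * partial b (u d) z.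
  rewrite (@partial_ext _ _ _ _ (fun w => wt c d w * u d (trans c d w)) _ _ oV Vy); last first.
    by move=> _ [x' [[Ux' dx'] cx'] <-]; rewrite (transE hA)//; exact: tu.
  rewrite partialM; [|exact: smooth_derivable sw Vy|exact: smooth_derivable sud Vy].
  rewrite (transE hA)//; congr (_ + _ * _).
  rewrite (@partial_chain _ _ _ (u d) (trans c d)).
  - by rewrite (transE hA)//; apply: eq_bigr => b _; rewrite mxE.
  - apply: (smooth_differentiable _ (su d Ad)); first exact: (cset_open hA).
    by rewrite (transE hA)//; exact: cset_point.
  - by move=> b; apply: smooth_derivable (trans_smooth hA b Ac Ad) _; exact: cset_point.
have n0 := det_Jac_neq0 hA Ac Ad cx dx.
have dX := divergence_change vX Ac Ad cx dx; rewrite -/y -/z in dX.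
have dw a : partial a (wt c d) y =
    2^-1 * (wt c d y * (partial a (fun z => \det (Jac c d z)) y / \det (Jac c d y))).
  by apply: (mulIf n0); rewrite partial_wt//; rewrite -/y; field.
rewrite /lie (tX c d x)// (tu c d x)// -/y -/z.
have -> : divergence X d z = divergence X c y +
    \sum_(a < 4) X c y 0 a * (partial a (fun z => \det (Jac c d z)) y / \det (Jac c d y)).
  apply: (mulIf n0); rewrite dX mulrDl; congr (_ + _); rewrite mulr_suml; apply: eq_bigr => a _.
  by rewrite -mulrA divfK.
under eq_bigr => a _ do rewrite duc dw mulrDr.
rewrite big_split /=.
have -> : \sum_(a < 4) X c y 0 a * (wt c d y * (\sum_(b < 4) Jac c d y a b * partial b (u d) z)) =
    wt c d y * \sum_(b < 4) (X c y *m Jac c d y) 0 b * partial b (u d) z.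
  rewrite mulr_sumr; under [RHS]eq_bigr => b _ do rewrite mxE mulr_suml mulr_sumr.
  rewrite exchange_big /=; apply: eq_bigr => a _; rewrite !mulr_sumr.
  by apply: eq_bigr => b _; ring.
have -> : \sum_(a < 4) X c y 0 a * (2^-1 * (wt c d y *
    (partial a (fun z => \det (Jac c d z)) y / \det (Jac c d y))) * u d z) =
  2^-1 * (wt c d y * u d z) *
   \sum_(a < 4) X c y 0 a * (partial a (fun z => \det (Jac c d z)) y / \det (Jac c d y)).
  by rewrite mulr_sumr; apply: eq_bigr => a _; ring.
ring.
Qed.

Lemma real_hdZ U (k : R) u : open U -> real_hd U u -> real_hd U (fun c y => k * u c y).
Proof.
move=> oU [su tu]; split=> [c Ac|c d x Ac Ad Ux cx dx].
  apply: smoothM; [exact: (cset_open hA)|exact: smooth_cst|exact: su].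
by rewrite (tu c d x)//; ring.
Qed.

Lemma real_hdD U u u' : open U -> real_hd U u -> real_hd U u' -> real_hd U (fun c y => u c y + u' c y).
Proof.
move=> oU [su tu] [su' tu']; split=> [c Ac|c d x Ac Ad Ux cx dx].
  apply: smoothD; [exact: (cset_open hA)|exact: su|exact: su'].
by rewrite (tu c d x)// (tu' c d x)//; ring.
Qed.

Lemma real_hd_sum (I : Type) (r : seq I) U (F : I -> coord_field R M R) : open U ->
  (forall i, real_hd U (F i)) -> real_hd U (fun c y => \sum_(i <- r) F i c y).
Proof.
move=> oU sF; elim: r => [|i r IH].
  split=> [c Ac|c d x Ac Ad Ux cx dx]; last by rewrite !big_nil mulr0.
  by apply: smooth_ext (smooth_cst _ 0) => [|y _]; [exact: (cset_open hA)|rewrite big_nil].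
have [s t] := real_hdD oU (sF i) IH; split=> [c Ac|c d x Ac Ad Ux cx dx].
  by apply: smooth_ext (s c Ac) => [|y _]; [exact: (cset_open hA)|rewrite big_cons].
by rewrite !big_cons; exact: t.
Qed.

Lemma half_densityP U (v : coord_field R M 'cV[C]_2) :
  half_density A U v <-> forall i, real_hd U (fun c y => complex.Re (v c y i 0)) /\
                                   real_hd U (fun c y => complex.Im (v c y i 0)).
Proof.
split=> [[sv tv] i|H].
  split; split=> [c Ac|c d x Ac Ad Ux cx dx]; try by have [] := sv c i Ac.
    by rewrite (tv c d x)// mxE ReM mul0r subr0.
  by rewrite (tv c d x)// mxE ImM mul0r addr0.
split=> [c i Ac|c d x Ac Ad Ux cx dx].
  by have [[sr _] [si _]] := H i; split; [exact: sr|exact: si].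
apply/colP => i; have [[_ tr] [_ ti]] := H i; rewrite mxE.
apply: complex_ext; first by rewrite (tr c d x)// ReM mul0r subr0.
by rewrite (ti c d x)// ImM mul0r addr0.
Qed.

End LieDerivative.

(** * The operator of a tetrad *)

Lemma ReMc {R : realType} (k : R[i]) (x y : R) :
  complex.Re (k * (x +i* y)) = complex.Re k * x + - complex.Im k * y.
Proof. by rewrite ReM mulNr. Qed.

Lemma ImMc {R : realType} (k : R[i]) (x y : R) :
  complex.Im (k * (x +i* y)) = complex.Re k * y + complex.Im k * x.
Proof. by rewrite ImM. Qed.

Lemma mulii {R : realType} (z : R[i]) (X : 'M[R[i]]_2) :
  'i *: (z *: (- 'i *: X)) = z *: X.
Proof.
have ii : 'i * - 'i = 1 :> R[i] by rewrite mulrN -expr2 sqr_i opprK.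
by apply/matrixP => i j; rewrite !mxE mulrCA (mulrA 'i) ii mul1r.
Qed.

Section DiracOperator.
Context {R : realType} {M : topologicalType} (A : set (chart R M)).
Hypothesis hA : maximal_atlas A.
Local Notation C := R[i].
Context (e : 'I_4 -> coord_field R M 'rV[R]_4).
Hypothesis ve : forall j, is_vector A (e j).
Implicit Types (c d : chart R M) (x : M) (U : set M).

(** The principal symbol is [s^j e_j]; the zero order term [G] is half the
    divergence of [F], so that the subprincipal symbol vanishes. When the tetrad is
    a framing this is the Weyl (massless Dirac) operator up to zero order terms. *)
Definition weyl_op : operator R M := Operator
  (fun a c y => - 'i *: herm (\row_j e j c y 0 a))
  (fun c y => (2^-1)%:C%C *: \sum_(a < 4) \matrix_(i < 2, l < 2)
     cpartial a (fun z => (- 'i *: herm (\row_j e j c z 0 a)) i l) y).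

Definition weyl_coef (j : 'I_4) (i l : 'I_2) : C := - 'i * pauli j i l.

Lemma weyl_FE a c y i l :
  opF weyl_op a c y i l = \sum_j weyl_coef j i l * (e j c y 0 a)%:C%C.
Proof.
rewrite mxE /herm summxE mulr_sumr; apply: eq_bigr => j _.
by rewrite !mxE /weyl_coef; ring.
Qed.

Lemma weyl_F_smooth a c i l : A c -> csmooth_on (cimg c) (fun y => opF weyl_op a c y i l).
Proof.
move=> Ac; have oU := cimg_open hA Ac.
apply: (@csmooth_ext _ _ _ oU (fun y => \sum_j weyl_coef j i l * (e j c y 0 a)%:C%C)).
  by move=> y _; rewrite weyl_FE.
apply: csmooth_sum => // j; apply: csmoothM => //; first exact: csmooth_cst.
by apply: csmooth_real; exact: (ve j).1.
Qed.

Lemma weyl_GE c y i l : A c -> cimg c y ->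
  opG weyl_op c y i l = \sum_j weyl_coef j i l * (2^-1 * divergence (e j) c y)%:C%C.
Proof.
move=> Ac cy; have oU := cimg_open hA Ac.
have sE j a : csmooth_on (cimg c) (fun z => (e j c z 0 a)%:C%C).
  by apply: csmooth_real; exact: (ve j).1.
rewrite mxE summxE.
under eq_bigr => a _.
  rewrite mxE (_ : (fun z => _) = fun z => \sum_j weyl_coef j i l * (e j c z 0 a)%:C%C); last first.
    by apply/funext => z; rewrite -weyl_FE.
  rewrite (@cpartial_sum _ _ (cimg c))//; last first.
    by move=> j; apply: csmoothM => //; exact: csmooth_cst.
  under eq_bigr => j _ do rewrite (@cpartialZ _ _ (cimg c))// cpartial_real.
  over.
rewrite exchange_big mulr_sumr; apply: eq_bigr => j _ /=.
by rewrite -mulr_sumr mulrCA; congr (_ * _); rewrite /divergence -rmorph_sum -rmorphM.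
Qed.

Lemma weyl_G_smooth c i l : A c -> csmooth_on (cimg c) (fun y => opG weyl_op c y i l).
Proof.
move=> Ac; have oU := cimg_open hA Ac.
apply: (@csmooth_ext _ _ _ oU (fun y => \sum_j weyl_coef j i l * (2^-1 * divergence (e j) c y)%:C%C)).
  by move=> y cy; rewrite weyl_GE.
apply: csmooth_sum => // j; apply: csmoothM => //; first exact: csmooth_cst.
apply: csmooth_real; apply: smoothM => //; first exact: smooth_cst.
by apply: smooth_sum => // a _; apply: smooth_partial; exact: (ve j).1.
Qed.

(** The operator is [- i s^j] times the Lie derivatives along [e_j], hence well
    defined on half-densities. *)
Lemma weyl_apply (v : coord_field R M 'cV[C]_2) c y i : A c -> cimg c y ->
  op_apply weyl_op v c y i 0 = \sum_l \sum_j weyl_coef j i l *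
    (lie (e j) (fun c y => complex.Re (v c y l 0)) c y +i*
     lie (e j) (fun c y => complex.Im (v c y l 0)) c y).
Proof.
move=> Ac cy; rewrite /op_apply mxE summxE.
under eq_bigr => a _ do rewrite mxE.
rewrite exchange_big mxE -big_split /=; apply: eq_bigr => l _.
rewrite (weyl_GE _ _ Ac cy) mulr_suml.
under eq_bigr => a _ do rewrite weyl_FE mxE mulr_suml.
rewrite exchange_big -big_split /=; apply: eq_bigr => j _.
under eq_bigr => a _ do rewrite -mulrA.
rewrite -mulr_sumr -mulrA -mulrDr; congr (_ * _).
apply: complex_ext; rewrite /= ?ReD ?ImD ?Re_sum ?Im_sum /lie; congr (_ + _).
- by apply: eq_bigr => a _; rewrite ReM /= mul0r subr0.
- by rewrite ReM /= mul0r subr0 mulrA.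
- by apply: eq_bigr => a _; rewrite ImM /= mul0r addr0.
- by rewrite ImM /= mul0r addr0 mulrA.
Qed.

Lemma weyl_half_density U (v : coord_field R M 'cV[C]_2) : open U ->
  half_density A U v -> half_density A U (op_apply weyl_op v).
Proof.
move=> oU /(half_densityP A) hv; apply/half_densityP => i.
have hr l j : real_hd A U (lie (e j) (fun c y => complex.Re (v c y l 0))).
  by apply: lie_real_hd => //; exact: (hv l).1.
have hi l j : real_hd A U (lie (e j) (fun c y => complex.Im (v c y l 0))).
  by apply: lie_real_hd => //; exact: (hv l).2.
have ext (u u' : coord_field R M R) : (forall c y, A c -> cimg c y -> u c y = u' c y) ->
    real_hd A U u -> real_hd A U u'.
  move=> uu' [su tu]; split=> [c Ac|c d x Ac Ad Ux cx dx].
    apply: smooth_ext (su c Ac); first exact: (cset_open hA).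
    by move=> y /cset_cimg cy; exact: uu'.
  by rewrite -!uu'//; [exact: tu|exact: cimg_cmap|exact: cimg_cmap].
split.
- apply: (@ext (fun c y => \sum_l \sum_j
     (complex.Re (weyl_coef j i l) * lie (e j) (fun c y => complex.Re (v c y l 0)) c y +
      - complex.Im (weyl_coef j i l) * lie (e j) (fun c y => complex.Im (v c y l 0)) c y))).
    move=> c y Ac cy; rewrite weyl_apply// Re_sum; apply: eq_bigr => l _.
    by rewrite Re_sum; apply: eq_bigr => j _; rewrite ReMc.
  apply: real_hd_sum => // l; apply: real_hd_sum => // j.
  by apply: real_hdD => //; exact: real_hdZ.
- apply: (@ext (fun c y => \sum_l \sum_j
     (complex.Re (weyl_coef j i l) * lie (e j) (fun c y => complex.Im (v c y l 0)) c y +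
      complex.Im (weyl_coef j i l) * lie (e j) (fun c y => complex.Re (v c y l 0)) c y))).
    move=> c y Ac cy; rewrite weyl_apply// Im_sum; apply: eq_bigr => l _.
    by rewrite Im_sum; apply: eq_bigr => j _; rewrite ImMc.
  apply: real_hd_sum => // l; apply: real_hd_sum => // j.
  by apply: real_hdD => //; exact: real_hdZ.
Qed.

Lemma weyl_diffop : is_diffop A weyl_op.
Proof.
split=> [c a i j Ac|c i j Ac|U v oU]; first exact: weyl_F_smooth.
  exact: weyl_G_smooth.
exact: weyl_half_density.
Qed.

Lemma weyl_tetrad : is_tetrad A weyl_op e.
Proof.
move=> c y p Ac cy; rewrite /Lprin /= scaler_sumr.
rewrite (eq_bigr (fun a => (p 0 a)%:C%C *: herm (\row_j e j c y 0 a))); last by move=> a _; exact: mulii.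
under eq_bigr => a _ do rewrite /herm scaler_sumr.
rewrite exchange_big /=; apply: eq_bigr => j _.
rewrite !mxE rmorph_sum scaler_suml; apply: eq_bigr => a _.
by rewrite scalerA !mxE rmorphM.
Qed.

End DiracOperator.

(** * Framings as admissible operators *)

Section AdmissibleOperator.
Context {R : realType} {M : topologicalType} (A O : set (chart R M)).
Context (g : coord_field R M 'M[R]_4) (q : coord_field R M 'rV[R]_4).
Context (ctop ctem : int) (b : 'I_4 -> coord_field R M 'rV[R]_4).
Hypothesis hA : maximal_atlas A.
Hypothesis hg : lorentz_metric A g.
Hypothesis hO : orientation A O.
Hypothesis hqt : cotimelike A g q.
Hypothesis hb : is_framing A O g q ctop ctem b.
Context (f : M -> 'M[R]_4).
Hypothesis sf : smooth_mx A f.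
Hypothesis Sf : forall x, SOplus (f x).
Implicit Types (c d : chart R M) (x : M).

(** The framing whose map into the Lorentz group, relative to [b], is [f]. *)
Definition turned_frame (k : 'I_4) : coord_field R M 'rV[R]_4 :=
  fun c y => \sum_(j < 4) f (cinv c y) j k *: b j c y.

Lemma turned_frame_vector k : is_vector A (turned_frame k).
Proof.
have [vb _ _ _] := hb; split=> [c a Ac|c d x Ac Ad cx dx].
  have oU := cimg_open hA Ac.
  apply: (@smooth_ext _ _ _ (fun y => \sum_(j < 4) f (cinv c y) j k * b j c y 0 a)) => //.
    by move=> y _; rewrite summxE; apply: eq_bigr => j _; rewrite mxE.
  apply: smooth_sum => // j _; apply: smoothM => //; first exact: sf.
  exact: (vb j).1.
rewrite /turned_frame !(cmapK hA)// mulmx_suml; apply: eq_bigr => j _.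
have [_ /(_ c d x Ac Ad cx dx) ->] := vb j.
by rewrite -scalemxAl.
Qed.

Lemma turned_frame_mx c y : frame_mx turned_frame c y = (f (cinv c y))^T *m frame_mx b c y.
Proof.
apply/matrixP => k a; rewrite !mxE summxE; apply: eq_bigr => j _.
by rewrite !mxE.
Qed.

Lemma turned_frame_props c x : A c -> cdom c x ->
  [/\ frame_mx turned_frame c (cmap c x) *m g c (cmap c x) *m (frame_mx turned_frame c (cmap c x))^T = eta,
      O c -> sgz (\det (frame_mx turned_frame c (cmap c x))) = ctop &
      sgz ((q c (cmap c x) *m (turned_frame ord_max c (cmap c x))^T) 0 0) = ctem].
Proof.
move=> Ac cx; have eE := turned_frame_mx c (cmap c x); rewrite (cmapK hA)// in eE.
have cy := cimg_cmap cx; split.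
- rewrite eE trmx_mul trmxK -!mulmxA (mulmxA (frame_mx b c _)) (mulmxA (frame_mx b c _ *m _)).
  rewrite (framing_orthonormal hb Ac cy) mulmxA.
  exact: SOplus_Lorentz (Sf x).
- move=> Oc; rewrite eE det_mulmx det_tr sgzM gtr0_sgz ?mul1r.
    by have [_ _ h _] := hb; exact: h.
  exact: (SOplus_pos (Sf x)).1.
- rewrite time_pairing eE trmx_mul trmxK mulmxA.
  rewrite (time_dominates (cotimelike_frame hg hqt hb Ac cy) (SOplus_Lorentz (Sf x)) (SOplus_pos (Sf x)).2).
  by rewrite -time_pairing; have [_ _ _ h] := hb; exact: h.
Qed.

Lemma weyl_is_fL : is_fL A b (weyl_op turned_frame) f.
Proof.
split => //; exists turned_frame; first exact: weyl_tetrad.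
by move=> c x k Ac cx; rewrite /turned_frame (cmapK hA).
Qed.

(** The symbol is [herm] of the components of the covector in the turned frame, so
    non-degeneracy, the metric and the charges are read off from that frame. *)
Lemma weyl_admissible : formally_selfadjoint A (weyl_op turned_frame) ->
  admissible A O g q ctop ctem (weyl_op turned_frame).
Proof.
move=> sa; have te : is_tetrad A (weyl_op turned_frame) turned_frame by exact: weyl_tetrad.
have tv := turned_frame_vector.
have OA c : O c -> A c by have [h _ _] := hO; exact: h.
have orth c y : A c -> cimg c y ->
    frame_mx turned_frame c y *m g c y *m (frame_mx turned_frame c y)^T = eta.
  by move=> Ac [x cx <-]; have [] := turned_frame_props Ac cx.
split.
- by split => //; exact: weyl_diffop.
- move=> c y p Ac cy; rewrite (Lprin_herm _ te)//; apply: contra_neq => h0.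
  have uE : (frame_mx turned_frame c y)^T \in unitmx.
    rewrite unitmx_tr; have ug := metric_unit hg Ac cy.
    have := orth c y Ac cy => h.
    have : frame_mx turned_frame c y *m (g c y *m (frame_mx turned_frame c y)^T *m eta) = 1%:M.
      by rewrite !mulmxA h eta2.
    by case/mulmx1_unit.
  apply: (can_inj (mulmxK uE)); rewrite mul0mx; apply: herm_inj; rewrite h0.
  by rewrite /herm big1// => j _; rewrite mxE scale0r.
- move=> c y p Ac cy; rewrite (Lprin_herm _ te)// det_herm; congr (- _)%:C%C.
  have ug := metric_unit hg Ac cy.
  have /(frame_inverse _ ug) <- := orth c y Ac cy.
  by rewrite trmx_mul trmxK !mulmxA.
- exists turned_frame => // c y Oc [x cx <-].
  by have [_ h _] := turned_frame_props (OA c Oc) cx; exact: h.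
- move=> c y Ac cy; rewrite (Lprin_herm _ te)//.
  set w := q c y *m _; rewrite (_ : complex.Re (\tr (herm w)) = 2 * w 0 o3); last first.
    by rewrite /mxtrace sum2 ReD hermE !mxE /=; ring.
  rewrite sgzM gtr0_sgz// mul1r /w -time_pairing.
  by move: cy => [x cx <-]; have [] := turned_frame_props Ac cx.
Qed.

End AdmissibleOperator.
Definition cat_fam (T : Type) n m (f : 'I_n -> T) (g : 'I_m -> T) (i : 'I_(n + m)) : T :=
  match fintype.split i with inl j => f j | inr j => g j end.

Lemma cat_famL (T : Type) n m (f : 'I_n -> T) (g : 'I_m -> T) i : cat_fam f g (lshift m i) = f i.
Proof. by rewrite /cat_fam -[lshift m i]/(unsplit (inl i)) unsplitK. Qed.

Lemma cat_famR (T : Type) n m (f : 'I_n -> T) (g : 'I_m -> T) i : cat_fam f g (rshift n i) = g i.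
Proof. by rewrite /cat_fam -[rshift n i]/(unsplit (inr i)) unsplitK. Qed.

(** * Partitions of unity on compact sets *)

Section PartitionOfUnity.
Context {R : realType} {M : topologicalType} (A : set (chart R M)).
Hypothesis hM : hausdorff_space M.
Hypothesis hA : maximal_atlas A.
Implicit Types (c d : chart R M) (x : M) (B K U : set M) (psi : M -> R).

(** Multiplication by such functions splits densities into pieces that can be
    integrated in one chart. *)
Definition cutoff c psi : Prop :=
  [/\ A c, smooth_fun A psi &
      exists K, [/\ compact K, K `<=` cdom c & forall x, ~ K x -> psi x = 0]].

Lemma box_bump (y0 : 'rV[R]_4) (r : R) : 0 < r ->
  exists beta : 'rV[R]_4 -> R,
  [/\ smooth_on setT beta,
      forall y : 'rV[R]_4, (forall a, `|y 0 a - y0 0 a| <= r / 2) -> beta y = 1 &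
      forall y : 'rV[R]_4, beta y != 0 -> forall a, `|y 0 a - y0 0 a| <= r].
Proof.
move=> r0; pose s (y : 'rV[R]_4) a := (y 0 a - y0 0 a) * r^-1.
have sE y a : `|s y a| = `|y 0 a - y0 0 a| / r by rewrite normrM (gtr0_norm (_ : 0 < r^-1))// invr_gt0.
(* [2 - 2 s ^ 2] is at least [1] for [|s| <= 1 / 2] and at most [0] for [1 <= |s|] *)
exists (fun y => \prod_(a < 4) step (2 - 2 * (s y a * s y a))); split.
- apply: smooth_prod; first exact: openT.
  move=> a _; apply: smooth_step; first exact: openT.
  have ss : smooth_on setT (fun y => s y a).
    apply: smoothM; [exact: openT| |exact: smooth_cst].
    by apply: smoothB; [exact: openT|exact: smooth_coord|exact: smooth_cst].
  apply: smoothB; [exact: openT|exact: smooth_cst|].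
  apply: smoothM; [exact: openT|exact: smooth_cst|].
  by apply: smoothM; [exact: openT| |].
- move=> y hy; apply: big1 => a _; apply: step1.
  have : `|s y a| <= 2^-1 by rewrite sE ler_pdivrMr// mulrC hy.
  by rewrite ler_norml => /andP[h1 h2]; nra.
- move=> y /prodf_neq0 hy a; have := hy a isT; apply: contraNT; rewrite -ltNge => ha.
  apply/eqP; apply: step0.
  have : 1 < `|s y a| by rewrite sE ltr_pdivlMr// mul1r.
  have : s y a * s y a = `|s y a| * `|s y a| by rewrite -normrM ger0_norm// -expr2 sqr_ge0.
  by move=> -> ?; nra.
Qed.

(** A bump function in the coordinates, extended by zero. The extension is smooth
    because its support is compact, hence closed in a Hausdorff space. *)
Lemma local_cutoff x : exists c psi, cutoff c psi /\ \forall z \near x, psi z = 1.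
Proof.
have [c Ac cx] := chart_at hA x; set y0 := cmap c x.
have /nbhs_ballP[e e0 be] : nbhs y0 (cimg c).
  by apply: open_nbhs_nbhs; split; [exact: (cimg_open hA Ac)|exact: cimg_cmap].
pose r := e / 2; have r0 : 0 < r by rewrite divr_gt0.
have [beta [sb b1 b0]] := box_bump y0 r0.
pose box := [set y : 'rV[R]_4 | forall a, `[y0 0 a - r, y0 0 a + r]%classic (y 0 a)].
have cbox : compact box.
  have := @rV_compact _ 4 (fun a : 'I_4 => `[y0 0 a - r, y0 0 a + r]%classic).
  by apply => a; exact: segment_compact.
have boxP y : box y <-> forall a, `|y 0 a - y0 0 a| <= r.
  by split=> h a; have := h a; rewrite /= in_itv/= ler_distl.
have sbox : box `<=` cimg c.
  move=> y /boxP hy; apply: be; split=> // i a; rewrite (ord1 i) /ball /= distrC.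
  by apply: le_lt_trans (hy a) _; move: e0 => /= e0; rewrite /r; lra.
pose psi z := if z \in cdom c then beta (cmap c z) else 0.
pose K := cinv c @` box.
have cK : compact K.
  apply: continuous_compact => //; apply: continuous_in_subspaceT => y /set_mem /sbox cy.
  exact: (cinv_continuous hA).
have KS : K `<=` cdom c by move=> _ [y /sbox cy <-]; exact: (cinv_dom hA).
have psi0 z : ~ K z -> psi z = 0.
  rewrite /psi; case: ifPn => // /set_mem cz nK; apply/eqP; apply: contrapT => /negP h.
  apply: nK; exists (cmap c z); last exact: (cmapK hA).
  by apply/boxP; exact: b0.
exists c, psi; split; last first.
  have oc := cdom_open hA Ac.
  have nb : \forall z \near x, ball y0 (r / 2) (cmap c z).
    by apply: (cmap_continuous hA Ac cx); apply: nbhsx_ballx; rewrite divr_gt0.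
  near=> z; rewrite /psi mem_set; last by near: z; exact: open_near.
  apply: b1 => a; rewrite distrC; apply/ltW.
  have [_ /(_ 0 a)] : ball y0 (r / 2) (cmap c z) by near: z; exact: nb.
  by [].
split => //; last by exists K.
apply: (smooth_fun_at hA) => z; have [cz|ncz] := pselect (cdom c z).
  exists c, (cdom c); split => //; first exact: (cdom_open hA).
  apply: smooth_ext (smooth_sub (@subsetT _ _) sb).
    by apply: (cset_open hA) => //; exact: (cdom_open hA).
  move=> y; rewrite cset_dom => cy; rewrite /psi mem_set; last exact: (cinv_dom hA).
  by rewrite (cinvK hA).
have [d Ad dz] := chart_at hA z.
have oU : open (cdom d `&` ~` K).
  apply: openI; first exact: (cdom_open hA).
  by apply: closed_openC; exact: compact_closed.
exists d, (cdom d `&` ~` K); split => //.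
- by split => // /KS.
- apply: smooth_ext (@smooth_cst _ _ _ 0); first exact: (cset_open hA).
  by move=> y /(csetP hA _ _ Ad)[_ [_ nK]]; rewrite psi0.
Unshelve. all: by end_near. Qed.

Definition unity_on B : Prop :=
  exists (n : nat) (c : 'I_n -> chart R M) (chi : 'I_n -> M -> R),
    (forall i, cutoff (c i) (chi i)) /\ forall x, B x -> \sum_(i < n) chi i x = 1.

Lemma unity_sub B B' : B `<=` B' -> unity_on B' -> unity_on B.
Proof. by move=> BB' [n [c [chi [h s]]]]; exists n, c, chi; split=> // x /BB'; exact: s. Qed.

Lemma smooth_funM psi1 psi2 :
  smooth_fun A psi1 -> smooth_fun A psi2 -> smooth_fun A (fun x => psi1 x * psi2 x).
Proof.
by move=> h1 h2 c Ac; apply: smoothM; [exact: (cimg_open hA)|exact: h1|exact: h2].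
Qed.

(** The functions for [B2] are multiplied by [1 - s], where [s] is the sum of the
    functions for [B1]; on [B1] this factor is [0], and on [B2] the total is
    [s + (1 - s)]. *)
Lemma unityU B1 B2 : unity_on B1 -> unity_on B2 -> unity_on (B1 `|` B2).
Proof.
move=> [n1 [c1 [chi1 [h1 s1]]]] [n2 [c2 [chi2 [h2 s2]]]].
pose rest x := 1 - \sum_i chi1 i x.
have srest : smooth_fun A rest.
  move=> c Ac; have oU := cimg_open hA Ac.
  apply: smoothB => //; first exact: smooth_cst.
  by apply: smooth_sum => // i _; have [_ h _] := h1 i; exact: h.
exists (n1 + n2)%N, (cat_fam c1 c2), (cat_fam chi1 (fun i x => rest x * chi2 i x)); split.
  move=> i; case: (split_ordP i) => j ->; rewrite ?cat_famL ?cat_famR; first exact: h1.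
  have [Ac sc [K [cK KS K0]]] := h2 j.
  split => //; first exact: smooth_funM.
  by exists K; split => // x /K0 ->; rewrite mulr0.
move=> x Bx; rewrite big_split_ord /=.
under eq_bigr => i _ do rewrite cat_famL.
under [X in _ + X]eq_bigr => i _ do rewrite cat_famR.
rewrite -mulr_sumr /rest; case: Bx => [/s1 ->|/s2 ->]; first by rewrite subrr mul0r addr0.
by rewrite mulr1 addrC subrK.
Qed.

(** If [K] had no such functions, the sets [B] for which [K \ B] has them would form
    a proper filter, by [unityU]. It would cluster at a point of [K], near which
    [local_cutoff] gives a contradiction. *)
Lemma unity_compact K : compact K -> unity_on K.
Proof.
move=> cK; apply: contrapT => nK.
have u0 : unity_on set0.
  have no (i : 'I_0) : False by case: i.
  by exists 0%N, (fun i => False_rect _ (no i)), (fun i => False_rect _ (no i)); split=> // i.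
pose F := [set B : set M | unity_on (K `\` B)].
have FF : ProperFilter F.
  split.
    by rewrite /F /= setD0.
  split; rewrite /F /=.
  - by rewrite setDT.
  - by move=> P Q uP uQ; rewrite /= setDIr; exact: unityU.
  - by move=> P Q PQ; apply: unity_sub => x [Kx nQ]; split=> // /PQ.
have FK : F K by rewrite /F /= setDv.
have [x [Kx clx]] := cK F FF FK.
have [c [psi [hc near1]]] := local_cutoff x.
have ux : unity_on [set z | psi z = 1].
  exists 1%N, (fun=> c), (fun=> psi); split => // z /= <-.
  by rewrite big_ord1.
have : F (~` [set z | psi z = 1]).
  by rewrite /F /=; apply: unity_sub ux => z [_ /contrapT].
by move=> /clx /(_ near1) [z [h1 h2]].
Qed.

End PartitionOfUnity.

(** * Formal self-adjointness *)

Section SelfAdjointness.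
Context {R : realType} {M : topologicalType} (A : set (chart R M)).
Hypothesis hM : hausdorff_space M.
Hypothesis hA : maximal_atlas A.
Local Notation C := R[i].
Local Notation hd := (half_density A setT).
Implicit Types (c d : chart R M) (x : M) (K U : set M) (v w : coord_field R M 'cV[C]_2).

Definition scale_field (psi : M -> R) v : coord_field R M 'cV[C]_2 :=
  fun c y => (psi (cinv c y))%:C%C *: v c y.

Definition pairing v w : coord_field R M C := fun c y => (adjmx (w c y) *m v c y) 0 0.

Lemma half_density_csmooth v c i : hd v -> A c -> csmooth_on (cimg c) (fun y => v c y i 0).
Proof. by move=> [sv _] Ac; rewrite -(cset_setT c); exact: sv. Qed.

Lemma pairingE v w c y : pairing v w c y = \sum_i (w c y i 0)^*%C * v c y i 0.
Proof. by rewrite /pairing mxE; apply: eq_bigr => i _; rewrite !mxE. Qed.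

Lemma scale_half_density psi v : smooth_fun A psi -> hd v -> hd (scale_field psi v).
Proof.
move=> sp hv; split=> [c i Ac|c d x Ac Ad _ cx dx].
  have oU := cimg_open hA Ac; rewrite -/(cset c setT) cset_setT.
  apply: (@csmooth_ext _ _ _ oU (fun y => (psi (cinv c y))%:C%C * v c y i 0)).
    by move=> y _; rewrite mxE.
  by apply: csmoothM => //; [apply: csmooth_real; exact: sp|exact: half_density_csmooth].
have [_ /(_ c d x Ac Ad I cx dx) tv] := hv.
by rewrite /scale_field tv !(cmapK hA)// !scalerA mulrC.
Qed.

Lemma pairing_density v w : hd v -> hd w -> density A (pairing v w).
Proof.
move=> hv hw; split=> [c Ac|c d x Ac Ad cx dx].
  have oU := cimg_open hA Ac.
  by apply: csmooth_mulmx => // [i j|i j]; [apply: csmooth_adjmx => // k l; rewrite ord1|rewrite ord1];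
     exact: half_density_csmooth.
rewrite !pairingE mulr_sumr; apply: eq_bigr => i _.
have [_ /(_ c d x Ac Ad I cx dx) ->] := hv; have [_ /(_ c d x Ac Ad I cx dx) ->] := hw.
set t := Num.sqrt _; have tt : `|\det (Jac c d (cmap c x))| = t * t.
  by rewrite -expr2 sqr_sqrtr.
rewrite tt !mxE; case: (w _ _ i 0) => a b; case: (v _ _ i 0) => p q.
by apply: complex_ext => /=; ring.
Qed.

Lemma densityB (m m' : coord_field R M C) : density A m -> density A m' ->
  density A (fun c y => m c y - m' c y).
Proof.
move=> [sm tm] [sm' tm']; split=> [c Ac|c d x Ac Ad cx dx].
  have oU := cimg_open hA Ac; apply: csmoothD => //; first exact: sm.
  by apply: csmoothN => //; exact: sm'.
by rewrite mulrBr -tm// -tm'.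
Qed.

Lemma cpartial_opp a (f f' : 'rV[R]_4 -> C) (U : set 'rV[R]_4) y :
  csmooth_on U f -> U y -> (forall z, f' z = - f z) -> cpartial a f' y = - cpartial a f y.
Proof.
move=> sf Uy h; have -> : f' = fun z => -1 * f z by apply/funext => z; rewrite h mulN1r.
by rewrite (cpartialZ _ _ sf Uy) mulN1r.
Qed.

Lemma mulmx_col (X : 'M[C]_2) (f : 'I_2 -> C) i : (X *m \col_j f j) i 0 = \sum_l X i l * f l.
Proof. by rewrite mxE; apply: eq_bigr => l _; rewrite mxE. Qed.

Lemma op_apply_ext (L : operator R M) v w c (U : set 'rV[R]_4) y : open U -> U y ->
  (forall z, U z -> v c z = w c z) -> op_apply L v c y = op_apply L w c y.
Proof.
move=> oU Uy vw; rewrite /op_apply vw//; congr (_ + _); apply: eq_bigr => a _; congr (_ *m _).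
by apply/matrixP => i j; rewrite !mxE; apply: (cpartial_ext oU a Uy) => z Uz; rewrite vw.
Qed.

Lemma op_apply_sum (L : operator R M) n (v : 'I_n -> coord_field R M 'cV[C]_2) c y :
  A c -> cimg c y -> (forall i, hd (v i)) ->
  op_apply L (fun c y => \sum_i v i c y) c y = \sum_i op_apply L (v i) c y.
Proof.
move=> Ac cy hv; have oU := cimg_open hA Ac.
rewrite /op_apply big_split /= -mulmx_sumr; congr (_ + _).
rewrite exchange_big /=; apply: eq_bigr => a _; rewrite -mulmx_sumr; congr (_ *m _).
apply/matrixP => i j; rewrite !mxE summxE.
under eq_bigr => k _ do rewrite mxE.
rewrite -(cpartial_sum oU)//; last by move=> k; exact: half_density_csmooth.
by congr cpartial; apply/funext => z; rewrite summxE.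
Qed.

Lemma op_apply_vanishes (L : operator R M) v K : closed K -> vanishes_off A K v ->
  vanishes_off A K (op_apply L v).
Proof.
move=> cK v0 c y Ac cy nK; have oU : open (cset c (~` K)).
  by apply: (cset_open hA) => //; exact: closed_openC.
rewrite (@op_apply_ext L v (fun _ _ => 0) c (cset c (~` K)))//.
- rewrite /op_apply mulmx0 addr0 big1// => a _.
  rewrite (_ : \col_i _ = 0) ?mulmx0//; apply/matrixP => i j; rewrite !mxE.
  by rewrite -[RHS](@cpartial_cst _ _ a 0 y); congr cpartial; apply/funext => z; rewrite mxE.
- by apply/(csetP hA _ _ Ac).
- by move=> z /(csetP hA _ _ Ac)[cz nKz]; exact: v0.
Qed.

Lemma smooth_extend0 (U B : set 'rV[R]_4) h : open U -> compact B -> B `<=` U ->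
  smooth_on U h -> (forall y, U y -> ~ B y -> h y = 0) ->
  smooth_on setT (fun y => if y \in U then h y else 0).
Proof.
move=> oU cB BU sh h0; apply: smooth_local => y _; have [Uy|nUy] := pselect (U y).
  by exists U => //; apply: smooth_ext sh => // z Uz; rewrite mem_set.
exists (~` B); first by move=> /BU.
apply: smooth_ext (@smooth_cst _ _ _ 0).
  by apply: closed_openC; apply: compact_closed => //; exact: norm_hausdorff.
by move=> z nB; case: ifPn => // /set_mem Uz; rewrite h0.
Qed.

Lemma int4_divergence_in (U B : set 'rV[R]_4) (V : 'I_4 -> 'rV[R]_4 -> R) :
  open U -> compact B -> B `<=` U -> (forall a, smooth_on U (V a)) ->
  (forall a y, U y -> ~ B y -> V a y = 0) ->
  int4 (fun y => if y \in U then \sum_a partial a (V a) y else 0) = 0.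
Proof.
move=> oU cB BU sV V0.
pose W a (y : 'rV[R]_4) := if y \in U then V a y else 0.
have W0 a y : ~ B y -> W a y = 0.
  by rewrite /W; case: ifPn => // /set_mem Uy nB; exact: V0.
have sW a : smooth_on setT (W a) by exact: (smooth_extend0 oU cB BU (sV a) (V0 a)).
rewrite -[RHS](int4_divergence cB sW W0).
congr int4; apply/funext => y; case: ifPn => [/set_mem Uy|/negP nUy].
  by apply: eq_bigr => a _; apply: (partial_ext _ oU Uy) => z Uz; rewrite /W mem_set.
rewrite big1// => a _; apply: (@partial_off_closed _ _ B) => //.
- by apply: compact_closed => //; exact: norm_hausdorff.
- exact: W0.
- by move=> /BU /mem_set.
Qed.

Lemma cint4_divergence (U B : set 'rV[R]_4) (V : 'I_4 -> 'rV[R]_4 -> C) (h : 'rV[R]_4 -> C) :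
  open U -> compact B -> B `<=` U -> (forall a, csmooth_on U (V a)) ->
  (forall a y, U y -> ~ B y -> V a y = 0) ->
  (forall y, U y -> h y = \sum_a cpartial a (V a) y) ->
  cint4 (fun y => if y \in U then h y else 0) = 0.
Proof.
move=> oU cB BU sV V0 hE; apply: complex_ext; rewrite /cint4 /=.
- rewrite -[RHS](@int4_divergence_in U B (fun a y => complex.Re (V a y)) oU cB BU).
  + congr int4; apply/funext => y; case: ifPn => // /set_mem Uy.
    by rewrite hE// Re_sum.
  + by move=> a; exact: (sV a).1.
  + by move=> a y Uy nB; rewrite V0.
- rewrite -[RHS](@int4_divergence_in U B (fun a y => complex.Im (V a y)) oU cB BU).
  + congr int4; apply/funext => y; case: ifPn => // /set_mem Uy.
    by rewrite hE// Im_sum.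
  + by move=> a; exact: (sV a).2.
  + by move=> a y Uy nB; rewrite V0.
Qed.

Context (e : 'I_4 -> coord_field R M 'rV[R]_4).
Hypothesis ve : forall j, is_vector A (e j).
Local Notation L := (weyl_op e).

Lemma weyl_F_antiherm a c y i l : (opF L a c y l i)^*%C = - opF L a c y i l.
Proof.
have pauliH j : (pauli j l i)^*%C = pauli j i l :> C.
  move: i l; apply: ord2P; apply: ord2P; move: j; apply: ord4P;
  by rewrite /pauli /= !mxE /=; apply: complex_ext => /=; ring.
rewrite !weyl_FE rmorph_sum -sumrN; apply: eq_bigr => j _.
rewrite /weyl_coef !rmorphM /= pauliH; case: (pauli j i l) => p q.
by apply: complex_ext => /=; ring.
Qed.

(** With [F] anti-Hermitian and [G] half its divergence, [w^* L u - (L w)^* u] is the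
    divergence of [w^* F u]. *)
Lemma weyl_divergence u w c y : hd u -> hd w -> A c -> cimg c y ->
  pairing (op_apply L u) w c y - pairing u (op_apply L w) c y =
  \sum_a cpartial a (fun z => (adjmx (w c z) *m opF L a c z *m u c z) 0 0) y.
Proof.
move=> hu hw Ac cy; have oU := cimg_open hA Ac.
have sF a i l := weyl_F_smooth hA ve a i l Ac.
have su i := half_density_csmooth i hu Ac; have sw i := half_density_csmooth i hw Ac.
pose F a i l := opF L a c y i l; pose dF a i l := cpartial a (fun z => opF L a c z i l) y.
(* the part of [L v] that comes from the coordinate direction [a] *)
pose t v a i := \sum_l (F a i l * cpartial a (fun z => v c z l 0) y + (2^-1)%:C%C * (dF a i l * v c y l 0)).
have LE v i : op_apply L v c y i 0 = \sum_a t v a i.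
  rewrite /op_apply mxE summxE [X in _ + X]mxE.
  under [X in _ + X]eq_bigr => l _ do rewrite mxE summxE -mulrA mulr_suml mulr_sumr.
  rewrite [X in _ + X]exchange_big -big_split; apply: eq_bigr => a _ /=.
  rewrite mulmx_col /t big_split; congr (_ + _).
  by apply: eq_bigr => l _; rewrite mxE.
have dFH a i l : (dF a l i)^*%C = - dF a i l.
  rewrite /dF -(cpartial_conj _ (sF a l i) cy).
  by apply: (cpartial_opp _ (sF a i l) cy) => z; exact: weyl_F_antiherm.
rewrite !pairingE.
under eq_bigr => i _ do rewrite LE mulr_sumr.
under [X in _ - X]eq_bigr => i _ do rewrite LE rmorph_sum mulr_suml.
rewrite exchange_big [X in _ - X]exchange_big -sumrB; apply: eq_bigr => a _ /=.
have -> : cpartial a (fun z => (adjmx (w c z) *m opF L a c z *m u c z) 0 0) y =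
    \sum_l \sum_i ((cpartial a (fun z => w c z i 0) y)^*%C * F a i l * u c y l 0 +
                   (w c y i 0)^*%C * dF a i l * u c y l 0 +
                   (w c y i 0)^*%C * F a i l * cpartial a (fun z => u c z l 0) y).
  rewrite (_ : (fun z => _) = fun z => \sum_l \sum_i (w c z i 0)^*%C * opF L a c z i l * u c z l 0).
    have swF i l : csmooth_on (cimg c) (fun z => (w c z i 0)^*%C * opF L a c z i l).
      by apply: csmoothM => //; exact: csmooth_conj.
    have s1 l i : csmooth_on (cimg c) (fun z => (w c z i 0)^*%C * opF L a c z i l * u c z l 0).
      exact: csmoothM.
    rewrite (cpartial_sum oU)//; last by move=> l; exact: csmooth_sum.
    apply: eq_bigr => l _; rewrite (cpartial_sum oU)//; apply: eq_bigr => i _.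
    rewrite (cpartialM _ (swF i l) (su l) cy) (cpartialM _ (csmooth_conj oU (sw i)) (sF a i l) cy).
    by rewrite (cpartial_conj _ (sw i) cy) mulrDl.
  apply/funext => z; rewrite mxE; apply: eq_bigr => l _; rewrite mxE mulr_suml.
  by apply: eq_bigr => i _; rewrite !mxE.
have FH i l : (F a l i)^*%C = - F a i l by exact: weyl_F_antiherm.
have halfH : ((2^-1 : R)%:C%C)^*%C = (2^-1)%:C%C by apply: complex_ext => /=; rewrite ?oppr0.
have h00 := FH 0 0; have h01 := FH 0 1; have h10 := FH 1 0; have h11 := FH 1 1.
have d00 := dFH a 0 0; have d01 := dFH a 0 1; have d10 := dFH a 1 0; have d11 := dFH a 1 1.
have cD (p r : C) : (p + r)^*%C = p^*%C + r^*%C by rewrite rmorphD.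
have cM (p r : C) : (p * r)^*%C = p^*%C * r^*%C by rewrite rmorphM.
rewrite /t !sum2 !cD !cM halfH h00 h01 h10 h11 d00 d01 d10 d11.
have -> : ((2^-1 : R)%:C%C) = 2^-1 :> C by rewrite rmorphV ?unitfE ?pnatr_eq0// rmorph_nat.
by field.
Qed.

(** The functions [chi i] split [v] into pieces [u i] with support in one chart
    domain. For each piece the densities [w^* L (u i)] and [(L w)^* (u i)] differ by
    a divergence with compact support in that domain, whose integral is zero. Using
    the densities [nu i] for one product, and [nu i] together with these divergences
    [ka i] for the other, the two products have the same value. *)
Lemma weyl_selfadjoint : formally_selfadjoint A L.
Proof.
move=> v w hv hw [K cK v0] _.
have [n [c [chi [hchi s1]]]] := unity_compact hM hA cK.
have hL v' : hd v' -> hd (op_apply L v') by move=> h; apply: (weyl_half_density hA ve openT h).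
pose u i := scale_field (chi i) v.
have hu i : hd (u i) by apply: scale_half_density => //; have [] := hchi i.
have vE d y : A d -> cimg d y -> v d y = \sum_i u i d y.
  move=> Ad dy; rewrite /u /scale_field -scaler_suml -rmorph_sum.
  have [/s1 ->|nK] := pselect (K (cinv d y)); first by rewrite scale1r.
  by rewrite v0// scaler0.
pose nu i := pairing (u i) (op_apply L w).
pose ka i : coord_field R M C := fun d y => pairing (op_apply L (u i)) w d y - nu i d y.
have dnu i : density A (nu i) by apply: pairing_density => //; exact: hL.
have dka i : density A (ka i).
  by apply: densityB => //; apply: pairing_density => //; exact: hL.
have supp i : exists Ki, [/\ compact Ki, Ki `<=` cdom (c i), vanishes_off A Ki (u i) &
    vanishes_off A Ki (op_apply L (u i))].
  have [_ _ [Ki [cKi KiS chi0]]] := hchi i; exists Ki.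
  have u0 : vanishes_off A Ki (u i).
    by move=> d y _ _ /chi0 h; rewrite /u /scale_field h scale0r.
  by split => //; apply: op_apply_vanishes => //; exact: compact_closed.
have nu0 i Ki : vanishes_off A Ki (u i) -> vanishes_off A Ki (nu i).
  by move=> h d y Ad dy nK; rewrite /nu /pairing h// mulmx0 mxE.
have snu i : exists Ki, [/\ compact Ki, Ki `<=` cdom (c i) & vanishes_off A Ki (nu i)].
  by have [Ki [? ? h _]] := supp i; exists Ki; split => //; exact: nu0.
have ska i : exists Ki, [/\ compact Ki, Ki `<=` cdom (c i) & vanishes_off A Ki (ka i)].
  have [Ki [? ? h h']] := supp i; exists Ki; split => // d y Ad dy nK.
  by rewrite /ka (nu0 i Ki)// /pairing h'// mulmx0 mxE subrr.
have Ac i : A (c i) by have [] := hchi i.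
have kint i : cint4 (fun y => if y \in cimg (c i) then ka i (c i) y else 0) = 0.
  have [Ki [cKi KiS u0 _]] := supp i.
  apply: (@cint4_divergence (cimg (c i)) (cmap (c i) @` Ki)
    (fun a z => (adjmx (w (c i) z) *m opF L a (c i) z *m u i (c i) z) 0 0)).
  - exact: (cimg_open hA).
  - apply: continuous_compact => //; apply: continuous_in_subspaceT => x /set_mem /KiS cx.
    exact: (cmap_continuous hA).
  - by move=> _ [x /KiS cx <-]; exact: cimg_cmap.
  - move=> a; have oU := cimg_open hA (Ac i).
    apply: csmooth_mulmx => // j k; last by rewrite ord1; exact: half_density_csmooth.
    apply: csmooth_mulmx => // l m; last exact: (weyl_F_smooth hA ve _ _ _ (Ac i)).
    by apply: csmooth_adjmx => // p r; rewrite ord1; exact: half_density_csmooth.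
  - move=> a y cy nB; rewrite u0// ?mulmx0 ?mxE// => Ky; apply: nB.
    by exists (cinv (c i) y) => //; exact: (cinvK hA).
  - by move=> y cy; rewrite /ka weyl_divergence.
exists (\sum_i cint4 (fun y => if y \in cimg (c i) then nu i (c i) y else 0)).
- exists (n + n)%N, (cat_fam c c), (cat_fam nu ka); split.
  + by move=> i; case: (split_ordP i) => j ->; rewrite ?cat_famL ?cat_famR.
  + by move=> i; case: (split_ordP i) => j ->; rewrite ?cat_famL ?cat_famR.
  + move=> d y Ad dy; rewrite big_split_ord /=.
    under eq_bigr => i _ do rewrite cat_famL.
    under [X in _ + X]eq_bigr => i _ do rewrite cat_famR.
    rewrite -big_split /=.
    under eq_bigr => i _ do rewrite /ka addrC subrK.
    have -> : op_apply L v d y = \sum_i op_apply L (u i) d y.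
      rewrite -(op_apply_sum _ Ad dy)//.
      by apply: (op_apply_ext _ (cimg_open hA Ad) dy) => z dz; exact: vE.
    by rewrite mulmx_sumr summxE.
  + rewrite big_split_ord /= [X in _ = _ + X]big1 ?addr0.
      by apply: eq_bigr => i _; rewrite !cat_famL.
    by move=> i _; rewrite !cat_famR kint.
- exists n, c, nu; split => //.
  by move=> d y Ad dy; rewrite vE// mulmx_sumr summxE.
Qed.

End SelfAdjointness.
(** * The two notions of spin structure *)

Theorem theorem4p1 (R : realType) (M : topologicalType)
  (A O : set (chart R M))
  (g : coord_field R M 'M[R]_4) (q : coord_field R M 'rV[R]_4)
  (ctop ctem : int) (b : 'I_4 -> coord_field R M 'rV[R]_4)
  (hM : smooth_manifold A) (hconn : connected [set: M])
  (hpar : parallelizable A)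
  (hg : lorentz_metric A g) (hto : time_orientable A g)
  (hO : orientation A O)
  (hq : is_covector A q) (hqt : cotimelike A g q)
  (hctop : ctop = 1 \/ ctop = -1) (hctem : ctem = 1 \/ ctem = -1)
  (hb : is_framing A O g q ctop ctem b) :
  exists T : set (operator R M) -> set (M * 'M[R[i]]_2 -> M * 'M[R]_4),
    set_bij (an_spin_structures A O g q ctop ctem) (trad_spin_structures A) T /\
    forall L, admissible A O g q ctop ctem L ->
      (exists! f, is_fL A b L f) /\
      (forall f, is_fL A b L f ->
        equivariant_map A (Phi_of f) /\
        T (an_class A O g q ctop ctem L) = trad_class A (Phi_of f)).
Proof.
have [hH _ hA] := hM.
pose adm L := admissible A O g q ctop ctem L.
have equi L f : is_fL A b L f -> equivariant_map A (Phi_of f).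
  by case=> sf Sf _; exact: Phi_of_equivariant.
have trad_rel f Phi L : is_fL A b L f -> equivariant_map A Phi ->
    trad_equiv A (Phi_of f) Phi <-> Ad_related A (fiber_map Phi) f.
  by move=> /equi eqf eqP; rewrite (trad_equivP hA eqf eqP) fiber_Phi_of.
have an_rel := an_equivP hA hb.
pose T (Cs : set (operator R M)) := [set Phi | exists L f,
  [/\ Cs L, is_fL A b L f & trad_class A (Phi_of f) Phi]].
have TE L f : adm L -> is_fL A b L f ->
    T (an_class A O g q ctop ctem L) = trad_class A (Phi_of f).
  move=> aL Lf; apply/seteqP; split=> [Phi [L' [f' [[aL' LL'] Lf' [eqP rel]]]]|Phi hPhi].
    split => //; apply/(trad_rel _ _ _ Lf eqP).
    apply: (Ad_related_trans hA ((trad_rel _ _ _ Lf' eqP).1 rel)).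
    exact: (Ad_related_sym hA ((an_rel _ _ _ _ Lf Lf').1 LL')).
  exists L, f; split => //; split => //.
  by apply/(an_rel _ _ _ _ Lf Lf); exact: Ad_related_refl.
exists T; split; first split.
- move=> _ [L aL <-]; have [f Lf] := admissible_fL hA hg hO hqt hb aL.
  by rewrite (TE _ _ aL Lf); exists (Phi_of f) => //; exact: equi Lf.
- move=> _ _ /set_mem[L aL <-] /set_mem[L' aL' <-].
  have [f Lf] := admissible_fL hA hg hO hqt hb aL.
  have [f' Lf'] := admissible_fL hA hg hO hqt hb aL'.
  rewrite (TE _ _ aL Lf) (TE _ _ aL' Lf') => TT.
  have : trad_class A (Phi_of f') (Phi_of f').
    split; first exact: equi Lf'.
    by apply/(trad_rel _ _ _ Lf' (equi _ _ Lf')); rewrite fiber_Phi_of; exact: Ad_related_refl.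
  rewrite -TT => -[_ /(trad_rel _ _ _ Lf (equi _ _ Lf'))]; rewrite fiber_Phi_of => f'f.
  have ff' := Ad_related_sym hA f'f.
  apply/seteqP; split=> L2 [aL2 LL2]; split => //;
    have [f2 Lf2] := admissible_fL hA hg hO hqt hb aL2.
    apply/(an_rel _ _ _ _ Lf' Lf2); apply: (Ad_related_trans hA f'f).
    exact/(an_rel _ _ _ _ Lf Lf2).
  apply/(an_rel _ _ _ _ Lf Lf2); apply: (Ad_related_trans hA ff').
  exact/(an_rel _ _ _ _ Lf' Lf2).
- move=> _ [Phi eqP <-].
  have sf := fiber_map_smooth hA eqP; have Sf x := fiber_map_SOplus x eqP.
  pose L := weyl_op (turned_frame b (fiber_map Phi)).
  have Lf : is_fL A b L (fiber_map Phi) by exact: weyl_is_fL.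
  have aL : adm L.
    apply: weyl_admissible => //; apply: weyl_selfadjoint => // k.
    exact: (turned_frame_vector hA hb sf).
  exists (an_class A O g q ctop ctem L); first by exists L.
  rewrite (TE _ _ aL Lf); apply/seteqP; split=> Phi' [eqP' rel]; split => //.
    by apply/(trad_equivP hA eqP eqP'); exact/(trad_rel _ _ _ Lf eqP').
  by apply/(trad_rel _ _ _ Lf eqP'); exact/(trad_equivP hA eqP eqP').
- move=> L aL; split; last first.
    by move=> f Lf; split; [exact: equi Lf|exact: TE].
  have [f Lf] := admissible_fL hA hg hO hqt hb aL.
  by exists f; split => // f' Lf'; exact: (is_fL_unique hA hb Lf Lf').
Qed.
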